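(* Let $X$ be a Banach function space (B.f.s.), let $(\Omega,\Sigma)$ be a measurable space and let $m\colon\Sigma\to X$ be a $\sigma$-additive vector measure. Assume: (a) $X$ has the weak Banach-Saks property. (b) $X$ and its dual $X^*$ have the subsequence splitting property. (c) The measure $m$ is separable and positive, i.e. $m(A)\in X^+$ for $A\in\Sigma$. (d) The range $m(\Sigma)=\{m(A):A\in\Sigma\}$ of $m$ has uniformly absolutely continuous norm in $X$. Then the B.f.s. $L^1(m)$ has both the subsequence splitting property and the weak Banach-Saks property.
   Context: All functions are real-valued. A Banach function space (B.f.s.) $X$ over a measure space $(S,\mathcal{S},\rho)$ is a Banach space of classes of measurable functions on $S$ satisfying the ideal property: $g\in X$ and $\|g\|_X\le\|f\|_X$ whenever $f\in X$ and $|g|\le|f|$ $\rho$-a.e. $X^+$ is the cone of all $f\in X$ satisfying $f\ge0$ $\rho$-a.e. $X$ has absolutely continuous (a.c.) norm if $\lim_{\rho(A)\to0}\|f\chi_A\|_X=0$ for every $f\in X$, where $\chi_A$ is the characteristic function of $A\in\mathcal{S}$. A subset $K\subseteq X$ has uniformly a.c. norm if $\lim_{\rho(A)\to0}\sup_{f\in K}\|f\chi_A\|_X=0$. Subsequence splitting property: a B.f.s. $X$ with a.c. norm over a measure space has this property if for every norm bounded sequence $\{f_n\}\subseteq X$ there are a subsequence $\{f'_n\}$ of $\{f_n\}$ and sequences $\{g_n\}$ and $\{h_n\}$ in $X$ such that: (a) for each $n\in\mathbb{N}$, $f'_n=g_n+h_n$ with $g_n$ and $h_n$ having disjoint support; (b)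 the sequence $\{g_n\}$ has uniformly a.c. norm in $X$; (c) the functions $\{h_n\}$ have pairwise disjoint support. (In particular, having this property includes having a.c. norm.) $X^*$ is the dual Banach space of $X$, regarded as a B.f.s. by identifying it with the associate space of $X$, that is, the space of all measurable functions $g$ satisfying $fg\in L^1(\rho)$ for all $f\in X$, acting by $f\mapsto\int_S fg\,d\rho$. Weak Banach-Saks property: a Banach space has this property if every weakly null sequence in it admits a subsequence whose arithmetic means converge to zero in norm. The space $L^1(m)$: for $x^*\in X^*$ let $x^*m$ be the scalar measure $A\mapsto\langle x^*,m(A)\rangle$ and $|x^*m|$ its variation measure. The semivariation of $m$ is $\|m\|(A):=\sup\{|x^*m|(A):x^*\in B_{X^*}\}$, where $B_{X^*}$ is the closed unit ball of $X^*$. A measurable $f\colon\Omega\to\mathbb{R}$ is $m$-integrable if $f\in L^1(|x^*m|)$ for every $x^*\in X^*$ and, for each $A\in\Sigma$, there exists a vector $\int_A f\,dm\in X$ with $\langle\int_A f\,dm,x^*\rangle=\int_A f\,dx^*m$ for every $x^*\in X^*$. $L^1(m)$ is the space of $m$-integrable functions, identified when they agree $\|m\|$-a.e., with norm $\|f\|_{L^1(m)}:=\sup\{\int_\Omega|f|\,d|x^*m|:x^*\in B_{X^*}\}$. A Rybakov control measure for $m$ is a measure of the form $\eta=|x_0^*m|$ for a suitable $x_0^*\in X^*$ such that $\eta(A)=0$ if and only if $\|m\|(A)=0$; $L^1(m)$ is a B.f.s. over $(\Omega,\Sigma,\eta)$ relative to any Rybakov control measure $\eta$ for $m$. The vector measure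 $m$ is separable if the pseudometric space $(\Sigma,d_m)$, with $d_m(A,B):=\|m\|(A\triangle B)$, is separable, i.e. contains a countable dense subset.
   Formalization: The measure space (S, ρ) underlying X is assumed finite; for infinite ρ the claim fails as worded (X = c_0 over counting measure, m(A) = Σ_{k∈A} 2^{-k} e_k, where every set trivially has uniformly a.c. norm). *)

(* Defs.v *)
From HB Require Import structures.
From mathcomp Require Import all_boot all_order all_algebra.
From mathcomp Require Import all_classical all_reals all_analysis.

Set Implicit Arguments.
Unset Strict Implicit.
Unset Printing Implicit Defensive.

Import Order.TTheory GRing.Theory Num.Theory.
Import numFieldNormedType.Exports.

Local Open Scope classical_set_scope.
Local Open Scope ring_scope.

(* Spaces of classes of functions are handled through representatives: a space
   is a set of real functions with a norm, and equality in the space is equality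
   almost everywhere. The norm is extended-valued so that norms given by a
   supremum need no finiteness proof in order to be defined. *)
Record fspace (T : Type) (R : realType) := FSpace {
  carrier : set (T -> R) ;
  fnorm : (T -> R) -> \bar R }.

Arguments FSpace {T R}.
Arguments carrier {T R}.
Arguments fnorm {T R}.

Section function_spaces.
Context d (T : measurableType d) (R : realType).
Variable rho : {measure set T -> \bar R}.
Implicit Types (E : fspace T R) (f g h : T -> R).

(* The ideal property makes the carrier and the norm invariant under almost
   everywhere equality. *)
Record is_bfs E : Prop := IsBfs {
  bfs_measurable : forall f, carrier E f -> measurable_fun setT f ;
  bfs_zero : carrier E (cst 0) ;
  bfs_add : forall f g, carrier E f -> carrier E g -> carrier E (f \+ g) ;
  bfs_scale : forall (a : R) f, carrier E f -> carrier E (a \*o f) ;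
  bfs_norm_ge0 : forall f, carrier E f -> (0 <= fnorm E f)%E ;
  bfs_norm_fin : forall f, carrier E f -> (fnorm E f < +oo)%E ;
  bfs_norm_eq0 : forall f, carrier E f ->
    fnorm E f = 0%E -> {ae rho, forall x, f x = 0} ;
  bfs_normZ : forall (a : R) f, carrier E f ->
    fnorm E (a \*o f) = (`|a|%:E * fnorm E f)%E ;
  bfs_normD : forall f g, carrier E f -> carrier E g ->
    (fnorm E (f \+ g)%R <= fnorm E f + fnorm E g)%E ;
  bfs_ideal : forall f g, carrier E f -> measurable_fun setT g ->
    {ae rho, forall x, `|g x| <= `|f x|} ->
    carrier E g /\ (fnorm E g <= fnorm E f)%E ;
  bfs_complete : forall u : nat -> T -> R, (forall n, carrier E (u n)) ->
    (forall e : R, 0 < e -> exists n0, forall i j, (n0 <= i)%N -> (n0 <= j)%N ->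
      (fnorm E (u i \- u j)%R < e%:E)%E) ->
    exists2 f, carrier E f & fnorm E (u n \- f) @[n --> \oo] --> 0%E }.

Record bfs := Bfs {
  bfs_space :> fspace T R ;
  bfsP : is_bfs bfs_space }.

Definition positive_cone E : set (T -> R) :=
  [set f | carrier E f /\ {ae rho, forall x, 0 <= f x}].

(* This is the usual notion only when rho is finite: over the counting measure
   on nat, say, every set is uniformly a.c. *)
Definition uniformly_ac E (K : set (T -> R)) : Prop :=
  forall e : R, 0 < e -> exists2 delta : R, 0 < delta &
    forall A, measurable A -> (rho A < delta%:E)%E ->
      (ereal_sup [set fnorm E (f \* \1_A)%R | f in K] < e%:E)%E.

Definition ac_norm E : Prop :=
  forall f, carrier E f ->
  forall e : R, 0 < e -> exists2 delta : R, 0 < delta &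
    forall A, measurable A -> (rho A < delta%:E)%E ->
      (fnorm E (f \* \1_A)%R < e%:E)%E.

Definition disjoint_support f g : Prop :=
  {ae rho, forall x, f x = 0 \/ g x = 0}.

Definition subsequence_splitting E : Prop :=
  ac_norm E /\
  forall f : nat -> T -> R, (forall n, carrier E (f n)) ->
    (exists M : R, forall n, (fnorm E (f n) <= M%:E)%E) ->
  exists (phi : nat -> nat) (g h : nat -> T -> R),
    [/\ {homo phi : i j / (i < j)%N},
        forall n, carrier E (g n) /\ carrier E (h n),
        forall n, {ae rho, forall x, f (phi n) x = g n x + h n x} /\
                  disjoint_support (g n) (h n),
        uniformly_ac E (range g) &
        forall i j, i != j -> disjoint_support (h i) (h j)].

(* The dual regarded as a function space: g stands for the functional
   f |-> \int f g drho, and its norm is the operator norm. *)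
Definition associate E : fspace T R := FSpace
  [set g | measurable_fun setT g /\
     forall f, carrier E f -> rho.-integrable setT (EFin \o (f \* g))]
  (fun g => ereal_sup [set `| \int[rho]_x (f x * g x)%:E|%E |
     f in [set f | carrier E f /\ (fnorm E f <= 1)%E]]).

End function_spaces.

Section dual.
Context (T : Type) (R : realType).
Implicit Types (E : fspace T R).

(* A functional is represented by a total map whose values outside the carrier
   are irrelevant; boundedness makes it compatible with almost everywhere
   equality. *)
Record dual E := Dual {
  dual_fun :> (T -> R) -> R ;
  dual_linear : forall (a : R) (f g : T -> R), carrier E f -> carrier E g ->
    dual_fun ((a \*o f) \+ g) = a * dual_fun f + dual_fun g ;
  dual_bounded : exists C : R, forall f, carrier E f ->
    (`|dual_fun f|%:E <= C%:E * fnorm E f)%E }.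

Definition dual_ball E : set (dual E) :=
  [set x | forall f, carrier E f -> (`|x f|%:E <= fnorm E f)%E].

Definition weakly_null E (f : nat -> T -> R) : Prop :=
  forall x : dual E, x (f n) @[n --> \oo] --> (0 : R).

Definition weak_Banach_Saks E : Prop :=
  forall f : nat -> T -> R, (forall n, carrier E (f n)) -> weakly_null E f ->
  exists2 phi : nat -> nat, {homo phi : i j / (i < j)%N} &
    fnorm E (fun t => n.+1%:R^-1 * \sum_(0 <= k < n.+1) f (phi k) t)
      @[n --> \oo] --> 0%E.

End dual.

Section charge_integral.
Context d (T : measurableType d) (R : realType).
Variable nu : {charge set T -> \bar R}.

Let hahnP : set T := sval (cid (Hahn_decomposition nu)).
Let hahnN : set T := sval (cid (svalP (cid (Hahn_decomposition nu)))).
Let hahnPN : hahn_decomposition nu hahnP hahnN :=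
  svalP (cid (svalP (cid (Hahn_decomposition nu)))).

Definition variation : {measure set T -> \bar R} := charge_variation hahnPN.

Definition charge_integral (A : set T) (f : T -> R) : \bar R :=
  (\int[jordan_pos hahnPN]_(x in A) (f x)%:E -
   \int[jordan_neg hahnPN]_(x in A) (f x)%:E)%E.

End charge_integral.

Section vector_measure.
Context dS (S : measurableType dS) (R : realType).
Variables (rho : {measure set S -> \bar R}) (X : bfs rho).
Context d (Omega : measurableType d).

Record vmeasure := VMeasure {
  vm_fun :> set Omega -> S -> R ;
  vm_carrier : forall A, measurable A -> carrier X (vm_fun A) ;
  vm_sigma_additive : forall F : nat -> set Omega,
    (forall i, measurable (F i)) -> trivIset setT F ->
    fnorm X (fun s => vm_fun (\bigcup_i F i) s -
                      \sum_(0 <= i < n) vm_fun (F i) s)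
      @[n --> \oo] --> 0%E }.

Variable m : vmeasure.

Definition scalar_measure (x : dual X) (A : set Omega) : \bar R := (x (m A))%:E.

Section scalar_measure_charge.
Variable x : dual X.

Let x0 : x (cst 0) = 0.
Proof.
have := dual_linear x 1 (bfs_zero (bfsP X)) (bfs_zero (bfsP X)).
rewrite mul1r.
have -> : (1 \*o cst 0) \+ cst 0 = cst 0 :> (S -> R).
  by apply/funext => s /=; rewrite mulr0 addr0.
by move=> /eqP; rewrite -subr_eq0 opprD addNKr oppr_eq0 => /eqP.
Qed.

Let xD f g : carrier X f -> carrier X g -> x (f \+ g) = x f + x g.
Proof.
move=> Xf Xg; have := dual_linear x 1 Xf Xg; rewrite mul1r => <-.
by congr (dual_fun x _); apply/funext => s /=; rewrite mul1r.
Qed.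

Let xB f g : carrier X f -> carrier X g -> x (f \- g) = x f - x g.
Proof.
move=> Xf Xg; have := dual_linear x (-1) Xg Xf; rewrite mulN1r addrC => <-.
by congr (dual_fun x _); apply/funext => s /=; rewrite mulN1r addrC.
Qed.

Let XB f g : carrier X f -> carrier X g -> carrier X (f \- g).
Proof.
move=> Xf Xg; have -> : f \- g = f \+ (-1 \*o g) :> (S -> R).
  by apply/funext => s /=; rewrite mulN1r.
by apply: (bfs_add (bfsP X)) => //; apply: (bfs_scale (bfsP X)).
Qed.

Let x_sum (F : nat -> set Omega) n : (forall i, measurable (F i)) ->
  carrier X (fun s => \sum_(0 <= i < n) m (F i) s) /\
  x (fun s => \sum_(0 <= i < n) m (F i) s) = \sum_(0 <= i < n) x (m (F i)).
Proof.
move=> mF; elim: n => [|n [Xn xn]].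
  have -> : (fun s => \sum_(0 <= i < 0) m (F i) s) = cst 0.
    by apply/funext => s; rewrite big_geq.
  by rewrite big_geq//; split => //; exact: (bfs_zero (bfsP X)).
have -> : (fun s => \sum_(0 <= i < n.+1) m (F i) s) =
    (fun s => \sum_(0 <= i < n) m (F i) s) \+ m (F n).
  by apply/funext => s; rewrite big_nat_recr.
split; first by apply: (bfs_add (bfsP X)) => //; exact: vm_carrier.
by rewrite xD//; [rewrite xn big_nat_recr|exact: vm_carrier].
Qed.

Let x_cvg (F : nat -> set Omega) :
  (forall i, measurable (F i)) -> trivIset setT F ->
  \sum_(0 <= i < n) x (m (F i)) @[n --> \oo] --> x (m (\bigcup_i F i)).
Proof.
move=> mF tF; have [C xC] := dual_bounded x.
pose D n := m (\bigcup_i F i) \- (fun s => \sum_(0 <= i < n) m (F i) s).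
have mU : carrier X (m (\bigcup_i F i)).
  by apply: vm_carrier; exact: bigcup_measurable.
have XD n : carrier X (D n) by apply: XB => //; have [] := x_sum n mF.
have Nfin n : fnorm X (D n) \is a fin_num.
  rewrite ge0_fin_numE; first exact: (bfs_norm_fin (bfsP X)).
  exact: (bfs_norm_ge0 (bfsP X)).
have N0 : fine (fnorm X (D n)) @[n --> \oo] --> (0 : R).
  by apply: fine_cvg; exact: (vm_sigma_additive m mF tF).
have CN0 : C * fine (fnorm X (D n)) @[n --> \oo] --> (0 : R).
  by rewrite -(mulr0 C); apply: cvgM => //; exact: cvg_cst.
apply/cvgrPdist_lt => e e0; near=> n.
have [Xn xn] := x_sum n mF.
rewrite -xn -xB// -/(D n); apply: (@le_lt_trans _ _ (C * fine (fnorm X (D n)))).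
  by rewrite -lee_fin EFinM fineK//; exact: xC.
near: n; exact: (cvgr_lt (0 : R)).
Unshelve. all: by end_near. Qed.

Let scalar_measure_sigma_additive : semi_sigma_additive (scalar_measure x).
Proof.
move=> F mF tF mUF; under eq_fun do rewrite /scalar_measure sumEFin.
by apply: cvg_EFin; [apply: nearW | exact: x_cvg].
Qed.

Let scalar_measure0 : scalar_measure x set0 = 0%E.
Proof.
have := @x_cvg (fun=> set0) (fun=> measurable0) (@trivIset_set0 _ _ _).
rewrite bigcup0//; set c := x (m set0); set u := (fun n => _) => cv.
have uS n : u n.+1 = u n + c by rewrite /u big_nat_recr.
have cvS : u n.+1 @[n --> \oo] --> c by rewrite cvg_shiftS.
have cvD : u n + c @[n --> \oo] --> c + c by apply: cvgD => //; exact: cvg_cst.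
suff /eqP : c = c + c by rewrite -subr_eq subrr /scalar_measure -/c => /eqP <-.
apply: (cvg_unique (@Rhausdorff R) cvS).
by rewrite (_ : (fun n => u n.+1) = (fun n => u n + c)) //; apply/funext.
Qed.

Let scalar_measure_fin A : measurable A -> scalar_measure x A \is a fin_num.
Proof. by []. Qed.

HB.instance Definition _ := isCharge.Build d Omega R (scalar_measure x)
  scalar_measure0 scalar_measure_fin scalar_measure_sigma_additive.

End scalar_measure_charge.

Definition semivariation (A : set Omega) : \bar R :=
  ereal_sup [set variation (scalar_measure x) A | x in @dual_ball _ _ X].

Definition vm_integrable (f : Omega -> R) : Prop :=
  [/\ measurable_fun setT f,
      forall x : dual X,
        (variation (scalar_measure x)).-integrable setT (EFin \o f) &
      forall A, measurable A -> exists2 v, carrier X v &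
        forall x : dual X, (x v)%:E = charge_integral (scalar_measure x) A f].

(* Functions agreeing almost everywhere for the semivariation, equivalently for
   any Rybakov control measure, represent the same element. *)
Definition L1 : fspace Omega R := FSpace
  vm_integrable
  (fun f => ereal_sup
    [set (\int[variation (scalar_measure x)]_w `|f w|%:E)%E
       | x in @dual_ball _ _ X]).

Definition rybakov (eta : {measure set Omega -> \bar R}) : Prop :=
  (exists x0 : dual X, forall A, measurable A ->
     eta A = variation (scalar_measure x0) A) /\
  (forall A, measurable A -> eta A = 0%E <-> semivariation A = 0%E).

Definition vm_separable : Prop :=
  exists D : set (set Omega), [/\ countable D, D `<=` measurable &
    forall (A : set Omega) (e : R), measurable A -> 0 < e ->
      exists2 B, D B & (semivariation (A `+` B) < e%:E)%E].

Definition vm_positive : Prop :=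
  forall A, measurable A -> positive_cone rho X (m A).

Definition vm_range : set (S -> R) := [set m A | A in measurable].

End vector_measure.

(* Main.v *)
Require Import Defs.
From mathcomp Require Import all_boot all_order all_algebra.
From mathcomp Require Import all_classical all_reals all_analysis.
From mathcomp Require Import measurable_realfun ring lra.

Set Implicit Arguments.
Unset Strict Implicit.
Unset Printing Implicit Defensive.

Import Order.TTheory GRing.Theory Num.Theory.
Import numFieldNormedType.Exports.

Local Open Scope classical_set_scope.
Local Open Scope ring_scope.

(** Write I(f) for the integral of f against m. Since m is positive, I is a
    positive operator and the norm of f in L^1(m) is the norm of I(|f|) in X
    (fnorm_L1E). Both conclusions are transferred from X through I. Positive
    functionals are enough to compute norms: Hahn-Banach applied to
    f |-> ||f^+|| gives, for each positive vector, a positive functional of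
    norm at most one that norms it (positive_norming_ge0). Applied to a
    decreasing sequence instead of one vector it is a Dini theorem
    (positive_norming_seq), which makes the norm of L^1(m) absolutely
    continuous with respect to every Rybakov measure eta (L1_ac).

    Subsequence splitting. For a bounded sequence f n, put
    F n k = I(|f n| 1_{|f n| <= k}), which increases with k and is at most k u,
    where u = I(1). Splitting I(|f n|) in X as G n + H n, with the H n carried
    by sets B n whose measures tend to 0, one has F n k <= |G n| off B n, while
    on B n the vector F n k <= k u becomes small as n grows. It remains to see
    that the increments F n i - F n j, j <= i, are small for j large. As they
    are dominated by an equi-integrable sequence, it is enough that they are
    small relative to u outside a set of small measure, and this follows since
    the integrals of F n k / (u + F n k) increase with k and are bounded by
    rho(S). Along a subsequence the truncations of f n at height n are thus
    equi-integrable (uniform_truncation). The remainders live on sets whose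
    measures tend to 0; after passing to a sparse subsequence they are made
    disjoint at an equi-integrable cost (L1_splitting).

    Weak Banach-Saks. Separability of m gives a Rybakov functional as a series
    of functionals that norm m(B) for B in a countable dense family
    (rybakov_exists). A weakly null sequence f n is bounded, hence splits along
    a subsequence as g n + h n. For the disjoint part, a gliding hump shows that
    I(|h n|) is weakly null in X (mint_disjoint_weakly_null); the property of X
    yields means of I(|h n|) tending to 0, and these dominate the norms of the
    means of h n. For the equi-integrable part, truncation reduces to bounded
    functions in L^2(eta), where a subsequence has an asymptotically constant
    Gram matrix and hence Cauchy means, as do all its subsequences
    (uniformly_ac_cauchy_averages). The means of g n are then Cauchy in L^1(m),
    and they tend weakly to 0 because those of f n and h n do, so they tend to
    0 in norm. *)

(** * The Hahn-Banach theorem *)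

Section hahn_banach.
Context (R : realType) (V : lmodType R) (W : set V).
Hypotheses (W0 : W 0) (WD : forall u v, W u -> W v -> W (u + v))
  (WZ : forall (a : R) u, W u -> W (a *: u)).
Implicit Types (p q : V -> R) (u v : V).

Let WN u : W u -> W (- u).
Proof. by move=> Wu; rewrite -scaleN1r; exact: WZ. Qed.

Definition sublinear p :=
  (forall u v, W u -> W v -> p (u + v) <= p u + p v) /\
  (forall a u, 0 <= a -> W u -> p (a *: u) = a * p u).

Lemma sublinear0 p : sublinear p -> p 0 = 0.
Proof. by move=> [_ /(_ 0 0 (lexx _) W0)]; rewrite scaler0 mul0r. Qed.

Lemma sublinear_geN p u : sublinear p -> W u -> - p (- u) <= p u.
Proof.
move=> sp Wu; rewrite lerNl -subr_ge0 opprK -(sublinear0 sp) -(subrr u) addrC.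
by rewrite addrC [leRHS]addrC; apply: sp.1 => //; exact: WN.
Qed.

(** Sublinear functional below p which is at most - L at every - v n.
    Lowering p in this way replaces the extension of linear forms from
    subspaces in the proof of the Hahn-Banach theorem. *)
Definition lowered p (v : nat -> V) (L : R) u : R :=
  inf [set z | exists n t, 0 <= t /\ z = p (u + t *: v n) - t * L].

Section lowered.
Variables (p : V -> R) (v : nat -> V) (L : R).
Hypotheses (sp : sublinear p) (Wv : forall n, W (v n))
  (pv : forall n t u, 0 <= t -> W u -> p (u + t *: v n.+1) <= p (u + t *: v n))
  (Lv : forall n, L <= p (v n)).

Let pv_le n k t u : (n <= k)%N -> 0 <= t -> W u ->
  p (u + t *: v k) <= p (u + t *: v n).
Proof.
move=> + t0 Wu; elim: k => [|k IH]; first by rewrite leqn0 => /eqP ->.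
rewrite leq_eqVlt => /orP[/eqP -> //|]; rewrite ltnS => /IH.
by apply: le_trans; exact: pv.
Qed.

Let lb u n t : W u -> 0 <= t -> - p (- u) <= p (u + t *: v n) - t * L.
Proof.
move=> Wu t0.
have : p (t *: v n) <= p (u + t *: v n) + p (- u).
  have {1}-> : t *: v n = (u + t *: v n) + - u by rewrite addrAC subrr add0r.
  by apply: sp.1; [apply: WD => //; exact: WZ|exact: WN].
rewrite sp.2// => h; have := ler_wpM2l t0 (Lv n); lra.
Qed.

Let hl u : W u ->
  has_lbound [set z | exists n t, 0 <= t /\ z = p (u + t *: v n) - t * L].
Proof. by move=> Wu; exists (- p (- u)) => z [n [t [t0 ->]]]; exact: lb. Qed.

Lemma lowered_le u n t : W u -> 0 <= t -> lowered p v L u <= p (u + t *: v n) - t * L.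
Proof. by move=> Wu t0; apply: ge_inf; [exact: hl|exists n, t]. Qed.

Lemma le_lowered u z : W u ->
  (forall n t, 0 <= t -> z <= p (u + t *: v n) - t * L) -> z <= lowered p v L u.
Proof.
move=> Wu h; apply: lb_le_inf; last by move=> _ [n [t [t0 ->]]]; exact: h.
by exists (p (u + 0 *: v 0%N) - 0 * L), 0%N, 0.
Qed.

(** For subadditivity, two competitors with indices n and k may
    both be moved to the index max(n, k), since p (u + t v n) decreases with n;
    then the subadditivity of p applies. *)
Lemma lowered_sublinear : sublinear (lowered p v L).
Proof.
have E a u : 0 < a -> W u -> a * lowered p v L u <= lowered p v L (a *: u).
  move=> a0 Wu; apply: le_lowered; first exact: WZ.
  move=> n t t0; rewrite -ler_pdivlMl//.
  have t0' : 0 <= a^-1 * t by rewrite mulr_ge0// invr_ge0 ltW.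
  apply: (le_trans (lowered_le n Wu t0')); rewrite mulrBr mulrA lerB//.
  rewrite -sp.2 ?invr_ge0 ?(ltW a0)//; last by apply: WD; exact: WZ.
  by rewrite scalerDr !scalerA mulVf ?gt_eqF// scale1r.
split=> [u w Wu Ww|a u a0 Wu].
  rewrite -lerBlDr; apply: le_lowered => // n t t0.
  rewrite lerBlDr -lerBlDl; apply: le_lowered => // k s s0.
  rewrite lerBlDl; pose j := maxn n k.
  have ts : 0 <= t + s by rewrite addr_ge0.
  apply: (le_trans (lowered_le j (WD Wu Ww) ts)).
  have -> : u + w + (t + s) *: v j = (u + t *: v j) + (w + s *: v j).
    by rewrite scalerDl addrACA.
  rewrite mulrDl opprD [leRHS]addrACA lerD2r.
  apply: (@le_trans _ _ (p (u + t *: v j) + p (w + s *: v j))).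
    by apply: sp.1; apply: WD => //; exact: WZ.
  by apply: lerD; apply: pv_le => //; [exact: leq_maxl|exact: leq_maxr].
have [->|an0] := eqVneq a 0; last first.
  have {}a0 : 0 < a by rewrite lt_neqAle eq_sym an0.
  apply/eqP; rewrite eq_le E// andbT.
  rewrite -ler_pdivrMl//; have ai : 0 < a^-1 by rewrite invr_gt0.
  by apply: (le_trans (E _ _ ai (WZ a Wu))); rewrite scalerA mulVf// scale1r.
rewrite scale0r mul0r; apply/eqP; rewrite eq_le; apply/andP; split.
  apply: (le_trans (lowered_le 0 W0 (lexx 0))).
  by rewrite scale0r addr0 mul0r subr0 sublinear0.
by apply: le_lowered => // n t t0; rewrite -{1}oppr0 -(sublinear0 sp) -{1}oppr0 lb.
Qed.

Lemma lowered_self u : W u -> lowered p v L u <= p u.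
Proof. by move=> Wu; have := lowered_le 0 Wu (lexx 0); rewrite scale0r addr0 mul0r subr0. Qed.

Lemma loweredN n : lowered p v L (- v n) <= - L.
Proof.
have := lowered_le n (WN (Wv n)) ler01.
by rewrite scale1r addNr mul1r sublinear0// add0r.
Qed.

End lowered.

Let below p := {q : V -> R | sublinear q /\ forall u, W u -> q u <= p u}.
Let ord p (q r : below p) : bool := `[< forall u, W u -> sval r u <= sval q u >].

(** Chains have lower bounds since q u >= - p (- u) for every
    sublinear q below p. The order is only a preorder, as the values outside
    W are arbitrary. *)
Lemma minimal_sublinear p : sublinear p -> exists q : V -> R,
  [/\ sublinear q, forall u, W u -> q u <= p u & forall r, sublinear r ->
      (forall u, W u -> r u <= q u) -> forall u, W u -> r u = q u].
Proof.
move=> sp; have pp : sublinear p /\ forall u, W u -> p u <= p u by [].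
have [||A tA|q qmin] := @ZL_preorder (below p) (exist _ p pp) (@ord p).
- by move=> t; apply/asboolP.
- move=> r s t /asboolP rs /asboolP st; apply/asboolP => u Wu.
  exact: le_trans (st _ Wu) (rs _ Wu).
- have [[q0 Aq0]|nA] := pselect (exists r : below p, A r); last first.
    by exists (exist _ p pp) => s As; exfalso; apply: nA; exists s.
  pose q u := inf [set z | exists2 r, A r & z = sval r u].
  have hl u : W u -> has_lbound [set z | exists2 r, A r & z = sval r u].
    move=> Wu; exists (- p (- u)) => _ [r Ar ->].
    apply: (@le_trans _ _ (- sval r (- u))); last exact: sublinear_geN (svalP r).1 Wu.
    by rewrite lerN2; apply: (svalP r).2; exact: WN.
  have qle r u : A r -> W u -> q u <= sval r u.
    by move=> Ar Wu; apply: ge_inf; [exact: hl|exists r].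
  have qge z u : W u -> (forall r, A r -> z <= sval r u) -> z <= q u.
    move=> Wu h; apply: lb_le_inf; first by exists (sval q0 u), q0.
    by move=> _ [r Ar ->]; exact: h.
  have sq : sublinear q.
    split=> [u w Wu Ww|a u a0 Wu].
      rewrite -lerBlDr; apply: (qge _ _) => // r Ar; rewrite lerBlDr -lerBlDl.
      apply: (qge _ w Ww) => s As; rewrite lerBlDl.
      have [/asboolP rs|/asboolP sr] := tA _ _ Ar As.
        apply: (le_trans (qle _ _ As (WD Wu Ww))).
        by apply: (le_trans ((svalP s).1.1 _ _ Wu Ww)); rewrite lerD2r rs.
      apply: (le_trans (qle _ _ Ar (WD Wu Ww))).
      by apply: (le_trans ((svalP r).1.1 _ _ Wu Ww)); rewrite lerD2l sr.
    have [->|an0] := eqVneq a 0.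
      rewrite scale0r mul0r; apply/eqP; rewrite eq_le; apply/andP; split.
        by apply: (le_trans (qle _ _ Aq0 W0)); rewrite (sublinear0 (svalP q0).1).
      by apply: (qge _ _) => // r Ar; rewrite (sublinear0 (svalP r).1).
    have {}a0 : 0 < a by rewrite lt_neqAle eq_sym an0.
    apply/eqP; rewrite eq_le; apply/andP; split.
      rewrite -ler_pdivrMl//; apply: (qge _ _) => // r Ar; rewrite ler_pdivrMl//.
      rewrite -((svalP r).1.2 a u (ltW a0) Wu).
      by apply: (qle r) => //; exact: WZ.
    apply: (qge _ _); first exact: WZ.
    by move=> r Ar; rewrite ((svalP r).1.2 a u (ltW a0) Wu) ler_pM2l// qle.
  have qp u : W u -> q u <= p u.
    by move=> Wu; apply: (le_trans (qle _ _ Aq0 Wu)); exact: (svalP q0).2.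
  exists (exist _ q (conj sq qp)) => s As; apply/asboolP => u Wu /=.
  exact: qle.
- exists (sval q); split; [exact: (svalP q).1|exact: (svalP q).2|].
  move=> r sr rq u Wu.
  have rp w : W w -> r w <= p w.
    by move=> Ww; apply: (le_trans (rq _ Ww)); exact: (svalP q).2.
  have := qmin (exist _ r (conj sr rp)).
  have -> : ord q (exist _ r (conj sr rp)) by apply/asboolP.
  move=> /(_ isT)/asboolP/(_ u Wu) /= h.
  by apply/eqP; rewrite eq_le h rq.
Qed.

(** A minimal sublinear functional q is linear: lowering it along the
    constant sequence w to the level q w cannot change it, which gives
    q u <= q (u + w) - q w. *)
Lemma hahn_banach p : sublinear p -> exists x : V -> R,
  (forall a u v, W u -> W v -> x (a *: u + v) = a * x u + x v) /\
  (forall u, W u -> x u <= p u).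
Proof.
move=> sp; have [q [sq qp qmin]] := minimal_sublinear sp.
have qD u w : W u -> W w -> q (u + w) = q u + q w.
  move=> Wu Ww; apply/eqP; rewrite eq_le sq.1//=.
  have Ww' (n : nat) : W ((fun=> w) n) by [].
  have h1 n t z : 0 <= t -> W z -> q (z + t *: (fun _ : nat => w) n.+1) <=
    q (z + t *: (fun _ : nat => w) n) by [].
  have h2 (n : nat) : q w <= q ((fun=> w) n) by [].
  have := qmin _ (lowered_sublinear sq Ww' h1 h2) (lowered_self sq Ww' h2).
  move=> /(_ u Wu) <-.
  have := lowered_le sq Ww' h2 0 Wu ler01.
  by rewrite scale1r mul1r lerBrDr.
have qN u : W u -> q (- u) = - q u.
  move=> Wu; apply/eqP; rewrite -subr_eq0 opprK addrC -qD//; last exact: WN.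
  by rewrite subrr sublinear0.
exists q; split => // a u w Wu Ww; rewrite qD//; last exact: WZ.
congr (_ + _); have [a0|a0] := leP 0 a; first exact: sq.2.
rewrite -[a]opprK scaleNr qN; last exact: WZ.
by rewrite (sq.2 _ _ _ Wu) ?oppr_ge0 ?ltW// !mulNr.
Qed.

(** A decreasing sequence of vectors, rather than one vector, is kept above
    the level L; constant sequences give the usual norming functionals. *)
Lemma hahn_banach_seq p (v : nat -> V) (L : R) : sublinear p ->
  (forall n, W (v n)) ->
  (forall n t u, 0 <= t -> W u -> p (u + t *: v n.+1) <= p (u + t *: v n)) ->
  (forall n, L <= p (v n)) ->
  exists x : V -> R,
  [/\ forall a u v, W u -> W v -> x (a *: u + v) = a * x u + x v,
      forall u, W u -> x u <= p u & forall n, L <= x (v n)].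
Proof.
move=> sp Wv pv Lv.
have [x [xl xp]] := hahn_banach (lowered_sublinear sp Wv pv Lv).
exists x; split => // [u Wu|n].
  exact: le_trans (xp _ Wu) (lowered_self sp Wv Lv Wu).
have := le_trans (xp _ (WN (Wv n))) (loweredN sp Wv Lv n).
have x0 : x 0 = 0.
  have := xl 1 0 0 W0 W0; rewrite scaler0 addr0 mul1r => /eqP.
  by rewrite -subr_eq subrr eq_sym => /eqP.
have := xl (-1) (v n) 0 (Wv n) W0.
by rewrite addr0 x0 addr0 scaleN1r mulN1r => ->; rewrite lerN2.
Qed.

End hahn_banach.

(** * Selection of subsequences, submeasures, signs *)

Section selection.
Context (R : realType).
Implicit Types (U : set_system nat) (a : nat -> R).

Lemma free_ultrafilter : exists2 U, UltraFilter U & forall A, \oo A -> U A.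
Proof.
by have [U [UU sU]] := ultraFilterLemma eventually_filter; exists U.
Qed.

(** Limits along one ultrafilter make countably many bounded sequences
    converge at once, in place of a diagonal extraction. *)
Lemma ultrafilter_lim U a (M : R) : UltraFilter U ->
  (forall n, `|a n| <= M) -> exists l : R, a n @[n --> U] --> l.
Proof.
move=> UU aM.
have := @segment_compact R (- M) M => /(_ (a @ U)) [].
  have : U (a @^-1` `[- M, M]%classic).
    by apply: filterS (@filterT _ U _) => n _ /=; rewrite in_itv/= -ler_norml.
  exact.
move=> l [_ cl]; exists l => A nA.
have [//|UnA] := in_ultra_setVsetC (a @^-1` A) UU.
by have [r [/= r1 r2]] := cl (~` A) _ UnA nA; exfalso; apply: r1.
Qed.

(** P s n means that n may be chosen after the indices listed in s. *)
Lemma extract_subsequence (P : seq nat -> nat -> Prop) :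
  (forall s N, exists2 n, (N <= n)%N & P s n) ->
  exists2 phi : nat -> nat, {homo phi : i j / (i < j)%N} &
    forall i, P (mkseq phi i) (phi i).
Proof.
move=> PP; pose nx s : nat := sval (cid2 (PP s (last 0%N s).+1)).
have nx1 s : (last 0%N s < nx s)%N by rewrite /nx; case: cid2.
have nx2 s : P s (nx s) by rewrite /nx; case: cid2.
pose sq := fix sq n := if n is k.+1 then rcons (sq k) (nx (sq k)) else [::].
pose phi n := nx (sq n).
have sqE n : sq n = mkseq phi n.
  by elim: n => //= n IH; rewrite /mkseq -addn1 iotaD map_cat cats1/= add0n -/(mkseq phi n) -IH.
exists phi; last by move=> i; rewrite -sqE; exact: nx2.
apply: homo_ltn => [|n]; first exact: ltn_trans.
by rewrite /phi /= (leq_trans _ (nx1 _))// last_rcons.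
Qed.

End selection.

Lemma homo_geq_id (phi : nat -> nat) : {homo phi : i j / (i < j)%N} ->
  forall n, (n <= phi n)%N.
Proof. by move=> h; elim=> // n IH; exact: leq_ltn_trans IH (h _ _ (ltnSn n)). Qed.

Lemma cvgn0P (R : realType) (a : nat -> R) : (a n @[n --> \oo] --> (0 : R)) <->
  (forall e : R, 0 < e -> exists n0, forall n, (n0 <= n)%N -> `|a n| < e).
Proof.
split=> [h e e0|h].
  by have [n0 _ hn] := cvgr0_norm_lt _ h e e0; exists n0 => n /hn.
by apply/cvgr0Pnorm_lt => e /h[n0 hn]; exists n0.
Qed.

Section submeasure.
Context d (T : measurableType d) (R : realType).
Variables p q : set T -> \bar R.

(** Borel-Cantelli. Sets A n with p (A n) < 2^-n and q (A n) >= e would have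
    a p-null upper limit, while q would stay above e on the decreasing unions
    of tails. Here p is a measure and q a norm, or the other way round. *)
Lemma submeasure_ac :
  (forall A, measurable A -> (0 <= p A)%E) ->
  (forall A B, measurable A -> measurable B -> A `<=` B -> (p A <= p B)%E) ->
  (forall (A : nat -> set T) (c : R), (forall n, measurable (A n)) -> 0 < c ->
    (forall n, p (A n) <= (c / (2 ^ n.+1)%:R)%:E)%E ->
    (p (\bigcup_n A n) <= c%:E)%E) ->
  (forall A B, measurable A -> measurable B -> A `<=` B -> (q A <= q B)%E) ->
  (forall (U : nat -> set T) (e : R), (forall n, measurable (U n)) ->
    (forall n, U n.+1 `<=` U n) -> p (\bigcap_n U n) = 0%E -> 0 < e ->
    exists n, (q (U n) < e%:E)%E) ->
  forall e : R, 0 < e -> exists2 delta : R, 0 < delta &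
    forall A, measurable A -> (p A < delta%:E)%E -> (q A < e%:E)%E.
Proof.
move=> p0 pm ps qm qc e e0; apply: contrapT => nex.
have bad n : exists A, [/\ measurable A,
    (p A < ((2 ^ n)%:R^-1 / 2)%:E)%E & (e%:E <= q A)%E].
  apply: contrapT => nA; apply: nex; exists ((2 ^ n)%:R^-1 / 2).
    by rewrite divr_gt0// invr_gt0 ltr0n expn_gt0.
  move=> A mA pA; rewrite ltNge; apply/negP => eq; apply: nA.
  by exists A.
have [A HA] := choice bad.
have mA n : measurable (A n) by have [] := HA n.
pose U n := \bigcup_i A (n + i)%N.
have mU n : measurable (U n) by exact: bigcupT_measurable.
have pU n : (p (U n) <= ((2 ^ n)%:R^-1)%:E)%E.
  apply: ps => //.
  move=> i; have [_ /ltW h _] := HA (n + i)%N; apply: (le_trans h).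
  by rewrite lee_fin expnD natrM expnS natrM !invfM -mulrA [_ / 2]mulrC.
have UU n : U n.+1 `<=` U n.
  by move=> x [i _ Ax]; exists i.+1 => //; rewrite addnS -addSn.
have pI : p (\bigcap_n U n) = 0%E.
  have mI : measurable (\bigcap_n U n) by exact: bigcapT_measurable.
  apply/eqP; rewrite eq_le p0// andbT; apply/lee_addgt0Pr => r r0.
  rewrite add0e; have [n nr] := ltr_add_invr r0.
  apply: (@le_trans _ _ (p (U n))); first by apply: pm => //; exact: bigcap_inf.
  apply: (le_trans (pU n)); rewrite lee_fin.
  rewrite add0r in nr; apply: le_trans (ltW nr).
  by rewrite lef_pV2 ?posrE ?ltr0n ?expn_gt0// ler_nat ltn_expl.
have [n] := qc U e mU UU pI e0.
rewrite ltNge => /negP; apply; have [_ _ h] := HA n; apply: (le_trans h).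
apply: qm => // x Ax; exists 0%N => //; by rewrite addn0.
Qed.

End submeasure.

Section measurable_sets.
Context d (T : measurableType d) (R : realType).
Implicit Types (f : T -> R) (P : set T).

Lemma measurable_ge f (a : R) : measurable_fun setT f -> measurable [set w | a <= f w].
Proof.
move=> mf; rewrite (_ : [set _ | _] = f @^-1` `[a, +oo[%classic).
  by rewrite -[X in measurable X]setTI; apply: mf => //; exact: measurable_itv.
by apply/seteqP; split => w /=; rewrite in_itv/= andbT.
Qed.

Lemma measurable_gt f (a : R) : measurable_fun setT f -> measurable [set w | a < f w].
Proof.
move=> mf; rewrite (_ : [set _ | _] = f @^-1` `]a, +oo[%classic).
  by rewrite -[X in measurable X]setTI; apply: mf => //; exact: measurable_itv.
by apply/seteqP; split => w /=; rewrite in_itv/= andbT.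
Qed.

Definition signed P w : R := \1_P w - \1_(~` P) w.

Lemma normr_signed P w : `|signed P w| = 1.
Proof.
by rewrite /signed !indicE in_setC; case: (w \in P); rewrite /= ?subr0 ?sub0r ?normrN normr1.
Qed.

Lemma measurable_signed P : measurable P -> measurable_fun setT (signed P).
Proof.
by move=> mP; apply: measurable_funB; apply: measurable_indic => //; exact: measurableC.
Qed.

Lemma mul_signed f P : f \* signed P = (f \* \1_P) \- (f \* \1_(~` P)).
Proof. by apply/funext => w; rewrite /signed /= mulrBr. Qed.

Lemma normr_mul_signed f P w : `|(f \* signed P) w| = `|f w|.
Proof. by rewrite normrM normr_signed mulr1. Qed.

Lemma norm_signed f : measurable_fun setT f ->
  exists2 P, measurable P & (fun w => `|f w|) = f \* signed P.
Proof.
move=> mf; exists [set w | 0 <= f w]; first exact: measurable_ge.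
apply/funext => w; rewrite /signed /= !indicE in_setC.
have [f0|f0] := leP 0 (f w); first by rewrite mem_set//= subr0 mulr1 ger0_norm.
by rewrite memNset /= ?sub0r ?mulrN1 ?ltr0_norm//; apply/negP; rewrite -ltNge.
Qed.

End measurable_sets.

Lemma measurable_neq0 d (T : measurableType d) (R : realType) (h : T -> R) :
  measurable_fun setT h -> measurable [set w | h w != 0].
Proof.
move=> mh; rewrite (_ : [set _ | _] = [set w | 0 < `|h w|]).
  by apply: measurable_gt; exact: measurableT_comp.
by apply/seteqP; split => w /=; rewrite normr_gt0.
Qed.

Lemma le_measure_ae d (T : measurableType d) (R : realType)
    (mu : {measure set T -> \bar R}) (A B : set T) : measurable A -> measurable B ->
  {ae mu, forall s, A s -> B s} -> (mu A <= mu B)%E.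
Proof.
move=> mA mB [Z [mZ Z0 sZ]]; apply: (@le_trans _ _ (mu (B `|` Z))).
  rewrite le_measure ?inE//; first exact: measurableU.
  move=> s As; have [Bs|nB] := pselect (B s); [by left|right].
  by apply: sZ => /= /(_ As).
by rewrite -[leRHS]adde0 -Z0; exact: measureU2.
Qed.

Lemma third_sum (R : realFieldType) (e : R) : e = e / 3 + e / 3 + e / 3.
Proof. by field. Qed.

Lemma filter_all_seq (I : eqType) (T : Type) (F : set_system T) (FF : Filter F)
    (Q : I -> set T) (s : seq I) : (forall i, F (Q i)) -> F [set t | forall i, i \in s -> Q i t].
Proof.
move=> FQ; elim: s => [|i s IH]; first by apply: filterS filterT => t _ i; rewrite in_nil.
apply: filterS2 (FQ i) IH => t Qi Qs k; rewrite in_cons => /orP[/eqP ->//|]; exact: Qs.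
Qed.

(** * Banach function spaces and positive functionals *)

Section bfs_theory.
Context d (T : measurableType d) (R : realType).
Variables (rho : {measure set T -> \bar R}) (X : bfs rho).
Implicit Types (f g h : T -> R) (A B : set T).

Notation Xc := (carrier X).

(** The norm is finite on the carrier, where real arithmetic is thus
    available. *)
Definition nrm f : R := fine (fnorm X f).

Lemma fnormE f : Xc f -> fnorm X f = (nrm f)%:E.
Proof.
move=> Xf; rewrite /nrm fineK// ge0_fin_numE.
  exact: (bfs_norm_fin (bfsP X)).
exact: (bfs_norm_ge0 (bfsP X)).
Qed.

Lemma bfs_mfun f : Xc f -> measurable_fun setT f.
Proof. exact: (bfs_measurable (bfsP X)). Qed.

Lemma bfsD f g : Xc f -> Xc g -> Xc (f \+ g).
Proof. exact: (bfs_add (bfsP X)). Qed.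

Lemma bfsZ (a : R) f : Xc f -> Xc (a \*o f).
Proof. exact: (bfs_scale (bfsP X)). Qed.

Lemma bfs0 : Xc (cst 0).
Proof. exact: (bfs_zero (bfsP X)). Qed.

Lemma bfsB f g : Xc f -> Xc g -> Xc (f \- g).
Proof.
move=> Xf Xg; have -> : f \- g = f \+ (-1 \*o g) by apply/funext => s /=; rewrite mulN1r.
by apply: bfsD => //; exact: bfsZ.
Qed.

Lemma bfs_sum (I : Type) (r : seq I) (F : I -> T -> R) :
  (forall i, Xc (F i)) -> Xc (fun s => \sum_(i <- r) F i s).
Proof.
move=> XF; elim: r => [|i r IH].
  by rewrite (_ : (fun s => _) = cst 0); [exact: bfs0|apply/funext => s; rewrite big_nil].
rewrite (_ : (fun s => _) = F i \+ (fun s => \sum_(i <- r) F i s)); first exact: bfsD.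
by apply/funext => s; rewrite big_cons.
Qed.

Lemma bfs_le f g : Xc f -> measurable_fun setT g ->
  {ae rho, forall x, `|g x| <= `|f x|} -> Xc g.
Proof. by move=> Xf mg /(bfs_ideal (bfsP X) Xf mg) []. Qed.

Lemma nrm_le f g : Xc f -> measurable_fun setT g ->
  {ae rho, forall x, `|g x| <= `|f x|} -> nrm g <= nrm f.
Proof.
move=> Xf mg gf; have [Xg h] := bfs_ideal (bfsP X) Xf mg gf.
by rewrite -lee_fin -!fnormE.
Qed.

Lemma nrm_ae f g : Xc f -> Xc g -> {ae rho, forall x, f x = g x} -> nrm f = nrm g.
Proof.
move=> Xf Xg fg; apply/eqP; rewrite eq_le; apply/andP; split; apply: nrm_le => //;
  try exact: bfs_mfun; by apply: filterS fg => x ->.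
Qed.

Lemma bfs_mul_indic f A : measurable A -> Xc f -> Xc (f \* \1_A).
Proof.
move=> mA Xf; apply: (bfs_le Xf).
  by apply: measurable_funM ; [exact: bfs_mfun|exact: measurable_indic].
apply: aeW => x /=; rewrite indicE; case: (x \in A); rewrite ?mulr1 ?mulr0//.
by rewrite normr0.
Qed.

Lemma bfs_norm f : Xc f -> Xc (fun x => `|f x|).
Proof.
move=> Xf; apply: (bfs_le Xf); last by apply: aeW => x; rewrite normr_id.
by apply: measurableT_comp => //; exact: bfs_mfun.
Qed.

Lemma bfs_pos f : Xc f -> Xc f^\+.
Proof.
move=> Xf; apply: (bfs_le Xf); first by apply: measurable_funrpos; exact: bfs_mfun.
apply: aeW => x; rewrite /funrpos; case: (leP (f x) 0) => [f0|//].
by rewrite normr0.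
Qed.

Lemma nrm_ge0 f : Xc f -> 0 <= nrm f.
Proof. by move=> Xf; rewrite fine_ge0//; exact: (bfs_norm_ge0 (bfsP X)). Qed.

Lemma nrmZ (a : R) f : Xc f -> nrm (a \*o f) = `|a| * nrm f.
Proof.
move=> Xf; apply: EFin_inj; rewrite EFinM -!fnormE//; last exact: bfsZ.
exact: (bfs_normZ (bfsP X)).
Qed.

Lemma nrmD f g : Xc f -> Xc g -> nrm (f \+ g) <= nrm f + nrm g.
Proof.
move=> Xf Xg; rewrite -lee_fin EFinD -!fnormE//; last exact: bfsD.
exact: (bfs_normD (bfsP X)).
Qed.

Lemma nrm0 : nrm (cst 0) = 0.
Proof.
have := nrmZ 0 bfs0; rewrite normr0 mul0r.
by rewrite (_ : 0 \*o cst 0 = cst 0)//; apply/funext => x /=; rewrite mul0r.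
Qed.

Lemma nrm_eq0 f : Xc f -> nrm f = 0 -> {ae rho, forall x, f x = 0}.
Proof. by move=> Xf f0; apply: (bfs_norm_eq0 (bfsP X)) => //; rewrite fnormE// f0. Qed.

Lemma nrm_ae0 f : Xc f -> {ae rho, forall x, f x = 0} -> nrm f = 0.
Proof. by move=> Xf f0; rewrite (nrm_ae Xf bfs0 f0) nrm0. Qed.

Lemma nrm_norm f : Xc f -> nrm (fun x => `|f x|) = nrm f.
Proof.
move=> Xf; have Xn := bfs_norm Xf.
by apply/eqP; rewrite eq_le; apply/andP; split; apply: nrm_le => //;
  try exact: bfs_mfun; apply: aeW => x; rewrite normr_id.
Qed.

Lemma nrm_sum (I : Type) (r : seq I) (F : I -> T -> R) :
  (forall i, Xc (F i)) ->
  nrm (fun s => \sum_(i <- r) F i s) <= \sum_(i <- r) nrm (F i).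
Proof.
move=> XF; elim: r => [|i r IH].
  rewrite (_ : (fun s => _) = cst 0) ?nrm0 ?big_nil//.
  by apply/funext => s; rewrite big_nil.
rewrite (_ : (fun s => _) = F i \+ (fun s => \sum_(i <- r) F i s)); last first.
  by apply/funext => s; rewrite big_cons.
rewrite big_cons; apply: (le_trans (nrmD (XF i) (bfs_sum _ XF))).
by rewrite lerD2l.
Qed.

Section functionals.
Variable x : dual X.

Lemma dualD f g : Xc f -> Xc g -> x (f \+ g) = x f + x g.
Proof.
move=> Xf Xg; have := dual_linear x 1 Xf Xg; rewrite mul1r => <-.
by congr (dual_fun x _); apply/funext => s /=; rewrite mul1r.
Qed.

Lemma dual0 : x (cst 0) = 0.
Proof.
have := dualD bfs0 bfs0; have -> : cst 0 \+ cst 0 = cst 0 :> (T -> R).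
  by apply/funext => s /=; rewrite addr0.
by move=> /eqP; rewrite -subr_eq subrr => /eqP.
Qed.

Lemma dualZ (a : R) f : Xc f -> x (a \*o f) = a * x f.
Proof.
move=> Xf; have := dual_linear x a Xf bfs0; rewrite dual0 addr0 => <-.
by congr (dual_fun x _); apply/funext => s /=; rewrite addr0.
Qed.

Lemma dualB f g : Xc f -> Xc g -> x (f \- g) = x f - x g.
Proof.
move=> Xf Xg; have := dual_linear x (-1) Xg Xf; rewrite mulN1r addrC => <-.
by congr (dual_fun x _); apply/funext => s /=; rewrite mulN1r addrC.
Qed.

Lemma dual_sum (I : Type) (r : seq I) (F : I -> T -> R) : (forall i, Xc (F i)) ->
  x (fun s => \sum_(i <- r) F i s) = \sum_(i <- r) x (F i).
Proof.
move=> XF; elim: r => [|i r IH].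
  rewrite big_nil (_ : (fun s => _) = cst 0) ?dual0//.
  by apply/funext => s; rewrite big_nil.
rewrite (_ : (fun s => _) = F i \+ (fun s => \sum_(i <- r) F i s)); last first.
  by apply/funext => s; rewrite big_cons.
by rewrite big_cons dualD// ?IH//; exact: bfs_sum.
Qed.

Lemma dual_le : exists2 C : R, 0 <= C & forall f, Xc f -> `|x f| <= C * nrm f.
Proof.
have [C xC] := dual_bounded x; exists `|C| => // f Xf.
have := xC _ Xf; rewrite fnormE// lee_fin => /le_trans; apply.
by rewrite ler_wpM2r ?nrm_ge0// ler_norm.
Qed.

Lemma dual_ae f g : Xc f -> Xc g -> {ae rho, forall s, f s = g s} -> x f = x g.
Proof.
move=> Xf Xg fg; apply/eqP; rewrite -subr_eq0 -dualB// -normr_le0.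
have [C C0 xC] := dual_le; apply: (le_trans (xC _ (bfsB Xf Xg))).
rewrite nrm_ae0 ?mulr0//; first exact: bfsB.
by apply: filterS fg => s /= ->; rewrite subrr.
Qed.

Definition positive_dual := forall f, Xc f -> {ae rho, forall s, 0 <= f s} -> 0 <= x f.

Lemma positive_dual_le f g : positive_dual -> Xc f -> Xc g ->
  {ae rho, forall s, f s <= g s} -> x f <= x g.
Proof.
move=> px Xf Xg fg; rewrite -subr_ge0 -dualB//; apply: px; first exact: bfsB.
by apply: filterS fg => s /=; rewrite subr_ge0.
Qed.

Lemma dual_ball_le f : @dual_ball _ _ X x -> Xc f -> `|x f| <= nrm f.
Proof. by move=> bx Xf; have := bx _ Xf; rewrite fnormE// lee_fin. Qed.

End functionals.

(** A linear form below f |-> ||f^+|| is positive and of norm at most one.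
    Along a decreasing sequence this is Dini's theorem: the sequence cannot
    tend weakly to 0 unless its positive parts tend to 0 in norm. *)
Lemma positive_norming_seq (v : nat -> T -> R) (L : R) :
  (forall n, Xc (v n)) -> (forall n, {ae rho, forall s, v n.+1 s <= v n s}) ->
  (forall n, L <= nrm (v n)^\+) ->
  exists x : dual X, [/\ @dual_ball _ _ X x, positive_dual x & forall n, L <= x (v n)].
Proof.
move=> Xv vdec Lv; pose p f := nrm f^\+.
have sp : sublinear Xc (p : (T -> R)%type -> R).
  split=> [f g Xf Xg|a f a0 Xf].
    apply: (@le_trans _ _ (nrm (f^\+ \+ g^\+))).
      apply: nrm_le; first by apply: bfsD; exact: bfs_pos.
        by apply: bfs_mfun; apply: bfs_pos; exact: bfsD.
      apply: aeW => s; rewrite !ger0_norm ?addr_ge0 ?funrpos_ge0// /funrpos/=.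
      rewrite ge_max lerD ?le_max ?lexx//= addr_ge0 ?le_max ?lexx ?orbT//.
    by apply: nrmD; exact: bfs_pos.
  rewrite /p -[in RHS](ger0_norm a0) -nrmZ; last exact: bfs_pos.
  by congr nrm; apply/funext => s; rewrite /funrpos /= maxr_pMr// mulr0.
have WD f g : Xc f -> Xc g -> Xc (f + g) by exact: bfsD.
have WZ a f : Xc f -> Xc (a *: f) by exact: bfsZ.
have pdec n (t : R) f : 0 <= t -> Xc f -> p (f + t *: v n.+1) <= p (f + t *: v n).
  move=> t0 Xf; apply: nrm_le; first by apply: bfs_pos; apply: WD => //; exact: WZ.
    by apply: bfs_mfun; apply: bfs_pos; apply: WD => //; exact: WZ.
  apply: filterS (vdec n) => s vs.
  rewrite !ger0_norm ?funrpos_ge0// /funrpos.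
  by rewrite ge_max !le_max lexx orbT andbT lerD2l ler_wpM2l.
have [x [xl xp xL]] := hahn_banach_seq bfs0 WD WZ sp Xv pdec Lv.
have x0 : x (cst 0) = 0.
  have := xl 1 _ _ bfs0 bfs0; rewrite scaler0 addr0 mul1r => /eqP.
  by rewrite -subr_eq subrr eq_sym => /eqP.
have xN f : Xc f -> x (-1 \*o f) = - x f.
  move=> Xf; have := xl (-1) _ _ Xf bfs0; rewrite addr0 x0 addr0 mulN1r => <-.
  by congr x.
have pn f : Xc f -> p f <= nrm f.
  move=> Xf; apply: nrm_le => //; first by apply: bfs_mfun; exact: bfs_pos.
  apply: aeW => s; rewrite /funrpos; case: (leP (f s) 0) => [f0|//].
  by rewrite normr0.
have xn f : Xc f -> `|x f| <= nrm f.
  move=> Xf; rewrite ler_norml; apply/andP; split.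
    rewrite lerNl -xN//; apply: le_trans (xp _ (bfsZ _ Xf)) _.
    apply: (le_trans (pn _ (bfsZ _ Xf))).
    by rewrite nrmZ// normrN1 mul1r.
  exact: le_trans (xp _ Xf) (pn _ Xf).
have xb : exists C : R, forall f, Xc f -> (`|x f|%:E <= C%:E * fnorm X f)%E.
  by exists 1 => f Xf; rewrite mul1e fnormE// lee_fin xn.
exists (Dual xl xb); split => //=.
  by move=> f Xf /=; rewrite fnormE// lee_fin xn.
move=> f Xf f0 /=; rewrite -oppr_le0 -xN//.
apply: (le_trans (xp _ (bfsZ _ Xf))).
rewrite /p nrm_ae0//; first by apply: bfs_pos; exact: bfsZ.
apply: filterS f0 => s f0; rewrite /funrpos; apply/max_idPr.
by rewrite /= mulN1r oppr_le0.
Qed.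

Lemma positive_norming f : Xc f -> exists x : dual X,
  [/\ @dual_ball _ _ X x, positive_dual x & x f = nrm f^\+].
Proof.
move=> Xf.
have [|x [bx px xf]] :=
  @positive_norming_seq (fun=> f) (nrm f^\+) (fun=> Xf) _ (fun=> lexx _).
  by move=> _; exact: aeW.
exists x; split => //; apply/eqP; rewrite eq_le (xf 0%N) andbT.
apply: (@le_trans _ _ (x f^\+)).
  apply: positive_dual_le => //; first exact: bfs_pos.
  by apply: aeW => s; rewrite /funrpos le_max lexx.
by apply: (le_trans (ler_norm _)); apply: dual_ball_le => //; exact: bfs_pos.
Qed.

Lemma positive_norming_ge0 f : Xc f -> {ae rho, forall s, 0 <= f s} ->
  exists x : dual X, [/\ @dual_ball _ _ X x, positive_dual x & x f = nrm f].
Proof.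
move=> Xf f0; have [x [bx px xf]] := positive_norming Xf; exists x; split => //.
rewrite xf; apply: nrm_ae => //; first exact: bfs_pos.
by apply: filterS f0 => s f0; rewrite /funrpos; apply/max_idPl.
Qed.

(** Some positive x satisfies x (- f) = ||(- f)^+||; as x f >= 0, this norm
    is 0. *)
Lemma ae_ge0_dual f : Xc f ->
  (forall x : dual X, positive_dual x -> 0 <= x f) -> {ae rho, forall s, 0 <= f s}.
Proof.
move=> Xf h; have XN := bfsZ (-1) Xf.
have [x [bx px xf]] := positive_norming XN.
have : nrm (-1 \*o f)^\+ <= 0.
  by rewrite -xf dualZ// mulN1r oppr_le0 h.
move=> le0; have XP := bfs_pos XN.
have /(nrm_eq0 XP) : nrm (-1 \*o f)^\+ = 0 by apply/eqP; rewrite eq_le le0 nrm_ge0.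
apply: filterS => s; rewrite /funrpos /= mulN1r => e.
by rewrite -oppr_le0 -e le_max lexx.
Qed.

Lemma ae_le_dual f g : Xc f -> Xc g ->
  (forall x : dual X, positive_dual x -> x f <= x g) ->
  {ae rho, forall s, f s <= g s}.
Proof.
move=> Xf Xg h; have := @ae_ge0_dual _ (bfsB Xg Xf).
move=> H; apply: filterS (H _); first by move=> s /=; rewrite subr_ge0.
by move=> x px; rewrite dualB// subr_ge0 h.
Qed.

Lemma ae_eq_dual f g : Xc f -> Xc g ->
  (forall x : dual X, positive_dual x -> x f = x g) ->
  {ae rho, forall s, f s = g s}.
Proof.
move=> Xf Xg h.
have h1 : {ae rho, forall s, f s <= g s} by apply: ae_le_dual => // x /h ->.
have h2 : {ae rho, forall s, g s <= f s} by apply: ae_le_dual => // x /h ->.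
by apply: filterS2 h1 h2 => s fg gf; apply/eqP; rewrite eq_le fg.
Qed.

End bfs_theory.

(** * Integration against a charge *)

Section charge_integral_theory.
Context d (T : measurableType d) (R : realType).
Variable nu : {charge set T -> \bar R}.
Implicit Types (f g : T -> R) (A : set T).

Local Notation vint f := ((Defs.variation nu).-integrable setT (EFin \o f)).

Definition cint f : R := fine (charge_integral nu setT f).

(** The integral is defined through a chosen Hahn decomposition; these are
    its properties that do not depend on the choice. *)
Lemma charge_jordan : exists (pos neg : {finite_measure set T -> \bar R}) (P : set T),
  [/\ measurable P,
      forall A, measurable A -> pos A = nu (A `&` P),
      forall A, measurable A -> neg A = (- nu (A `&` ~` P))%E,
      forall A, Defs.variation nu A = (pos A + neg A)%E &
      forall A f, charge_integral nu A f =
        (\int[pos]_(x in A) (f x)%:E - \int[neg]_(x in A) (f x)%:E)%E].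
Proof.
rewrite /Defs.variation /charge_integral.
pose nuPN := svalP (cid (svalP (cid (Hahn_decomposition nu)))).
pose P := sval (cid (Hahn_decomposition nu)).
pose N := sval (cid (svalP (cid (Hahn_decomposition nu)))).
exists (jordan_pos nuPN), (jordan_neg nuPN), P.
have [[mP _] [mN _] PN PIN] : hahn_decomposition nu P N by exact: nuPN.

split => [//|A mA|A mA|//|//].
  by rewrite -[LHS]/(jordan_pos nuPN A) jordan_posE cjordan_posE /crestr0 mem_set.
rewrite -[LHS]/(jordan_neg nuPN A) jordan_negE cjordan_negE /crestr0 mem_set// /crestr -/N.
suff -> : N = ~` P by [].
apply/seteqP; split => x.
  by move=> Nx Px; have : (P `&` N) x by []; rewrite PIN.
by move=> nPx; have : [set: T] x by []; rewrite -PN => -[].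
Qed.

Section jordan.
Variables (pos neg : {finite_measure set T -> \bar R}) (P : set T).
Hypotheses (mP : measurable P)
  (posE : forall A, measurable A -> pos A = nu (A `&` P))
  (negE : forall A, measurable A -> neg A = (- nu (A `&` ~` P))%E)
  (varE : forall A, Defs.variation nu A = (pos A + neg A)%E)
  (intE : forall A f, charge_integral nu A f =
        (\int[pos]_(x in A) (f x)%:E - \int[neg]_(x in A) (f x)%:E)%E).

Let int_var (g : T -> \bar R) : measurable_fun setT g -> (forall x, (0 <= g x)%E) ->
  (\int[Defs.variation nu]_x g x = \int[pos]_x g x + \int[neg]_x g x)%E.
Proof.
move=> mg g0; rewrite -ge0_integral_measure_add//.
by apply: eq_measure_integral => A mA _; rewrite varE -measure_addE.
Qed.

Let vmeas f : vint f -> measurable_fun setT f.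
Proof. by move=> /integrableP[+ _]; exact: (measurable_EFinP _ _).1. Qed.

Let vabs f : measurable_fun setT f -> measurable_fun setT (fun x => `|(EFin \o f) x|%E).
Proof. by move=> mf; apply: measurableT_comp => //; exact/measurable_EFinP. Qed.

Let int_pos f : vint f -> pos.-integrable setT (EFin \o f).
Proof.
move=> fi; have mf := vmeas fi; case/integrableP: fi => mEf.
rewrite int_var//; last exact: vabs; move=> fi; apply/integrableP; split => //.
by apply: le_lt_trans fi; rewrite leeDl// integral_ge0.
Qed.

Let int_neg f : vint f -> neg.-integrable setT (EFin \o f).
Proof.
move=> fi; have mf := vmeas fi; case/integrableP: fi => mEf.
rewrite int_var//; last exact: vabs; move=> fi; apply/integrableP; split => //.
by apply: le_lt_trans fi; rewrite leeDr// integral_ge0.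
Qed.

Let cintE f : vint f -> cint f = Rintegral pos setT f - Rintegral neg setT f.
Proof.
move=> fi; rewrite /cint intE fineB//.
  by apply: integrable_fin_num => //; exact: int_pos.
by apply: integrable_fin_num => //; exact: int_neg.
Qed.

Let vD (a : R) f g : vint f -> vint g -> vint (fun x => a * f x + g x).
Proof.
move=> fi gi; rewrite (_ : EFin \o _ = (fun x => a%:E * (EFin \o f) x) \+ (EFin \o g))%E//.
by apply: integrableD => //; exact: integrableZl.
Qed.

Let lin (a : R) f g : vint f -> vint g ->
  cint (fun x => a * f x + g x) = a * cint f + cint g.
Proof.
move=> fi gi; rewrite !cintE//; last exact: vD.
rewrite !RintegralD ?RintegralZl//; try exact: int_pos; try exact: int_neg.
- by rewrite mulrBr opprD addrACA.
- by move: (int_neg fi) => /(integrableZl measurableT a).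
- by move: (int_pos fi) => /(integrableZl measurableT a).
Qed.

Let indic A : measurable A -> (cint \1_A)%:E = nu A.
Proof.
move=> mA; rewrite /cint intE !integral_indic// !setIT fineK; last first.
  by rewrite fin_numB !fin_num_measure.
have pE : (pos : {measure set T -> \bar R}) A = nu (A `&` P) by exact: posE.
have nE : (neg : {measure set T -> \bar R}) A = (- nu (A `&` ~` P))%E by exact: negE.
rewrite pE nE oppeK -[in RHS](setIT A) -(setUv P) setIUr chargeU//.
- exact: measurableI.
- by apply: measurableI => //; exact: measurableC.
- by rewrite setIACA setICr setI0.
Qed.

Let abs f : vint f -> `|cint f| <= fine (\int[Defs.variation nu]_x `|f x|%:E)%E.
Proof.
move=> fi; rewrite cintE// (int_var (g := fun x => `|f x|%:E))//; last first.
  apply/measurable_EFinP; apply: measurableT_comp => //; exact: vmeas.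
have ip := int_pos fi; have i_n := int_neg fi.
rewrite fineD.
- apply: (le_trans (ler_normB _ _)); apply: lerD; exact: le_normr_Rintegral.
- by apply: integrable_fin_num => //; exact: integrable_norm.
- by apply: integrable_fin_num => //; exact: integrable_norm.
Qed.

Let pos_ge0 f : (forall A, measurable A -> (0 <= nu A)%E) -> vint f ->
  (forall x, 0 <= f x) -> 0 <= cint f.
Proof.
move=> nu0 fi f0; rewrite cintE// subr_ge0.
have -> : Rintegral neg setT f = 0.
  rewrite /Rintegral (eq_measure_integral mzero) ?integral_measure_zero//.
  move=> A mA _; apply/eqP; rewrite eq_le; apply/andP; split => //=.
  by rewrite negE// oppe_le0 nu0//; apply: measurableI => //; exact: measurableC.
  exact: measure_ge0.
by apply: Rintegral_ge0 => x _; exact: f0.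
Qed.

Let var f : vint f ->
  (\int[Defs.variation nu]_x `|f x|%:E)%E = (cint (fun x => `|f x| * signed R P x))%:E.
Proof.
move=> fi; have ip := int_pos fi; have i_n := int_neg fi.
have mf := vmeas fi; have mC : measurable (~` P) by exact: measurableC.
have pC : pos (~` P) = 0%E by rewrite posE// setICl charge0.
have nP : neg P = 0%E by rewrite negE// setICr charge0 oppe0.
have mg : measurable_fun setT (fun x => `|f x| * signed R P x).
  apply: measurable_funM; first by apply: measurableT_comp.
  exact: measurable_signed.
have mab : measurable_fun setT (fun x => `|f x|) by exact: measurableT_comp.
have gE x : `| `|f x| * signed R P x| = `|f x|.
  by rewrite normrM normr_id normr_signed mulr1.
have vg : vint (fun x => `|f x| * signed R P x).
  by apply: (le_integrable _ _ _ fi) => //;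
    [exact/measurable_EFinP|move=> x _ /=; rewrite gE].
rewrite cintE// (int_var (g := fun x => `|f x|%:E))//; last exact/measurable_EFinP.
have -> : Rintegral pos setT (fun x => `|f x| * signed R P x) =
    Rintegral pos setT (fun x => `|f x|).
  congr fine; apply: ae_eq_integral => //.
  - exact/measurable_EFinP.
  - exact/measurable_EFinP.
  - exists (~` P); split => // x /= h Px; apply: h => _.
    by rewrite /signed !indicE in_setC mem_set//= subr0 mulr1.
have -> : Rintegral neg setT (fun x => `|f x| * signed R P x) =
    Rintegral neg setT (fun x => - `|f x|).
  congr fine; apply: ae_eq_integral => //.
  - exact/measurable_EFinP.
  - by apply/measurable_EFinP; exact: measurableT_comp.
  - exists P; split => // x /= h; apply: contrapT => Px; apply: h => _.
    by rewrite /signed !indicE in_setC memNset//= sub0r mulrN1.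
have inn := integrable_norm i_n.
have -> : Rintegral neg setT (fun x => - `|f x|) = - Rintegral neg setT (fun x => `|f x|).
  rewrite -mulN1r -RintegralZl//; by congr Rintegral; apply/funext => x; rewrite mulN1r.
rewrite opprK EFinD !fineK//.
  by apply: integrable_fin_num.
by apply: integrable_fin_num => //; exact: integrable_norm.
Qed.

Let onset A f : measurable A -> vint f ->
  charge_integral nu A f = (cint (f \* \1_A))%:E.
Proof.
move=> mA fi; have ip := int_pos fi; have i_n := int_neg fi.
have vA : vint (f \* \1_A).
  apply: (le_integrable _ _ _ fi) => //.
    apply/measurable_EFinP; apply: measurable_funM; first exact: vmeas.
    exact: measurable_indic.
  move=> x _ /=; rewrite indicE lee_fin normrM.
  by case: (x \in A); rewrite ?normr1 ?normr0 ?mulr1 ?mulr0.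
have E (mu : {finite_measure set T -> \bar R}) :
    (\int[mu]_(x in A) (f x)%:E = \int[mu]_x (f x * \1_A x)%:E)%E.
  rewrite integral_mkcond; apply: eq_integral => x _.
  by rewrite patchE indicE; case: (x \in A); rewrite ?mulr1 ?mulr0.
by rewrite cintE// intE !E EFinB !fineK// integrable_fin_num//; [exact: int_neg|exact: int_pos].
Qed.

Lemma cint_facts :
  [/\ forall (a : R) f g, vint f -> vint g ->
        cint (fun x => a * f x + g x) = a * cint f + cint g,
      forall A, measurable A -> (cint \1_A)%:E = nu A,
      forall f, vint f -> `|cint f| <= fine (\int[Defs.variation nu]_x `|f x|%:E)%E,
      (forall A, measurable A -> (0 <= nu A)%E) -> forall f, vint f ->
        (forall x, 0 <= f x) -> 0 <= cint f &
      (forall f, vint f -> (\int[Defs.variation nu]_x `|f x|%:E)%E =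
        (cint (fun x => `|f x| * signed R P x))%:E) /\
      forall A f, measurable A -> vint f ->
        charge_integral nu A f = (cint (f \* \1_A))%:E].
Proof. by split => //; move=> nu0 f; exact: pos_ge0. Qed.

End jordan.

Let facts : exists2 P, measurable P & _ :=
  let: ex_intro pos (ex_intro neg (ex_intro P (And5 mP a b c e))) := charge_jordan in
  ex_intro2 _ _ P mP (cint_facts mP a b c e).

Lemma cint_linear (a : R) f g : vint f -> vint g ->
  cint (fun x => a * f x + g x) = a * cint f + cint g.
Proof. by have [P _ [h _ _ _ _]] := facts; exact: h. Qed.

Lemma cint_indic A : measurable A -> (cint \1_A)%:E = nu A.
Proof. by have [P _ [_ h _ _ _]] := facts; exact: h. Qed.

Lemma normr_cint_le f : vint f -> `|cint f| <= fine (\int[Defs.variation nu]_x `|f x|%:E)%E.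
Proof. by have [P _ [_ _ h _ _]] := facts; exact: h. Qed.

Lemma cint_ge0 f : (forall A, measurable A -> (0 <= nu A)%E) -> vint f ->
  (forall x, 0 <= f x) -> 0 <= cint f.
Proof. by have [P _ [_ _ _ h _]] := facts => nu0; exact: (h nu0). Qed.

(** The variation of nu is nu on P and - nu on the complement of P, so
    integrals against the variation are integrals against nu itself. This
    makes moduli of functionals unnecessary. *)
Lemma integral_variation : exists2 P, measurable P & forall f, vint f ->
  (\int[Defs.variation nu]_x `|f x|%:E)%E =
  (cint (fun x => `|f x| * signed R P x))%:E.
Proof. by have [P mP [_ _ _ _ [h _]]] := facts; exists P. Qed.

Lemma charge_integral_indic A f : measurable A -> vint f ->
  charge_integral nu A f = (cint (f \* \1_A))%:E.
Proof. by have [P _ [_ _ _ _ [_ h]]] := facts; exact: h. Qed.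

Lemma variation_integrable_indic A : measurable A -> vint \1_A.
Proof.
move=> mA; apply/integrableP; split; first exact/measurable_EFinP.
rewrite (eq_integral (fun x => (\1_A x)%:E)); last first.
  by move=> x _ /=; rewrite ger0_norm.
rewrite integral_indic// setIT.
have [pos [neg [P [_ _ _ -> _]]]] := charge_jordan.
by rewrite ltey_eq fin_numD !fin_num_measure.
Qed.

End charge_integral_theory.

(** * The vector integral and the norm of L^1(m) *)

Section vector_integral.
Context dS (S : measurableType dS) (R : realType).
Variables (rho : {measure set S -> \bar R}) (X : bfs rho).
Context d (Omega : measurableType d).
Variable m : vmeasure X Omega.
Hypothesis hm_pos : vm_positive m.
Implicit Types (f g : Omega -> R) (A B : set Omega) (x : dual X).

Local Notation Xc := (carrier X).
Local Notation L := (carrier (L1 m)).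
Local Notation N := (nrm X).
Local Notation var x := (Defs.variation (scalar_measure m x)).
Local Notation J x f := (cint (scalar_measure m x) f).

Lemma L1_mfun f : L f -> measurable_fun setT f.
Proof. by case. Qed.

Lemma L1_vint f x : L f -> (var x).-integrable setT (EFin \o f).
Proof. by case. Qed.

Lemma measurable_mul_indic f A : measurable A -> measurable_fun setT f ->
  measurable_fun setT (f \* \1_A).
Proof. by move=> mA mf; apply: measurable_funM => //; exact: measurable_indic. Qed.

Lemma normr_mul_indic_le f A w : `|(f \* \1_A) w| <= `|f w|.
Proof.
by rewrite /= indicE; case: (w \in A); rewrite ?mulr1// mulr0 normr0.
Qed.

Lemma vint_mul_indic f A x : measurable A -> (var x).-integrable setT (EFin \o f) ->
  (var x).-integrable setT (EFin \o (f \* \1_A)).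
Proof.
move=> mA fi; apply: (le_integrable _ _ _ fi) => //.
  apply/measurable_EFinP; apply: measurable_mul_indic => //.
  by case/integrableP: fi => /measurable_EFinP.
by move=> w _; rewrite lee_fin normr_mul_indic_le.
Qed.

Lemma L1P f : L f <-> [/\ measurable_fun setT f,
  forall x, (var x).-integrable setT (EFin \o f) &
  forall A, measurable A -> exists2 v, Xc v & forall x, x v = J x (f \* \1_A)].
Proof.
split=> -[mf fi h]; split => // A mA; have [v Xv vE] := h A mA; exists v => // x.
  by apply: EFin_inj; rewrite vE charge_integral_indic.
by rewrite vE charge_integral_indic.
Qed.

Lemma L1_linear (a : R) f g : L f -> L g -> L (fun w => a * f w + g w).
Proof.
move=> Lf Lg; apply/L1P; split.
- by apply: measurable_funD; [apply: measurable_funM => //|]; exact: L1_mfun.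
- move=> x; rewrite (_ : EFin \o _ = (fun w => a%:E * (EFin \o f) w) \+ (EFin \o g))%E//.
  by apply: integrableD => //; [apply: integrableZl => //|]; exact: L1_vint.
- move=> A mA; have [_ fi /(_ A mA)[u Xu uE]] := (L1P f).1 Lf.
  have [_ gi /(_ A mA)[v Xv vE]] := (L1P g).1 Lg.
  exists (a \*o u \+ v); first by apply: bfsD => //; exact: bfsZ.
  move=> x; rewrite dual_linear// uE vE -cint_linear; [|exact: vint_mul_indic..].
  by congr cint; apply/funext => w /=; rewrite mulrDl mulrA.
Qed.

Lemma L1_mul_indic f A : measurable A -> L f -> L (f \* \1_A).
Proof.
move=> mA /L1P[mf fi h]; apply/L1P; split; first exact: measurable_mul_indic.
  by move=> x; exact: vint_mul_indic.
move=> B mB; have [v Xv vE] := h _ (measurableI _ _ mA mB).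
exists v => // x; rewrite vE; congr cint; apply/funext => w /=.
by rewrite -mulrA indicI.
Qed.

Lemma L1_indic A : measurable A -> L \1_A.
Proof.
move=> mA; apply/L1P; split; first exact: measurable_indic.
  by move=> x; exact: variation_integrable_indic.
move=> B mB; have mAB := measurableI _ _ mA mB.
exists (m (A `&` B)); first exact: vm_carrier.
move=> x; rewrite -indicI; apply: EFin_inj.
by rewrite (cint_indic (scalar_measure m x)).
Qed.

Lemma L1D f g : L f -> L g -> L (f \+ g).
Proof.
move=> Lf Lg; rewrite (_ : f \+ g = fun w => 1 * f w + g w); first exact: L1_linear.
by apply/funext => w; rewrite mul1r.
Qed.

Lemma L1_0 : L (cst 0).
Proof.
by rewrite (_ : cst 0 = \1_set0); [exact: L1_indic|apply/funext => w; rewrite indic0].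
Qed.

Lemma L1Z (a : R) f : L f -> L (a \*o f).
Proof.
move=> Lf; rewrite (_ : a \*o f = fun w => a * f w + cst 0 w).
  by apply: L1_linear => //; exact: L1_0.
by apply/funext => w /=; rewrite addr0.
Qed.

Lemma L1B f g : L f -> L g -> L (f \- g).
Proof.
move=> Lf Lg; rewrite (_ : f \- g = fun w => -1 * g w + f w); first exact: L1_linear.
by apply/funext => w; rewrite mulN1r addrC.
Qed.

Lemma L1_cst (a : R) : L (cst a).
Proof.
rewrite (_ : cst a = a \*o \1_setT); first by apply: L1Z; exact: L1_indic.
by apply/funext => w /=; rewrite indicT mulr1.
Qed.

Lemma L1_mul_signed f A : measurable A -> L f -> L (f \* signed R A).
Proof.
move=> mA Lf; rewrite mul_signed; apply: L1B; apply: L1_mul_indic => //.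
exact: measurableC.
Qed.

Lemma L1_norm f : L f -> L (fun w => `|f w|).
Proof.
move=> Lf; have [P mP ->] := norm_signed (L1_mfun Lf); exact: L1_mul_signed.
Qed.

Lemma L1_sum (I : Type) (r : seq I) (F : I -> Omega -> R) :
  (forall i, L (F i)) -> L (fun w => \sum_(i <- r) F i w).
Proof.
move=> LF; elim: r => [|i r IH].
  by rewrite (_ : (fun w => _) = cst 0); [exact: L1_0|apply/funext => w; rewrite big_nil].
rewrite (_ : (fun w => _) = F i \+ (fun w => \sum_(i <- r) F i w)); first exact: L1D.
by apply/funext => w; rewrite big_cons.
Qed.

(** The integral of f over the whole space, which is determined almost
    everywhere by its values under the functionals; the default is used where
    there is no such vector. *)
Definition mint f : S -> R :=
  if pselect (exists v, Xc v /\ forall x, x v = J x f) is left e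
  then sval (cid e) else cst 0.

Lemma mint_carrier f : Xc (mint f).
Proof.
by rewrite /mint; case: pselect => [e|_]; [case: (cid e) => v []|exact: bfs0].
Qed.

Lemma mintE f x : L f -> x (mint f) = J x f.
Proof.
move=> /L1P[_ _ /(_ setT measurableT)[v Xv vE]].
rewrite /mint; case: pselect => [e|[]]; first by case: (cid e) => u [_ /= ->].
exists v; split => // y; rewrite vE; congr cint.
by apply/funext => w /=; rewrite indicT mulr1.
Qed.

Lemma scalar_measure_ge0 x A : positive_dual x -> measurable A -> (0 <= scalar_measure m x A)%E.
Proof.
by move=> px mA; rewrite /scalar_measure lee_fin; have [XA A0] := hm_pos mA; exact: px.
Qed.

Lemma cintB x f g : L f -> L g -> J x (f \- g) = J x f - J x g.
Proof.
move=> Lf Lg; rewrite (_ : f \- g = fun w => -1 * g w + f w).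
  by rewrite cint_linear ?mulN1r 1?addrC//; exact: L1_vint.
by apply/funext => w; rewrite mulN1r addrC.
Qed.

Lemma cintD x f g : L f -> L g -> J x (f \+ g) = J x f + J x g.
Proof.
move=> Lf Lg; rewrite (_ : f \+ g = fun w => 1 * f w + g w).
  by rewrite cint_linear ?mul1r//; exact: L1_vint.
by apply/funext => w; rewrite mul1r.
Qed.

Lemma cintZ x (a : R) f : L f -> J x (a \*o f) = a * J x f.
Proof.
move=> Lf; have -> : a \*o f = fun w => (a - 1) * f w + f w.
  by apply/funext => w /=; rewrite mulrBl mul1r subrK.
by rewrite cint_linear; [rewrite mulrBl mul1r subrK|exact: L1_vint..].
Qed.

Lemma cint_le x f g : positive_dual x -> L f -> L g -> (forall w, f w <= g w) ->
  J x f <= J x g.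
Proof.
move=> px Lf Lg fg; rewrite -subr_ge0 -cintB//.
apply: cint_ge0 => [A mA||w /=]; [exact: scalar_measure_ge0|exact/L1_vint/L1B|].
by rewrite subr_ge0.
Qed.

Lemma mint_le f g : L f -> L g -> (forall w, f w <= g w) ->
  {ae rho, forall s, mint f s <= mint g s}.
Proof.
move=> Lf Lg fg; apply: ae_le_dual; [exact: mint_carrier..|].
by move=> x px; rewrite !mintE//; exact: cint_le.
Qed.

Lemma mint_eq v f : L f -> Xc v -> (forall x, x v = J x f) -> {ae rho, forall s, mint f s = v s}.
Proof.
by move=> Lf Xv vE; apply: (ae_eq_dual (mint_carrier f) Xv) => x _; rewrite mintE.
Qed.

Lemma mintD f g : L f -> L g -> {ae rho, forall s, mint (f \+ g) s = mint f s + mint g s}.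
Proof.
move=> Lf Lg; apply: (@mint_eq (mint f \+ mint g)); first exact: L1D.
  by apply: bfsD; exact: mint_carrier.
by move=> x; rewrite dualD ?cintD ?mintE//; exact: mint_carrier.
Qed.

Lemma mintB f g : L f -> L g -> {ae rho, forall s, mint (f \- g) s = mint f s - mint g s}.
Proof.
move=> Lf Lg; apply: (@mint_eq (mint f \- mint g)); first exact: L1B.
  by apply: bfsB; exact: mint_carrier.
by move=> x; rewrite dualB ?cintB ?mintE//; exact: mint_carrier.
Qed.

Lemma mintZ (a : R) f : L f -> {ae rho, forall s, mint (a \*o f) s = a * mint f s}.
Proof.
move=> Lf; apply: (@mint_eq (a \*o mint f)); first exact: L1Z.
  by apply: bfsZ; exact: mint_carrier.
by move=> x; rewrite dualZ ?cintZ ?mintE//; exact: mint_carrier.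
Qed.

Lemma mint_sum (I : Type) (r : seq I) (F : I -> Omega -> R) : (forall i, L (F i)) ->
  {ae rho, forall s, mint (fun w => \sum_(i <- r) F i w) s = \sum_(i <- r) mint (F i) s}.
Proof.
move=> LF; apply: (@mint_eq (fun s => \sum_(i <- r) mint (F i) s)); first exact: L1_sum.
  by apply: bfs_sum => i; exact: mint_carrier.
move=> x; rewrite dual_sum; last by move=> i; exact: mint_carrier.
elim: r => [|i r IH].
  rewrite big_nil (_ : (fun w => _) = 0 \*o cst 0); last first.
    by apply/funext => w; rewrite big_nil /= mul0r.
  by rewrite cintZ ?mul0r//; exact: L1_0.
rewrite (_ : (fun w => _) = F i \+ (fun w => \sum_(i <- r) F i w)); last first.
  by apply/funext => w; rewrite big_cons.
by rewrite big_cons cintD ?IH ?mintE//; exact: L1_sum.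
Qed.

Lemma mint_indic A : measurable A -> {ae rho, forall s, mint \1_A s = m A s}.
Proof.
move=> mA; apply: mint_eq; [exact: L1_indic|exact: vm_carrier|].
by move=> x; apply: EFin_inj; rewrite (cint_indic (scalar_measure m x)).
Qed.

Lemma mint_ge0 f : L f -> (forall w, 0 <= f w) -> {ae rho, forall s, 0 <= mint f s}.
Proof.
move=> Lf f0; apply: ae_ge0_dual => [|x px]; first exact: mint_carrier.
rewrite mintE//; apply: cint_ge0 => // [A mA|]; last exact: L1_vint.
exact: scalar_measure_ge0.
Qed.

(** For a positive vector measure this is the norm of L^1(m). *)
Definition normL f : R := N (mint (fun w => `|f w|)).

Lemma normL_ge0 f : 0 <= normL f.
Proof. by apply: nrm_ge0; exact: mint_carrier. Qed.

Lemma normL_le f g : L f -> L g -> (forall w, `|g w| <= `|f w|) -> normL g <= normL f.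
Proof.
move=> Lf Lg gf; have Lf' := L1_norm Lf; have Lg' := L1_norm Lg.
apply: nrm_le; [exact: mint_carrier|by apply: bfs_mfun; exact: mint_carrier|].
have h1 := mint_le Lg' Lf' gf; have h2 := mint_ge0 Lg' (fun w => normr_ge0 _).
by apply: filterS2 h1 h2 => s h1 h2; rewrite !ger0_norm// (le_trans h2).
Qed.

Lemma normLZ (a : R) f : L f -> normL (a \*o f) = `|a| * normL f.
Proof.
move=> Lf; have Lf' := L1_norm Lf.
rewrite /normL -[in RHS](normr_id a) -nrmZ; last exact: mint_carrier.
apply: nrm_ae; [exact: mint_carrier|by apply: bfsZ; exact: mint_carrier|].
rewrite (_ : (fun w => _) = `|a| \*o (fun w => `|f w|)); first exact: mintZ.
by apply/funext => w /=; rewrite normrM.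
Qed.

Lemma normLD f g : L f -> L g -> normL (f \+ g) <= normL f + normL g.
Proof.
move=> Lf Lg; have Lf' := L1_norm Lf; have Lg' := L1_norm Lg.
apply: (@le_trans _ _ (N (mint (fun w => `|f w|) \+ mint (fun w => `|g w|)))); last first.
  by apply: nrmD; exact: mint_carrier.
apply: nrm_le; [by apply: bfsD; exact: mint_carrier|by apply: bfs_mfun; exact: mint_carrier|].
have Lfg := L1_norm (L1D Lf Lg).
have h1 := mint_le Lfg (L1D Lf' Lg') (fun w => ler_normD _ _).
have h2 := mint_ge0 Lfg (fun w => normr_ge0 _).
apply: filterS3 h1 h2 (mintD Lf' Lg') => s /= h1 h2 h3.
by rewrite -h3 !ger0_norm// (le_trans h2).
Qed.

Lemma normLB f g : L f -> L g -> normL (f \- g) <= normL f + normL g.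
Proof.
move=> Lf Lg; rewrite (_ : f \- g = f \+ (-1 \*o g)); last first.
  by apply/funext => w /=; rewrite mulN1r.
apply: (le_trans (normLD Lf (L1Z (-1) Lg))).
by rewrite normLZ// normrN1 mul1r.
Qed.

Lemma normL_indic A : measurable A -> normL \1_A = N (m A).
Proof.
move=> mA; apply: nrm_ae; [exact: mint_carrier|exact: vm_carrier|].
rewrite (_ : (fun w => _) = \1_A); first exact: mint_indic.
by apply/funext => w; rewrite ger0_norm.
Qed.

Lemma normL_norm f : normL (fun w => `|f w|) = normL f.
Proof. by congr (nrm X (mint _)); apply/funext => w; rewrite normr_id. Qed.

(** By integral_variation the left-hand side is x applied to the difference
    of the integrals of |f| over the two Hahn sets of x m. As m is positive,
    this difference is dominated by the integral of |f|. *)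
Lemma integral_variation_le x (C : R) f : L f -> 0 <= C ->
  (forall v, Xc v -> `|x v| <= C * N v) ->
  (\int[var x]_w `|f w|%:E <= (C * normL f)%:E)%E.
Proof.
move=> Lf C0 xC; have [P mP PE] := integral_variation (scalar_measure m x).
have Lf' := L1_norm Lf; have mP' := measurableC mP.
have L1' := L1_mul_indic mP Lf'; have L2' := L1_mul_indic mP' Lf'.
rewrite PE; last exact: L1_vint.
rewrite [X in cint _ X](mul_signed (fun w => `|f w|) P).
have Xv1 := mint_carrier ((fun w => `|f w|) \* \1_P).
have Xv2 := mint_carrier ((fun w => `|f w|) \* \1_(~` P)).
rewrite lee_fin cintB// -!mintE// -dualB//.
apply: (le_trans (ler_norm _)); apply: (le_trans (xC _ (bfsB Xv1 Xv2))).
apply: ler_wpM2l => //; apply: nrm_le; first exact: mint_carrier.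
  exact: (bfs_mfun (bfsB Xv1 Xv2)).
have h0 w A : 0 <= ((fun w => `|f w|) \* \1_A) w by rewrite /= mulr_ge0.
have h1 := mint_ge0 L1' (fun w => h0 w _); have h2 := mint_ge0 L2' (fun w => h0 w _).
have h3 := mintD L1' L2'.
rewrite (_ : _ \+ _ = fun w => `|f w|) in h3; last first.
  apply/funext => w /=; rewrite -mulrDr !indicE in_setC.
  by case: (w \in P); rewrite /= ?addr0 ?add0r mulr1.
apply: filterS3 h1 h2 h3 => s /= h1 h2 ->.
rewrite (ger0_norm (addr_ge0 h1 h2)) ler_norml; lra.
Qed.

Lemma cint_normL_le x (C : R) f : L f -> 0 <= C ->
  (forall v, Xc v -> `|x v| <= C * N v) -> `|J x f| <= C * normL f.
Proof.
move=> Lf C0 xC; apply: (le_trans (normr_cint_le (L1_vint x Lf))).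
rewrite -lee_fin fineK; first exact: integral_variation_le.
rewrite ge0_fin_numE; last exact: integral_ge0.
by have /integrableP[_] := L1_vint x Lf.
Qed.

Lemma cint_ball_le x f : L f -> @dual_ball _ _ X x -> `|J x f| <= normL f.
Proof.
move=> Lf bx; rewrite -[leRHS]mul1r; apply: cint_normL_le => // v Xv.
by rewrite mul1r; exact: dual_ball_le.
Qed.

Lemma normL_norming f : L f -> exists x,
  [/\ @dual_ball _ _ X x, positive_dual x & J x (fun w => `|f w|) = normL f].
Proof.
move=> Lf; have Lf' := L1_norm Lf.
have [x [bx px xE]] := positive_norming_ge0 (mint_carrier _) (mint_ge0 Lf' (fun w => normr_ge0 _)).
by exists x; split => //; rewrite -mintE.
Qed.

(** One inequality is integral_variation_le, the other is seen on a positive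
    functional that norms the integral of |f|. *)
Lemma fnorm_L1E f : L f -> fnorm (L1 m) f = (normL f)%:E.
Proof.
move=> Lf; apply/eqP; rewrite eq_le; apply/andP; split.
  apply: ge_ereal_sup => _ [x bx <-]; rewrite -[normL f]mul1r.
  apply: integral_variation_le => // v Xv.
  by rewrite mul1r; exact: dual_ball_le.
have [x [bx px <-]] := normL_norming Lf.
apply: le_trans (ereal_sup_ubound (ex_intro2 _ _ x bx erefl)) => /=.
have Lf' := L1_norm Lf; have fi := L1_vint x Lf.
have := normr_cint_le (L1_vint x Lf').
rewrite -lee_fin fineK => [/(le_trans _)|].
  under eq_integral do rewrite normr_id.
  by apply; rewrite lee_fin ler_norm.
rewrite ge0_fin_numE; last exact: integral_ge0.
by under eq_integral do rewrite normr_id; case/integrableP: fi.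
Qed.

Lemma variation_le x (C : R) A : measurable A -> 0 <= C ->
  (forall v, Xc v -> `|x v| <= C * N v) -> (var x A <= (C * N (m A))%:E)%E.
Proof.
move=> mA C0 xC; have := integral_variation_le (L1_indic mA) C0 xC.
rewrite normL_indic// (eq_integral (fun w => (\1_A w)%:E)) ?integral_indic ?setIT//.
by move=> w _ /=; rewrite ger0_norm.
Qed.

Lemma vm_le_variation x A : measurable A -> (`|x (m A)|%:E <= var x A)%E.
Proof.
move=> mA; have LA := L1_indic mA; have := normr_cint_le (L1_vint x LA).
have -> : J x \1_A = x (m A) by apply: EFin_inj; rewrite (cint_indic (scalar_measure m x)).
rewrite -lee_fin (eq_integral (fun w => (\1_A w)%:E)) => [|w _ /=]; last first.
  by rewrite ger0_norm.
rewrite integral_indic// setIT.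
rewrite fineK//; have [C C0 xC] := dual_le x.
rewrite ge0_fin_numE//; apply: le_lt_trans (variation_le mA C0 xC) _.
exact: ltry.
Qed.

Lemma semivariationE A : measurable A -> semivariation m A = (N (m A))%:E.
Proof.
move=> mA; apply/eqP; rewrite eq_le; apply/andP; split.
  apply: ge_ereal_sup => _ [x bx <-]; rewrite -[N _]mul1r.
  apply: variation_le => // v Xv.
  by rewrite mul1r; exact: dual_ball_le.
have [XA A0] := hm_pos mA.
have [x [bx px xE]] := positive_norming_ge0 XA A0.
apply: le_trans (ereal_sup_ubound (ex_intro2 _ _ x bx erefl)) => /=.
by rewrite -xE; apply: le_trans (vm_le_variation x mA); rewrite lee_fin ler_norm.
Qed.

End vector_integral.

(** * Absolutely continuous norms over a finite measure *)

Section finite_measure_lemmas.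
Context d (T : measurableType d) (R : realType).
Variable mu : {measure set T -> \bar R}.
Hypothesis mu_fin : (mu setT < +oo)%E.

Lemma finite_measure_lty A : measurable A -> (mu A < +oo)%E.
Proof. by move=> mA; apply: le_lt_trans mu_fin; rewrite le_measure ?inE. Qed.

Lemma decreasing_measure_lt (U : nat -> set T) (e : R) :
  (forall n, measurable (U n)) -> (forall n, U n.+1 `<=` U n) ->
  mu (\bigcap_n U n) = 0%E -> 0 < e -> exists n, (mu (U n) < e%:E)%E.
Proof.
move=> mU dU U0 e0.
have h : mu \o U @ \oo --> mu (\bigcap_n U n).
  apply: nonincreasing_cvg_mu => //; first exact: finite_measure_lty.
    exact: bigcapT_measurable.
  by apply/nonincreasing_seqP => n; apply/subsetPset.
rewrite U0 in h.
have : nbhs (0%E : \bar R) [set x | (x < e%:E)%E] by exact: lt_nbhsl.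
by move=> /h[n _ /(_ n (leqnn n))]; exists n.
Qed.

(** A point that lies in infinitely many of the sets lies in two of them. *)
Lemma almost_disjoint_tail (B : nat -> set T) (e : R) :
  (forall n, measurable (B n)) ->
  (forall i j, i != j -> mu (B i `&` B j) = 0%E) -> 0 < e ->
  exists n, (mu (\bigcup_l B (n + l)%N) < e%:E)%E.
Proof.
move=> mB B0 e0; pose U n := \bigcup_l B (n + l)%N.
have mU n : measurable (U n) by exact: bigcupT_measurable.
apply: (decreasing_measure_lt (U := U)) => //.
  by move=> n x [l _ Bx]; exists l.+1 => //; rewrite addnS -addSn.
have : mu.-negligible (\bigcup_i \bigcup_k (B i `&` B (i + k.+1)%N)).
  apply: negligible_bigcup => i; apply: negligible_bigcup => k.
  exists (B i `&` B (i + k.+1)%N); split => //; first exact: measurableI.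
  by apply: B0; rewrite neq_ltn addnS ltnS leq_addr.
case=> N [mN N0 sN]; apply: (subset_measure0 _ _ _ N0) => //.
  exact: bigcapT_measurable.
move=> x Ux; apply: sN; have [i _ Bi] := Ux 0%N I.
have [l _ Bl] := Ux i.+1 I; exists i => //; exists l => //.
by split; rewrite ?addnS -?addSn// -(add0n i).
Qed.

End finite_measure_lemmas.

Section ac_norm_control.
Context d (T : measurableType d) (R : realType).
Variables (rho : {measure set T -> \bar R}) (X : bfs rho).
Hypothesis rho_fin : (rho setT < +oo)%E.
Hypothesis acX : ac_norm rho X.
Local Notation N := (nrm X).
Local Notation Xc := (carrier X).

Lemma ac_normP f (e : R) : Xc f -> 0 < e -> exists2 delta : R, 0 < delta &
  forall A, measurable A -> (rho A < delta%:E)%E -> N (f \* \1_A) < e.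
Proof.
move=> Xf e0; have [delta d0 h] := acX Xf e0; exists delta => // A mA /h.
by rewrite fnormE ?lte_fin; [apply|exact: bfs_mul_indic].
Qed.

Lemma nrm_mul_indic_le f A B : Xc f -> measurable A -> measurable B -> A `<=` B ->
  N (f \* \1_A) <= N (f \* \1_B).
Proof.
move=> Xf mA mB AB; apply: nrm_le; first exact: bfs_mul_indic.
  exact: (bfs_mfun (bfs_mul_indic mA Xf)).
apply: aeW => s /=; rewrite !indicE; have [As|As] := boolP (s \in A).
  by rewrite (mem_set (AB _ (set_mem As))).
by rewrite mulr0 normr0.
Qed.

(** Countable subadditivity of A |-> ||u 1_A||: the norm being absolutely
    continuous, the part of the union not covered by finitely many sets is
    negligible. *)
Lemma nrm_bigcup_le u (A : nat -> set T) (c : R) : Xc u -> (forall n, measurable (A n)) ->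
  0 < c -> (forall n, N (u \* \1_(A n)) <= c / (2 ^ n.+1)%:R) ->
  N (u \* \1_(\bigcup_n A n)) <= c.
Proof.
move=> Xu mA c0 Ac; apply/ler_addgt0Pr => e e0.
have mU : measurable (\bigcup_n A n) by exact: bigcupT_measurable.
have [delta d0 ud] := ac_normP Xu e0.
pose V k := (\bigcup_n A n) `\` \bigcup_(n < k) A n.
have mV k : measurable (V k).
  by apply: measurableD => //; exact: bigcup_measurable.
have [k kd] : exists k, (rho (V k) < delta%:E)%E.
  apply: decreasing_measure_lt => //.
    move=> n x [xU nx]; split => // -[j jn Ax]; apply: nx; exists j => //=.
    exact: leq_trans jn (leqnSn n).
  rewrite (_ : \bigcap_n V n = set0) ?measure0//; apply/seteqP; split => x //.
  move=> xV; have [[n _ Ax] _] := xV 0%N I; have [_ []] := xV n.+1 I.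
  by exists n => //=.
have Xi j : Xc (u \* \1_(A j)) by exact: bfs_mul_indic.
have XV := bfs_mul_indic (mV k) Xu.
have Xs : Xc (fun s => \sum_(j <- iota 0 k) `|(u \* \1_(A j)) s|).
  by apply: bfs_sum => j; exact: bfs_norm.
pose w := (fun s => \sum_(j <- iota 0 k) `|(u \* \1_(A j)) s|) \+ (fun s => `|(u \* \1_(V k)) s|).
have Xw : Xc w by apply: bfsD => //; exact: bfs_norm.
apply: (@le_trans _ _ (N w)).
  apply: nrm_le => //; first exact: (bfs_mfun (bfs_mul_indic mU Xu)).
  apply: aeW => s; rewrite [leRHS]ger0_norm; last first.
    by rewrite addr_ge0//; exact: sumr_ge0.
  rewrite /w /=; have [sU|sU] := boolP (s \in \bigcup_n A n); last first.
    rewrite indicE (negbTE sU) mulr0 normr0 addr_ge0//; exact: sumr_ge0.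
  have [[j jk Aj]|nV] := pselect ((\bigcup_(n < k) A n) s).
    have jk' : j \in iota 0 k by rewrite mem_iota.
    apply: ler_wpDr => //; rewrite (big_rem j)//= ler_wpDr//; first exact: sumr_ge0.
    by rewrite !indicE sU (mem_set Aj).
  apply: ler_wpDl; first exact: sumr_ge0.
  by rewrite !indicE sU (mem_set (_ : V k s))//; split => //; exact: set_mem.
apply: (le_trans (nrmD Xs (bfs_norm XV))); apply: lerD; last first.
  by rewrite nrm_norm// ltW// ud.
apply: (le_trans (nrm_sum _ (fun j => bfs_norm (Xi j)))).
apply: (@le_trans _ _ (\sum_(j <- iota 0 k) c / (2 ^ j.+1)%:R)).
  by apply: ler_sum => j _; rewrite nrm_norm.
have -> : \sum_(j <- iota 0 k) c / (2 ^ j.+1)%:R = c - c / (2 ^ k)%:R.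
  elim: k {kd XV Xs w Xw} => [|k IH]; first by rewrite big_nil expn0 divr1 subrr.
  rewrite -addn1 iotaD big_cat IH big_seq1 add0n addn1.
  rewrite expnS natrM invfM; set z := (2 ^ k)%:R^-1; set y := (2 : R)^-1.
  have yE : y + y = 1 by rewrite /y; lra.
  have zE : c * z = c * (y * z) + c * (y * z) by rewrite -mulrDr -mulrDl yE mul1r.
  by rewrite zE /=; ring.
by rewrite gerBl divr_ge0// ltW.
Qed.

(** On the set where u > 0, the submeasure A |-> ||u 1_A|| vanishes only on
    null sets. *)
Lemma nrm_controls_measure u (e : R) : Xc u -> 0 < e ->
  exists2 delta : R, 0 < delta & forall A, measurable A ->
    N (u \* \1_A) < delta -> (rho (A `&` [set s | (0 < u s)%R]) < e%:E)%E.
Proof.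
move=> Xu e0; set W := [set s | 0 < u s].
have mW : measurable W by apply: measurable_gt; exact: (bfs_mfun Xu).
pose p A := (N (u \* \1_A))%:E; pose q A := rho (A `&` W).
have [|||||delta d0 h] := @submeasure_ac _ _ _ p q _ _ _ _ _ e e0.
- by move=> A mA; rewrite lee_fin nrm_ge0//; exact: bfs_mul_indic.
- by move=> A B mA mB AB; rewrite lee_fin nrm_mul_indic_le.
- by move=> A c mA c0 pA; rewrite lee_fin nrm_bigcup_le.
- move=> A B mA mB AB; rewrite le_measure ?inE//; try exact: measurableI.
  exact: setSI.
- move=> U r mU dU U0 r0.
  apply: (@decreasing_measure_lt _ _ _ rho _ (fun n => U n `&` W)) => //.
  + by move=> n; exact: measurableI.
  + by move=> n; apply: setSI; exact: dU.
  + have mI : measurable (\bigcap_n U n) by exact: bigcapT_measurable.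
    move: U0 => [] /(nrm_eq0 (bfs_mul_indic mI Xu))[Z [mZ Z0 sZ]].
    apply: (subset_measure0 _ mZ _ Z0).
      by apply: bigcapT_measurable => n; exact: measurableI.
    move=> s sUW; apply: sZ => /=.
    have [_ us] := sUW 0%N I.
    rewrite indicE mem_set; last by move=> n _; have [] := sUW n I.
    by rewrite mulr1 => u0; rewrite /W /= u0 ltxx in us.
- exists delta => // A mA Ad; apply: h => //; by rewrite lte_fin.
Qed.

(** Norm bounded sets are bounded in measure relative to u: if A is the
    exceptional set then K u 1_A <= |F|, so ||u 1_A|| is small for K large. *)
Lemma bounded_relative u (M e : R) : Xc u -> 0 < e ->
  exists2 K : R, 0 < K & forall F, Xc F -> N F <= M ->
    (rho ([set s | (K * u s < `|F s|)%R] `&` [set s | (0 < u s)%R]) < e%:E)%E.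
Proof.
move=> Xu e0; have [delta d0 h] := nrm_controls_measure Xu e0.
pose M1 := `|M| + 1; have M1_gt0 : 0 < M1 by rewrite ltr_wpDl.
exists (M1 / delta); first exact: divr_gt0.
have K0 : 0 < M1 / delta by exact: divr_gt0.
move=> F XF FM; set K := M1 / delta in K0 *.
set W := [set s | 0 < u s].
have mW : measurable W by apply: measurable_gt; exact: (bfs_mfun Xu).
pose A := [set s | K * u s < `|F s|] `&` W.
have mA : measurable A.
  apply: measurableI => //.
  rewrite (_ : [set _ | _] = [set s | 0 < `|F s| - K * u s]); last first.
    by apply/seteqP; split => s /=; rewrite subr_gt0.
  apply: measurable_gt; apply: measurable_funB.
    by apply: measurableT_comp => //; exact: (bfs_mfun XF).
  by apply: measurable_funM => //; exact: (bfs_mfun Xu).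
have XA := bfs_mul_indic mA Xu.
have : N (K \*o (u \* \1_A)) <= N F.
  apply: nrm_le => //; first exact: (bfs_mfun (bfsZ K XA)).
  apply: aeW => s /=; rewrite indicE; have [/set_mem[KF us]|_] := boolP (s \in A).
    by rewrite mulr1 ger0_norm; [exact: ltW|rewrite mulr_ge0// ltW].
  by rewrite mulr0 mulr0 normr0.
rewrite nrmZ// gtr0_norm// => KF.
have -> : [set s | K * u s < `|F s|] `&` W = A `&` W.
  by rewrite /A -setIA setIid.
apply: h => //; rewrite -(ltr_pM2l K0); apply: (le_lt_trans KF).
rewrite /K divfK ?gt_eqF//; apply: (le_lt_trans FM).
by rewrite /M1 (le_lt_trans (ler_norm _))// ltrDl.
Qed.

End ac_norm_control.

(** * Control of L^1(m) by a Rybakov measure *)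

Section rybakov_control.
Context dS (S : measurableType dS) (R : realType).
Variables (rho : {measure set S -> \bar R}) (X : bfs rho).
Context d (Omega : measurableType d).
Variable m : vmeasure X Omega.
Hypothesis hm_pos : vm_positive m.
Implicit Types (f g : Omega -> R) (A B : set Omega) (x : dual X).
Variable eta : {measure set Omega -> \bar R}.
Hypothesis ryb : rybakov m eta.

Local Notation Xc := (carrier X).
Local Notation L := (carrier (L1 m)).
Local Notation N := (nrm X).
Local Notation var x := (Defs.variation (scalar_measure m x)).
Local Notation J x f := (cint (scalar_measure m x) f).
Local Notation normL := (normL m).
Local Notation mint := (mint m).

Lemma rybakov_le : exists2 C : R, 0 < C & forall A, measurable A ->
  (eta A <= (C * N (m A))%:E)%E.
Proof.
have [[x0 etaE] _] := ryb; have [C C0 xC] := dual_le x0.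
exists (C + 1) => [|A mA]; first by rewrite ltr_wpDl.
rewrite etaE//; apply: le_trans (variation_le hm_pos mA C0 xC) _.
rewrite lee_fin ler_wpM2r ?lerDl// nrm_ge0//; exact: vm_carrier.
Qed.

Lemma rybakov_null A : measurable A -> eta A = 0%E -> N (m A) = 0.
Proof.
move=> mA eA; have [_ /(_ A mA)[/(_ eA) + _]] := ryb.
by rewrite semivariationE// => -[].
Qed.

Lemma rybakov_fin : (eta setT < +oo)%E.
Proof. by have [C _ /(_ setT measurableT)/le_lt_trans] := rybakov_le; apply; exact: ltry. Qed.

Lemma variation_null x A : measurable A -> N (m A) = 0 -> var x A = 0%E.
Proof.
move=> mA A0; have [C C0 xC] := dual_le x.
apply/eqP; rewrite eq_le measure_ge0 andbT.
by apply: le_trans (variation_le hm_pos mA C0 xC) _; rewrite A0 mulr0.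
Qed.

Lemma cint_decreasing_cvg0 x f (U : nat -> set Omega) : L f ->
  (forall n, measurable (U n)) -> (forall n, U n.+1 `<=` U n) ->
  eta (\bigcap_n U n) = 0%E -> J x (f \* \1_(U n)) @[n --> \oo] --> (0 : R).
Proof.
move=> Lf mU dU U0; have mI : measurable (\bigcap_n U n) by exact: bigcapT_measurable.
have vI := variation_null x mI (rybakov_null mI U0).
have dU' i j : (i <= j)%N -> U j `<=` U i.
  elim: j => [|j IH]; first by rewrite leqn0 => /eqP ->.
  rewrite leq_eqVlt => /orP[/eqP -> //|]; rewrite ltnS => /IH.
  by apply: subset_trans; exact: dU.
have mf := L1_mfun Lf.
have [] := @dominated_convergence _ _ _ (var x) setT measurableT
    (fun n => EFin \o (fun w => `|(f \* \1_(U n)) w|)) (cst 0%E) (EFin \o (fun w => `|f w|)).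
- move=> n; apply/measurable_EFinP; apply: measurableT_comp => //.
  exact: measurable_mul_indic.
- exact: measurable_cst.
- exists (\bigcap_n U n); split => // w /= h n _; apply: contrapT => nU; apply: h => _.
  apply: cvg_near_cst; exists n => // k /= nk.
  rewrite indicE memNset ?mulr0 ?normr0// => Uk; apply: nU; exact: dU' Uk.
- by have := integrable_norm (L1_vint x Lf).
- by apply: aeW => w n _; rewrite /= lee_fin normr_id normr_mul_indic_le.
move=> _ _; rewrite integral0 => h.
have {}h : fine (\int[var x]_w `|(f \* \1_(U n)) w|%:E)%E @[n --> \oo] --> (0 : R).
  exact: fine_cvg h.
apply/cvgn0P => e e0; have [n0 hn] := (cvgn0P _).1 h e e0.
exists n0 => n /hn; apply: le_lt_trans.
apply: (le_trans (normr_cint_le (L1_vint x (L1_mul_indic (mU n) Lf)))).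
exact: ler_norm.
Qed.

(** If the norms of f 1_(U n) stayed above r for a decreasing sequence U n with
    null intersection, some positive functional x would keep the integrals of
    |f| 1_(U n) against x m above r, contrary to dominated convergence. *)
Lemma L1_ac f (e : R) : L f -> 0 < e -> exists2 delta : R, 0 < delta &
  forall A, measurable A -> (eta A < delta%:E)%E -> normL (f \* \1_A) < e.
Proof.
move=> Lf e0; have Lf' := L1_norm Lf.
pose q A := (normL (f \* \1_A))%:E.
have [|||||delta d0 h] := @submeasure_ac _ _ _ eta q _ _ _ _ _ e e0.
- by [].
- by move=> A B mA mB AB; rewrite le_measure ?inE.
- move=> A c mA c0 Ac; apply: (@le_trans _ _ (\sum_(n <oo) eta (A n))%E).
    by apply: measure_sigma_subadditive => //; exact: bigcupT_measurable.
  apply: (@le_trans _ _ (\sum_(n <oo) (c / (2 ^ n.+1)%:R)%:E)%E).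
    by apply: lee_nneseries.
  exact/epsilon_trick0/ltW.
- move=> A B mA mB AB; rewrite lee_fin; apply: normL_le => //; try exact: L1_mul_indic.
  move=> w /=; rewrite !indicE; have [As|As] := boolP (w \in A).
    by rewrite (mem_set (AB _ (set_mem As))).
  by rewrite mulr0 normr0.
- move=> U r mU dU U0 r0; apply: contrapT => nU.
  pose g n := (fun w => `|f w|) \* \1_(U n).
  have Lg n : L (g n) by exact: L1_mul_indic.
  have g0 n w : 0 <= g n w by rewrite /g /= mulr_ge0.
  have gE n : (fun w => `|(f \* \1_(U n)) w|) = g n.
    by apply/funext => w; rewrite /g /= normrM [`|\1__ _|]ger0_norm.
  have [||x [bx px xr]] := @positive_norming_seq _ _ _ _ X (fun n => mint (g n)) r
      (fun n => mint_carrier m (g n)).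
  + move=> n; apply: mint_le => // w; rewrite /g /= !indicE.
    have [Us|Us] := boolP (w \in U n.+1); last by rewrite mulr0 mulr_ge0.
    by rewrite (mem_set (dU _ _ (set_mem Us))).
  + move=> n; have := mint_ge0 hm_pos (Lg n) (g0 n) => vg0.
    have <- : N (mint (g n)) = N (mint (g n))^\+.
      apply: nrm_ae; [exact: mint_carrier|exact/bfs_pos/mint_carrier|].
      by apply: filterS vg0 => s; rewrite /funrpos => /max_idPl.
    rewrite leNgt; apply/negP => lt; apply: nU; exists n.
    by rewrite /q lte_fin -[normL _]/(N (mint (fun w => `|(f \* \1_(U n)) w|))) gE.
  have h := cint_decreasing_cvg0 x Lf' mU dU U0.
  have [n /(_ n (leqnn n))] := (cvgn0P _).1 h r r0.
  rewrite -/(g n) -(mintE x (Lg n)) => lt; have := xr n.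
  by rewrite leNgt (le_lt_trans (ler_norm _) lt).
- exists delta => // A mA Ad; by have := h A mA Ad; rewrite lte_fin.
Qed.

Lemma L1_null f A : L f -> measurable A -> eta A = 0%E -> normL (f \* \1_A) = 0.
Proof.
move=> Lf mA A0; apply/eqP; rewrite eq_le normL_ge0 andbT.
apply/ler_addgt0Pr => e e0; rewrite add0r; have [delta d0 h] := L1_ac Lf e0.
by rewrite ltW// h// A0 lte_fin.
Qed.

Lemma normL_ae_le f g : L f -> L g -> {ae eta, forall w, `|g w| <= `|f w|} ->
  normL g <= normL f.
Proof.
move=> Lf Lg [Z [mZ Z0 sZ]]; have mC := measurableC mZ.
have -> : g = (g \* \1_Z) \+ (g \* \1_(~` Z)).
  apply/funext => w /=; rewrite -mulrDr !indicE in_setC.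
  by case: (w \in Z); rewrite /= ?addr0 ?add0r mulr1.
have L1' := L1_mul_indic mZ Lg; have L2' := L1_mul_indic mC Lg.
apply: (le_trans (normLD hm_pos L1' L2')); rewrite (L1_null Lg mZ Z0) add0r.
apply: normL_le => // w /=; rewrite indicE; have [/set_mem nZ|_] := boolP (w \in ~` Z).
  by rewrite mulr1; apply: contrapT => h; apply: nZ; exact: sZ.
by rewrite mulr0 normr0.
Qed.

Lemma normL_ae_eq f g : L f -> L g -> {ae eta, forall w, f w = g w} -> normL f = normL g.
Proof.
by move=> Lf Lg fg; apply/eqP; rewrite eq_le; apply/andP; split;
  apply: normL_ae_le => //; apply: filterS fg => w ->.
Qed.

Lemma cint_ae_eq x f g : L f -> L g -> {ae eta, forall w, f w = g w} -> J x f = J x g.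
Proof.
move=> Lf Lg fg; apply/eqP; rewrite -subr_eq0 -cintB// -normr_le0.
have [C C0 xC] := dual_le x; have LB := L1B Lf Lg.
apply: (le_trans (cint_normL_le hm_pos LB C0 xC)).
have L0 := L1_0 m.
have -> : normL (f \- g) = normL (0 \*o f).
  apply: normL_ae_eq => //; first exact: L1Z.
  by apply: filterS fg => w /= ->; rewrite subrr mul0r.
by rewrite normLZ// normr0 mul0r mulr0.
Qed.

Lemma L1_markov f (k : R) : L f -> 0 < k ->
  N (m [set w | k < `|f w|]) <= normL f / k.
Proof.
move=> Lf k0; have Lf' := L1_norm Lf.
have mA : measurable [set w | k < `|f w|] by apply: measurable_gt; exact: L1_mfun Lf'.
rewrite ler_pdivlMr// mulrC -normL_indic//.
have LA := L1_indic m mA.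
rewrite -{1}(gtr0_norm k0) -normLZ//; apply: normL_le => //; first exact: L1Z.
move=> w /=; rewrite indicE; have [/set_mem /= h|_] := boolP (w \in _).
  by rewrite mulr1 gtr0_norm// ltW.
by rewrite mulr0 normr0.
Qed.

End rybakov_control.

(** * Truncation of bounded sequences of L^1(m) *)

Lemma gap_le (R : realFieldType) (x y x' y' e1 e2 : R) : x - y <= e1 ->
  `|x - x'| < e2 -> `|y - y'| < e2 -> x' - y' <= e1 + e2 + e2.
Proof. by rewrite !ltr_norml => h1 /andP[h2 h3] /andP[h4 h5]; lra. Qed.

Lemma quarter_le (R : realFieldType) (x y e : R) : 0 < y -> 0 < x ->
  e <= x / 4 * y / 2 / 2 -> x / 4 * y / 2 + e + e <= x / 2 * y.
Proof.
move=> y0 x0 h; have xy : 0 < x * y by rewrite mulr_gt0.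
rewrite (_ : x / 4 * y / 2 / 2 = x * y / 16) in h; last by field.
rewrite (_ : x / 4 * y / 2 = x * y / 8); last by field.
by rewrite (_ : x / 2 * y = x * y / 2); [lra|field].
Qed.

Section unif_ac.
Context d (T : measurableType d) (R : realType).
Variables (rho : {measure set T -> \bar R}) (X : bfs rho).

Lemma uniformly_ac_range (G : nat -> T -> R) (e : R) : (forall n, carrier X (G n)) ->
  uniformly_ac rho X (range G) -> 0 < e -> exists2 delta : R, 0 < delta &
  forall A n, measurable A -> (rho A < delta%:E)%E -> nrm X (G n \* \1_A) < e.
Proof.
move=> XG uG e0; have [delta d0 h] := uG e e0; exists delta => // A n mA Ad.
rewrite -lte_fin -fnormE; last exact: bfs_mul_indic.
apply: le_lt_trans (h A mA Ad); apply: ereal_sup_ubound.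
by exists (G n) => //; exists n.
Qed.

End unif_ac.

Section truncation.
Context dS (S : measurableType dS) (R : realType).
Variables (rho : {measure set S -> \bar R}) (X : bfs rho).
Context d (Omega : measurableType d).
Variable m : vmeasure X Omega.
Hypothesis hm_pos : vm_positive m.
Hypothesis rho_fin : (rho setT < +oo)%E.
Implicit Types (f g : Omega -> R) (A B : set Omega).

Local Notation Xc := (carrier X).
Local Notation L := (carrier (L1 m)).
Local Notation N := (nrm X).
Local Notation normL := (normL m).
Local Notation mint := (mint m).

Definition band (j i : R) f : set Omega := [set w | j < `|f w| <= i].

Lemma measurable_band j i f : measurable_fun setT f -> measurable (band j i f).
Proof.
move=> mf; have mn : measurable_fun setT (fun w => `|f w|) by exact: measurableT_comp.
rewrite (_ : band j i f = [set w | j < `|f w|] `\` [set w | i < `|f w|]).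
  by apply: measurableD; exact: measurable_gt.
apply/seteqP; split => w; rewrite /band /=.
  by move=> /andP[-> wi]; split => //; apply/negP; rewrite -leNgt.
by move=> [-> /negP]; rewrite -leNgt.
Qed.

Definition low (k : R) f : set Omega := [set w | `|f w| <= k].

Lemma measurable_low k f : measurable_fun setT f -> measurable (low k f).
Proof.
move=> mf; have mn : measurable_fun setT (fun w => `|f w|) by exact: measurableT_comp.
rewrite (_ : low k f = ~` [set w | k < `|f w|]).
  by apply: measurableC; exact: measurable_gt.
apply/seteqP; split => w; rewrite /low /= => h; first by apply/negP; rewrite -leNgt.
by rewrite leNgt; apply/negP.
Qed.

(** Bounded and increasing in t, and invariant under scaling both u and t, so that
    its increments measure those of t relative to u. *)
Let phi (u t : R) := t / (u + t).

Let phi01 u t : 0 <= u -> 0 <= t -> 0 <= phi u t <= 1.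
Proof.
move=> u0 t0; rewrite /phi; have [->|nz] := eqVneq (u + t) 0.
  by rewrite invr0 mulr0 lexx ler01.
have ut : 0 < u + t by rewrite lt_neqAle eq_sym nz addr_ge0.
by rewrite divr_ge0 ?(ltW ut)// ler_pdivrMr// mul1r lerDr.
Qed.

Let phi_le u t t' : 0 <= u -> 0 <= t -> t <= t' -> phi u t <= phi u t'.
Proof.
move=> u0 t0 tt; have [u00|nz] := eqVneq u 0.
  rewrite u00 /phi !add0r; have [->|tz] := eqVneq t 0.
    by rewrite mul0r mulr_ge0 ?invr_ge0// (le_trans t0).
  have tp : 0 < t by rewrite lt_neqAle eq_sym tz.
  by rewrite !divff// gt_eqF// (lt_le_trans tp).
have up : 0 < u by rewrite lt_neqAle eq_sym nz.
have p1 : 0 < u + t by rewrite ltr_pwDl.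
have p2 : 0 < u + t' by rewrite ltr_pwDl// (le_trans t0).
rewrite /phi ler_pdivrMr// mulrAC ler_pdivlMr// !mulrDr.
by rewrite [t * t']mulrC lerD2r ler_wpM2r// ltW.
Qed.

Let phi_gap u t t' K c : 0 < u -> 0 <= t -> 0 < c -> 0 < K ->
  t' <= K * u -> c * u <= t' - t -> c / (1 + K) ^+ 2 <= phi u t' - phi u t.
Proof.
move=> u0 t0 c0 K0 tK ct.
have tt : t <= t' by rewrite -subr_ge0; apply: le_trans ct; rewrite mulr_ge0 ?ltW.
have p1 : 0 < u + t by rewrite ltr_pwDl.
have p2 : 0 < u + t' by rewrite ltr_pwDl// (le_trans t0).
have -> : phi u t' - phi u t = (u * (t' - t)) / ((u + t') * (u + t)).
  by rewrite /phi; field; rewrite !gt_eqF.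
have K1 : 0 < 1 + K by rewrite addr_gt0.
rewrite ler_pdivrMr ?exprn_gt0// mulrAC ler_pdivlMr ?mulr_gt0//.
have h1 : u + t' <= (1 + K) * u by rewrite mulrDl mul1r lerD2l.
have h2 : u + t <= (1 + K) * u by apply: le_trans h1; rewrite lerD2l.
have h3 : (u + t') * (u + t) <= ((1 + K) * u) * ((1 + K) * u).
  by apply: ler_pM => //; exact: ltW.
apply: (@le_trans _ _ (c * (((1 + K) * u) * ((1 + K) * u)))).
  by rewrite ler_wpM2l// ltW.
have -> : c * (((1 + K) * u) * ((1 + K) * u)) = (c * u) * (u * (1 + K) ^+ 2) by ring.
rewrite [u * (t' - t)]mulrC -[leRHS]mulrA ler_wpM2r// mulr_ge0 ?ltW// exprn_gt0//.
Qed.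

Variable f : nat -> Omega -> R.
Hypothesis Lf : forall n, L (f n).

Let absf n w : R := `|f n w|.
Let Labs n : L (absf n). Proof. exact: L1_norm. Qed.
Let mf n : measurable_fun setT (f n). Proof. exact: L1_mfun (Lf n). Qed.
Let cut n (k : nat) : Omega -> R := absf n \* \1_(low k%:R (f n)).
Let Lcut n k : L (cut n k).
Proof. by apply: L1_mul_indic => //; exact: measurable_low. Qed.

Let F n k s : R := `|mint (cut n k) s|.
Let u s : R := `|mint (cst 1) s|.
Let XF n k : Xc (F n k). Proof. by apply: bfs_norm; exact: mint_carrier. Qed.
Let Xu : Xc u. Proof. by apply: bfs_norm; exact: mint_carrier. Qed.
Let L11 : L (cst 1). Proof. exact: L1_cst. Qed.

Let cut_ge0 n k w : 0 <= cut n k w.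
Proof. by rewrite /cut /absf /= mulr_ge0. Qed.

Let F_le n j k : (j <= k)%N -> {ae rho, forall s, F n j s <= F n k s}.
Proof.
move=> jk; have h0 := mint_ge0 hm_pos (Lcut n j) (cut_ge0 n j).
have : {ae rho, forall s, mint (cut n j) s <= mint (cut n k) s}.
  apply: mint_le => // w; rewrite /cut /absf /= !indicE.
  have [/set_mem h|_] := boolP (w \in low j%:R _); last by rewrite mulr0 mulr_ge0.
  by rewrite mem_set//; apply: (le_trans h); rewrite ler_nat.
move=> h1; apply: filterS2 h0 h1 => s h0 h1; rewrite /F !ger0_norm//.
exact: le_trans h1.
Qed.

Let F_le_u n k : {ae rho, forall s, F n k s <= k%:R * u s}.
Proof.
have h0 := mint_ge0 hm_pos (Lcut n k) (cut_ge0 n k).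
have Lk : L (k%:R \*o cst 1) by exact: L1Z.
have h1 : {ae rho, forall s, mint (cut n k) s <= mint (k%:R \*o cst 1) s}.
  apply: mint_le => // w; rewrite /cut /absf /= mulr1 indicE.
  by have [/set_mem h|_] := boolP (w \in low _ _); rewrite ?mulr1 ?mulr0.
have h2 := mintZ k%:R L11.
apply: filterS3 h0 h1 h2 => s h0 h1 h2.
rewrite /F ger0_norm// (le_trans h1)// h2 ler_wpM2l// /u ler_norm//.
Qed.

Let F_le_all n k : {ae rho, forall s, F n k s <= `|mint (absf n) s|}.
Proof.
have h0 := mint_ge0 hm_pos (Lcut n k) (cut_ge0 n k).
have h1 : {ae rho, forall s, mint (cut n k) s <= mint (absf n) s}.
  apply: mint_le => // w; rewrite /cut /absf /= indicE.
  by case: (w \in _); rewrite ?mulr1// mulr0.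
apply: filterS2 h0 h1 => s h0 h1; rewrite /F ger0_norm//.
by rewrite (le_trans h1)// ler_norm.
Qed.

Let F_band n j i : (j <= i)%N -> {ae rho, forall s,
  mint (fun w => `|(f n \* \1_(band j%:R i%:R (f n))) w|) s = F n i s - F n j s}.
Proof.
move=> ji; have -> : (fun w => `|(f n \* \1_(band j%:R i%:R (f n))) w|) = cut n i \- cut n j.
  apply/funext => w; rewrite /cut /absf /= normrM [`|\1__ _|]ger0_norm// -mulrBr.
  congr (_ * _); rewrite !indicE.
  have ji' : j%:R <= i%:R :> R by rewrite ler_nat.
  have [wj|wj] := leP `|f n w| j%:R.
    rewrite (mem_set (_ : low j%:R (f n) w))// (mem_set (_ : low i%:R (f n) w)); last first.
      exact: le_trans ji'.
    by rewrite memNset ?subrr// /band /= ltNge wj.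
  rewrite (memNset (_ : ~ low j%:R (f n) w)); last by rewrite /low /= leNgt wj.
  rewrite subr0; have [wi|wi] := leP `|f n w| i%:R.
    by rewrite (mem_set (_ : low i%:R (f n) w))// mem_set// /band /= wj wi.
  by rewrite !memNset// /band /low /= leNgt wi ?andbF.
have h0 := mint_ge0 hm_pos (Lcut n i) (cut_ge0 n i).
have h1 := mint_ge0 hm_pos (Lcut n j) (cut_ge0 n j).
apply: filterS3 h0 h1 (mintB (Lcut n i) (Lcut n j)) => s h0 h1 ->.
by rewrite /F !ger0_norm.
Qed.

Let z n k s : R := phi (u s) (F n k s).

Let u0 s : 0 <= u s. Proof. exact: normr_ge0. Qed.
Let F0 n k s : 0 <= F n k s. Proof. exact: normr_ge0. Qed.
Let z01 n k s : 0 <= z n k s <= 1. Proof. exact: phi01. Qed.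

Let mz n k : measurable_fun setT (z n k).
Proof.
apply: measurable_funM; first exact: (bfs_mfun (XF n k)).
rewrite (_ : (fun s => _) = (fun s => (u s + F n k s) `^ (-1))); last first.
  by apply/funext => s; rewrite powR_inv1// addr_ge0 ?u0 ?F0.
apply: (measurableT_comp (measurable_powR _)).
by apply: measurable_funD; [exact: (bfs_mfun Xu)|exact: (bfs_mfun (XF n k))].
Qed.

Let bounded1_integrable (g : S -> R) : measurable_fun setT g -> (forall s, `|g s| <= 1) ->
  rho.-integrable setT (EFin \o g).
Proof.
move=> mg g1; apply: measurable_bounded_integrable => //.
exists 1; split; first exact: num_real.
by move=> r r1 s _ /=; apply: (le_trans (g1 s)); exact: ltW.
Qed.

Let zi n k : rho.-integrable setT (EFin \o z n k).
Proof.
apply: bounded1_integrable => // s; have /andP[z0 z1] := z01 n k s.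
by rewrite ger0_norm.
Qed.

Let a n k := Rintegral rho setT (z n k).

Let a_bound n k : `|a n k| <= fine (rho setT).
Proof.
rewrite ger0_norm; last by apply: Rintegral_ge0 => s _; have /andP[] := z01 n k s.
rewrite -[leRHS]mul1r -Rintegral_cst//; apply: le_Rintegral => //; first exact: zi.
  by apply: bounded1_integrable => // s; rewrite normr1.
by move=> s _; have /andP[] := z01 n k s.
Qed.

Let gapE n j k : (j <= k)%N ->
  (a n k - a n j)%:E = (\int[rho]_s `|z n k s - z n j s|%:E)%E.
Proof.
move=> jk; have zki := zi n k; have zji := zi n j.
have mB : measurable_fun setT (fun s => z n k s - z n j s) by exact: measurable_funB.
rewrite /a -RintegralB// /Rintegral fineK; last first.
  apply: integrable_fin_num => //.
  rewrite (_ : (fun s => _) = (EFin \o z n k) \- (EFin \o z n j))%E//.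
  exact: integrableB.
apply: ae_eq_integral => //; first exact/measurable_EFinP.
  by apply/measurable_EFinP; exact: measurableT_comp.
apply: filterS (F_le n jk) => s Fs _.
by rewrite ger0_norm// subr_ge0; apply: phi_le.
Qed.

Let a_le n j k : (j <= k)%N -> a n j <= a n k.
Proof. by move=> jk; rewrite -subr_ge0 -lee_fin gapE// integral_ge0. Qed.

Let gap_measure n j k (c : R) : (j <= k)%N -> 0 < c ->
  (rho [set s | (c <= `|z n k s - z n j s|)%R] <= ((a n k - a n j) / c)%:E)%E.
Proof.
move=> jk c0; rewrite mulrC EFinM gapE// lee_pdivlMl//.
have mB : measurable_fun setT (fun s => z n k s - z n j s) by exact: measurable_funB.
have := @le_integral_comp_abse _ _ _ rho setT measurableT
  (fun s => (z n k s - z n j s)%:E) c id.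
rewrite setTI; apply => //; exact/measurable_EFinP.
Qed.

(** The truncations of f (p i) at height i have uniformly small upper bands,
    which is their equi-integrability. The height can be as large as the index
    i because every condition on the i-th term holds for arbitrarily large
    indices of the sequence. *)
Theorem uniform_truncation (M : R) : subsequence_splitting rho X ->
  (forall n, normL (f n) <= M) ->
  exists2 p : nat -> nat, {homo p : i j / (i < j)%N} &
    forall e : R, 0 < e -> exists j i0 : nat, forall i, (i0 <= i)%N -> (j <= i)%N ->
      normL (f (p i) \* \1_(band j%:R i%:R (f (p i)))) <= e.
Proof.
move=> [acX splitX] fM.
have [||p0 [G [H [p0h GH FGH uG dH]]]] := splitX (fun n => mint (absf n)).
- by move=> n; exact: mint_carrier.
- by exists M => n; rewrite fnormE ?lee_fin; [exact: fM|exact: mint_carrier].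
pose B n := [set s | H n s != 0].
have XH n : Xc (H n) by have [] := GH n.
have XG n : Xc (G n) by have [] := GH n.
have mB n : measurable (B n) by apply: measurable_neq0; exact: (bfs_mfun (XH n)).
have uB e : 0 < e -> exists n0, forall n, (n0 <= n)%N -> N (u \* \1_(B n)) < e.
  move=> e0; have [delta d0 ud] := ac_normP acX Xu e0.
  have [|n0 Bn0] := almost_disjoint_tail rho_fin mB _ d0.
    move=> i j /dH[Z [mZ Z0 sZ]]; apply: (subset_measure0 _ mZ _ Z0).
      exact: measurableI.
    by move=> s [/eqP Hi /eqP Hj]; apply: sZ => /= -[].
  exists n0 => n n0n; apply: ud => //; apply: le_lt_trans Bn0.
  rewrite le_measure ?inE//; first exact: bigcupT_measurable.
  by move=> s Bs; exists (n - n0)%N => //; rewrite subnKC.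
have [U UU oU] := free_ultrafilter.
have PU : ProperFilter U by exact: ultra_proper.
have /choice[al alP] k : exists l : R, a (p0 n) k @[n --> U] --> l.
  by apply: (@ultrafilter_lim _ _ _ (fine (rho setT))) => n; exact: a_bound.
have al_le j k : (j <= k)%N -> al j <= al k.
  move=> jk; apply: (ler_cvg_to (alP j) (alP k)).
  by apply: filterS (@filterT _ U _) => n _; exact: a_le.
have al_bound k : al k <= fine (rho setT).
  apply: (ler_cvg_to (alP k) (cvg_cst _)).
  apply: filterS (@filterT _ U _) => n _.
  by apply: le_trans (a_bound (p0 n) k); exact: ler_norm.
have al_cauchy c : 0 < c -> exists j, forall i, (j <= i)%N -> al i - al j <= c.
  move=> c0; have ic : cvgn al.
    apply: nondecreasing_is_cvgn; first by move=> i j; exact: al_le.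
    by exists (fine (rho setT)) => _ [k _ <-].
  have [j _ hj] := cvgr_dist_lt _ _ ic c c0.
  exists j => i ji; have := nondecreasing_cvgn_le _ ic i.
  move=> /(_ (fun i j => @al_le i j)) h1; have := hj j (leqnn j).
  by move=> /ltW /ler_normlW h2; apply: le_trans h2; rewrite lerD2r.
(* The i-th index n is chosen so that the first i + 1 integrals are close to
   their limits and so that i u is small on B n. *)
pose P (s : seq nat) n := (forall k : 'I_(size s).+1,
   `|al k - a (p0 n) k| < (size s).+1%:R^-1) /\
   (size s)%:R * N (u \* \1_(B n)) <= (size s).+1%:R^-1.
have [s N0|q qh qP] := @extract_subsequence P.
  set i := size s; have i1 : 0 < i.+1%:R^-1 :> R by rewrite invr_gt0 ltr0n.
  have i2 : 0 < i.+1%:R^-1 / i.+1%:R :> R by rewrite divr_gt0.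
  have [n0 hn0] := uB _ i2.
  have U1 : U [set n | (N0 <= n)%N] by apply: oU; exists N0.
  have U2 : U [set n | (n0 <= n)%N] by apply: oU; exists n0.
  have U3 : U [set n | forall k : 'I_i.+1, `|al k - a (p0 n) k| < i.+1%:R^-1].
    apply: filter_forall => k; exact: (cvgr_dist_lt _ _ (alP k)).
  have [n [[/= n1 n2] n3]] := filter_ex (filterI (filterI U1 U2) U3).
  exists n => //; split; first exact: n3.
  have := ltW (hn0 n n2); rewrite ler_pdivlMr ?ltr0n// => h.
  apply: le_trans h; rewrite mulrC ler_wpM2l ?ler_nat//.
  by apply: nrm_ge0; exact: bfs_mul_indic.
exists (p0 \o q); first by move=> i j ij; apply: p0h; exact: qh.
have qP1 i k : (k <= i)%N -> `|al k - a (p0 (q i)) k| < i.+1%:R^-1.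
  by move=> ki; have [] := qP i; rewrite size_mkseq => /(_ (Ordinal (ki : (k < i.+1)%N))).
have qP2 i : i%:R * N (u \* \1_(B (q i))) <= i.+1%:R^-1.
  by have [_] := qP i; rewrite size_mkseq.
move=> e e0; pose t := e / 3 / (N u + 1).
have Nu0 := nrm_ge0 Xu.
have Nu1 : 0 < N u + 1 by rewrite ltr_wpDl.
have e3 : 0 < e / 3 by rewrite divr_gt0.
have t0 : 0 < t by rewrite divr_gt0.
have tNu : t * N u <= e / 3.
  by rewrite /t mulrAC ler_pdivrMr// ler_wpM2l ?(ltW e3)// lerDl.
have [delta d0 Gd] := uniformly_ac_range XG uG e3.
have d2 : 0 < delta / 2 by rewrite divr_gt0.
have [K K0 KP] := bounded_relative rho_fin acX M Xu d2.
(* Where F <= K u, an increment of F by t u increases F / (u + F) by at least c. *)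
pose c := t / (1 + K) ^+ 2.
have c0 : 0 < c by rewrite divr_gt0// exprn_gt0// addr_gt0.
have dc2 : 0 < delta / 4 * c / 2 by rewrite divr_gt0// mulr_gt0// divr_gt0.
(* j is the height after which the integrals of z can grow by at most
   delta / 8 * c, so that by Markov's inequality z grows by c only on a set of
   measure at most delta / 2. *)
have [j hj] := al_cauchy _ dc2.
have [i1 hi1] : exists i1 : nat, forall i, (i1 <= i)%N ->
    i.+1%:R^-1 <= e / 3 /\ i.+1%:R^-1 <= delta / 4 * c / 2 / 2.
  have [n1 h1] := ltr_add_invr e3; have dc4 : 0 < delta / 4 * c / 2 / 2 by rewrite divr_gt0.
  have [n2 h2] := ltr_add_invr dc4; rewrite !add0r in h1 h2.
  exists (maxn n1 n2) => i; rewrite geq_max => /andP[i1 i2]; split.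
    by apply: le_trans (ltW h1); rewrite lef_pV2 ?posrE ?ltr0n// ler_nat ltnS.
  by apply: le_trans (ltW h2); rewrite lef_pV2 ?posrE ?ltr0n// ler_nat ltnS.
exists j, i1 => i i1i ji /=; have [ie id] := hi1 i i1i.
set n := p0 (q i).
pose D := mint (fun w => `|(f n \* \1_(band j%:R i%:R (f n))) w|).
have XD : Xc D by exact: mint_carrier.
rewrite -[normL _]/(N D).
pose C := [set s | t * u s < `|D s|].
have mC : measurable C.
  rewrite (_ : C = [set s | 0 < `|D s| - t * u s]); last first.
    by apply/seteqP; split => s; rewrite /C /= subr_gt0.
  apply: measurable_gt; apply: measurable_funB.
    by apply: measurableT_comp => //; exact: (bfs_mfun XD).
  by apply: measurable_funM => //; exact: (bfs_mfun Xu).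
have DE := F_band n ji; have Fji := F_le n ji; have Fiu := F_le_u n i.
have FiA := F_le_all n i; have [FG dGH] := FGH (q i).
have rC : (rho C < delta%:E)%E.
  have XFi := XF n i.
  have NFi : N (F n i) <= M.
    apply: le_trans (fM n); rewrite -[normL _]/(N (mint (absf n))).
    by apply: nrm_le => //; [exact: mint_carrier|exact: (bfs_mfun XFi)|
      apply: filterS FiA => s; rewrite [`|F n i s|]ger0_norm].
  pose C1 := [set s | c <= `|z n i s - z n j s|].
  pose C2 := [set s | K * u s < `|F n i s|] `&` [set s | 0 < u s].
  have mC1 : measurable C1.
    apply: measurable_ge; apply: measurableT_comp => //; exact: measurable_funB.
  have mC2 : measurable C2.
    apply: measurableI; last by apply: measurable_gt; exact: (bfs_mfun Xu).
    rewrite (_ : [set _ | _] = [set s | 0 < `|F n i s| - K * u s]); last first.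
      by apply/seteqP; split => s /=; rewrite subr_gt0.
    apply: measurable_gt; apply: measurable_funB.
      by apply: measurableT_comp => //; exact: (bfs_mfun XFi).
    by apply: measurable_funM => //; exact: (bfs_mfun Xu).
  have CC : (rho C <= rho (C1 `|` C2))%E.
    apply: le_measure_ae => //; first exact: measurableU.
    apply: filterS3 DE Fji Fiu => s Ds Fs us Cs.
    have D0 : 0 <= D s by rewrite /D Ds subr_ge0.
    rewrite /C /= ger0_norm// in Cs.
    have us0 : 0 < u s.
      rewrite lt_neqAle eq_sym u0 andbT; apply/eqP => us00.
      move: Cs; rewrite us00 mulr0 => Cs; move: us; rewrite us00 mulr0 => us.
      have Ds0 : D s <= 0 by rewrite /D Ds subr_le0 (le_trans us).
      by have := lt_le_trans Cs Ds0; rewrite ltxx.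
    have [FK|FK] := leP (F n i s) (K * u s); last by right; split => //=; rewrite ger0_norm.
    left; rewrite /C1 /=; apply: le_trans (ler_norm _); apply: phi_gap => //.
    by rewrite -Ds; exact: ltW.
  apply: (le_lt_trans CC); apply: (@le_lt_trans _ _ (rho C1 + rho C2)%E).
    exact: measureU2.
  have -> : delta%:E = ((delta / 2)%:E + (delta / 2)%:E)%E by rewrite -EFinD -splitr.
  apply: lee_ltD; last exact: KP.
    by rewrite ge0_fin_numE//; exact: finite_measure_lty.
  apply: (le_trans (gap_measure n ji c0)); rewrite lee_fin ler_pdivrMr//.
  apply: (le_trans (gap_le (hj i ji) (qP1 i i (leqnn i)) (qP1 i j ji))).
  exact: quarter_le.
(* The three terms dominate D where D <= t u, on C off B, and on B. *)
pose w1 s := t * u s + `|(G (q i) \* \1_C) s| + i%:R * (u \* \1_(B (q i))) s.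
have XGC : Xc (G (q i) \* \1_C) by exact: bfs_mul_indic.
have XuB : Xc (u \* \1_(B (q i))) by exact: bfs_mul_indic.
have Xw1 : Xc (t \*o u \+ (fun s => `|(G (q i) \* \1_C) s|)).
  by apply: bfsD; [exact: bfsZ|exact: bfs_norm].
have Xw : Xc w1 by apply: (@bfsD _ _ _ _ X _ (i%:R \*o (u \* \1_(B (q i)))) Xw1); exact: bfsZ.
apply: (@le_trans _ _ (N w1)).
  apply: nrm_le => //; first exact: (bfs_mfun XD).
  apply: filterS3 (filterI DE Fji) (filterI Fiu FiA) (filterI FG dGH).
  move=> s [Ds Fs] [us FA] [FGs dGHs].
  have D0 : 0 <= D s by rewrite /D Ds subr_ge0.
  have DF : D s <= F n i s by rewrite /D Ds gerBl.
  have tu0 : 0 <= t * u s by rewrite mulr_ge0// ltW.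
  have g0 : 0 <= `|(G (q i) \* \1_C) s| by [].
  have ub0 (A : set S) : 0 <= i%:R * (u \* \1_A) s by rewrite mulr_ge0//= mulr_ge0 ?u0.
  rewrite ger0_norm// [leRHS]ger0_norm; last by rewrite !addr_ge0.
  rewrite /w1; have [sB|sB] := pselect (B (q i) s).
    apply: ler_wpDl; first exact: addr_ge0.
    by rewrite /= indicE (mem_set sB) mulr1; apply: (le_trans DF).
  apply: ler_wpDr => //; have [sC|sC] := pselect (C s); last first.
    apply: ler_wpDr => //; move: sC => /negP; rewrite -leNgt.
    exact: le_trans (ler_norm _).
  apply: ler_wpDl => //=; rewrite indicE (mem_set sC) mulr1.
  have -> : G (q i) s = mint (absf n) s.
    by rewrite FGs; have /negP := sB; rewrite negbK => /eqP ->; rewrite addr0.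
  exact: le_trans FA.
have h1 : N (t \*o u \+ (fun s => `|(G (q i) \* \1_C) s|)) <= e / 3 + e / 3.
  apply: (le_trans (nrmD (bfsZ t Xu) (bfs_norm XGC))).
  rewrite nrm_norm// nrmZ// ger0_norm ?(ltW t0)//.
  by apply: lerD => //; exact/ltW/Gd.
have h2 : N (i%:R \*o (u \* \1_(B (q i)))) <= e / 3.
  by rewrite nrmZ// ger0_norm//; exact: le_trans (qP2 i) ie.
apply: (le_trans (nrmD Xw1 (bfsZ i%:R XuB))); rewrite [leRHS](third_sum e).
exact: lerD.
Qed.

End truncation.

(** * Subsequence splitting in L^1(m) *)

Section splitting.
Context dS (S : measurableType dS) (R : realType).
Variables (rho : {measure set S -> \bar R}) (X : bfs rho).
Context d (Omega : measurableType d).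
Variable m : vmeasure X Omega.
Hypothesis hm_pos : vm_positive m.
Hypothesis rho_fin : (rho setT < +oo)%E.
Variable eta : {measure set Omega -> \bar R}.
Hypothesis ryb : rybakov m eta.
Implicit Types (f g : Omega -> R) (A B : set Omega).

Local Notation L := (carrier (L1 m)).
Local Notation normL := (normL m).

(** The finitely many terms not covered by the hypothesis are handled one by
    one by L1_ac. *)
Lemma uniformly_ac_L1 (g : nat -> Omega -> R) : (forall n, L (g n)) ->
  (forall e : R, 0 < e -> exists2 delta : R, 0 < delta & exists i0 : nat,
     forall i A, (i0 <= i)%N -> measurable A -> (eta A < delta%:E)%E ->
       normL (g i \* \1_A) <= e) ->
  uniformly_ac eta (L1 m) (range g).
Proof.
move=> Lg gt e e0; have e2 : 0 < e / 2 by rewrite divr_gt0.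
have [d0 d00 [i0 h0]] := gt _ e2.
have [d1 d10 h1] : exists2 d1 : R, 0 < d1 & forall i A, (i < i0)%N -> measurable A ->
    (eta A < d1%:E)%E -> normL (g i \* \1_A) <= e / 2.
  elim: i0 {h0} => [|i0 [d1 d10 h1]]; first by exists 1.
  have [d2 d20 h2] := L1_ac hm_pos ryb (Lg i0) e2.
  exists (Num.min d1 d2) => [|i A]; first by rewrite lt_min d10.
  rewrite ltnS leq_eqVlt => /orP[/eqP ->|ii] mA; rewrite EFin_min lt_min => /andP[A1 A2].
    by rewrite ltW// h2.
  exact: h1.
exists (Num.min d0 d1) => [|A mA]; first by rewrite lt_min d00.
rewrite EFin_min lt_min => /andP[A0 A1].
apply: (@le_lt_trans _ _ (e / 2)%:E); last by rewrite lte_fin gtr_pMr// invf_lt1// ltr1n.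
apply: ge_ereal_sup => _ [_ [i _ <-] <-].
have Li := L1_mul_indic mA (Lg i).
rewrite fnorm_L1E// lee_fin; have [ii|ii] := leqP i0 i; [exact: h0|exact: h1].
Qed.

Lemma L1_ac_norm : ac_norm eta (L1 m).
Proof.
move=> f Lf e e0; have [delta d0 h] := L1_ac hm_pos ryb Lf e0.
exists delta => // A mA Ad; have Li := L1_mul_indic mA Lf.
by rewrite fnorm_L1E// lte_fin h.
Qed.

(** By uniform_truncation the sequence f' i is equi-integrable on the complement
    of E i = {|f' i| > i}, and eta (E i) tends to 0. Along a sparse subsequence
    the later sets E have a union U i on which f' i is small, and
    removing U i from E i leaves disjoint sets. *)
Theorem L1_splitting : subsequence_splitting rho X -> subsequence_splitting eta (L1 m).
Proof.
move=> hX; split; first exact: L1_ac_norm.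
move=> f Lf [M0 fM0]; pose M := `|M0|.
have M1 : 0 < M + 1 by rewrite ltr_wpDl// normr_ge0.
have fM n : normL (f n) <= M.
  have := fM0 n; rewrite fnorm_L1E// lee_fin => /le_trans; apply; exact: ler_norm.
have [p ph pt] := uniform_truncation hm_pos rho_fin Lf hX fM.
pose f' i := f (p i); have Lf' i : L (f' i) by exact: Lf.
pose E (i : nat) := [set w | i%:R < `|f' i w|].
have mE i : measurable (E i).
  by apply: measurable_gt; apply: measurableT_comp => //; exact: L1_mfun (Lf' i).
have [C C0 etaC] := rybakov_le hm_pos ryb.
have etaE e : 0 < e -> \forall n \near \oo, (eta (E n) <= e%:E)%E.
  move=> e0; have eM : 0 < e / (C * (M + 1)).
    by rewrite divr_gt0// mulr_gt0.
  have [k hk] := ltr_add_invr eM; rewrite add0r in hk.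
  exists k.+1 => // n /= kn; apply: (le_trans (etaC _ (mE n))); rewrite lee_fin.
  have n0 : 0 < n%:R :> R by rewrite ltr0n (leq_ltn_trans _ kn).
  have h1 := L1_markov hm_pos (Lf' n) n0; rewrite -/(E n) in h1.
  rewrite -ler_pdivlMl//; apply: (le_trans h1); rewrite ler_pdivrMr//.
  apply: (le_trans (fM _)).
  have h2 : k.+1%:R^-1 * n%:R >= 1 :> R by rewrite mulrC ler_pdivlMr ?ltr0n// mul1r ler_nat.
  have h3 : e / (C * (M + 1)) * n%:R >= 1.
    by apply: (le_trans h2); rewrite ler_wpM2r ?ltW.
  have -> : C^-1 * e * n%:R = (M + 1) * (e / (C * (M + 1)) * n%:R).
    by field; rewrite !gt_eqF.
  rewrite -[leLHS]mulr1; apply: ler_pM => //; first exact: normr_ge0.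
  by rewrite lerDl.
have /choice[del delP] i : exists delta : R, 0 < delta /\
    forall A, measurable A -> (eta A < delta%:E)%E -> normL (f' i \* \1_A) < i.+1%:R^-1.
  have i1 : 0 < i.+1%:R^-1 :> R by rewrite invr_gt0.
  by have [delta d0 h] := L1_ac hm_pos ryb (Lf' i) i1; exists delta.
(* Each later set has measure at most del r times a term of a geometric
   series, so that the union of the later sets has measure below del r. *)
pose P (s : seq nat) n := forall r, r \in s -> (eta (E n) <= (del r / (2 ^ (size s).+1)%:R)%:E)%E.
have [s N0|q qh qP] := @extract_subsequence P.
  have : \forall n \near \oo, [set n | P s n] n.
    apply: filter_all_seq => r; apply: etaE.
    by rewrite divr_gt0 ?(delP r).1// ltr0n expn_gt0.
  move=> [k _ hk]; exists (maxn N0 k); first exact: leq_maxl.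
  apply: hk; exact: leq_maxr.
pose U i := \bigcup_k E (q (i.+1 + k)%N).
have mU i : measurable (U i) by exact: bigcupT_measurable.
have Uq i : normL (f' (q i) \* \1_(U i)) < (q i).+1%:R^-1.
  have [dq0 dq] := delP (q i); apply: dq => //.
  apply: (@le_lt_trans _ _ (del (q i) / 2)%:E); last first.
    by rewrite lte_fin gtr_pMr// invf_lt1// ltr1n.
  apply: (@le_trans _ _ (\sum_(k <oo) eta (E (q (i.+1 + k)%N)))%E).
    by apply: measure_sigma_subadditive => //; exact: bigcupT_measurable.
  have dq2 : 0 <= del (q i) / 2 by rewrite divr_ge0// ltW.
  apply: le_trans (epsilon_trick0 xpredT dq2).
  apply: lee_nneseries => // k _.
  apply: le_trans (qP (i.+1 + k)%N (q i) _) _.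
    by apply/mapP; exists i => //; rewrite mem_iota/= addSn ltnS leq_addr.
  rewrite size_mkseq lee_fin -mulrA ler_wpM2l ?(ltW dq0)//.
  rewrite -invfM lef_pV2 ?posrE ?mulr_gt0 ?ltr0n ?expn_gt0//.
  by rewrite -natrM -expnS ler_nat leq_exp2l// addSn !ltnS leq_addl.
pose D i := E (q i) `\` U i.
have mD i : measurable (D i) by exact: measurableD.
pose g i := f' (q i) \* \1_(~` D i); pose h i := f' (q i) \* \1_(D i).
have Lg i : L (g i) by apply: L1_mul_indic => //; exact: measurableC.
have Lh i : L (h i) by exact: L1_mul_indic.
exists (p \o q), g, h; split.
- by move=> i j ij; apply: ph; exact: qh.
- by [].
- move=> n; split; apply: aeW => w; rewrite /g /h /= !indicE in_setC.
    by case: (w \in D n); rewrite /= mulr1 mulr0 ?addr0 ?add0r.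
  by case: (w \in D n); rewrite /= mulr0; [left|right].
- apply: uniformly_ac_L1 => // e e0.
  have e3 : 0 < e / 3 by rewrite divr_gt0.
  have [j [i0 hji]] := pt _ e3.
  have [delta d0 hd] := L1_ac hm_pos ryb (L1_cst m j%:R) e3.
  have [k hk] := ltr_add_invr e3; rewrite add0r in hk.
  exists delta => //; exists (maxn (maxn i0 j) k) => i A.
  rewrite !geq_max => /andP[/andP[i0i ji] ki] mA Ad.
  have iq := homo_geq_id qh i.
  have b1 := hji (q i) (leq_trans i0i iq) (leq_trans ji iq).
  have b2 := Uq i; have b3 := hd A mA Ad.
  have b4 : (q i).+1%:R^-1 <= e / 3.
    apply: le_trans (ltW hk); rewrite lef_pV2 ?posrE ?ltr0n// ler_nat ltnS.
    exact: leq_trans iq.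
  set Bd := band j%:R (q i)%:R (f (p (q i))) in b1.
  have mB : measurable Bd by apply: measurable_band; exact: L1_mfun (Lf' (q i)).
  have L1' := L1_mul_indic mA (L1_cst m j%:R).
  have L2' := L1_norm (L1_mul_indic mB (Lf' (q i))).
  have L3' := L1_norm (L1_mul_indic (mU i) (Lf' (q i))).
  apply: (@le_trans _ _ (normL ((cst j%:R \* \1_A) \+ (fun w => `|(f' (q i) \* \1_Bd) w|)
      \+ (fun w => `|(f' (q i) \* \1_(U i)) w|)))).
    apply: normL_le => //; [exact: L1D (L1D L1' L2') L3'|exact: L1_mul_indic|].
    move=> w; rewrite [leRHS]ger0_norm; last by rewrite !addr_ge0//= mulr_ge0.
    rewrite /g /=; have [Aw|nA] := boolP (w \in A); last first.
      rewrite !indicE (negbTE nA) !mulr0 normr0 add0r addr_ge0//.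
    have [Dw|nD] := pselect (D i w).
      rewrite indicE memNset ?mulr0 ?mul0r ?normr0; last by apply.
      by rewrite !addr_ge0// mulr_ge0.
    rewrite indicE (mem_set (nD : (~` D i) w)) mulr1 [\1_A w]indicE Aw !mulr1.
    have [Uw|nU] := pselect (U i w).
      apply: ler_wpDl; first by rewrite addr_ge0.
      by rewrite indicE (mem_set Uw) mulr1.
    apply: ler_wpDr => //.
    have wq : `|f' (q i) w| <= (q i)%:R.
      by rewrite leNgt; apply/negP => lt; apply: nD.
    have [wj|wj] := leP `|f' (q i) w| j%:R; first exact: ler_wpDr.
    apply: ler_wpDl => //.
    by rewrite indicE (mem_set (_ : Bd w)) ?mulr1// /Bd /band /= wj.
  apply: (le_trans (normLD hm_pos (L1D L1' L2') L3')).
  have b5 := normLD hm_pos L1' L2'.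
  rewrite normL_norm in b5; rewrite normL_norm [leRHS](third_sum e).
  apply: lerD; last exact: le_trans (ltW b2) b4.
  by apply: (le_trans b5); apply: lerD; [exact: ltW|exact: b1].
- move=> i j; wlog ij : i j / (i < j)%N => [W nij|_].
    have := nij; rewrite neq_ltn => /orP[|] ij; first exact: W.
    have := W j i ij; rewrite eq_sym => /(_ nij).
    by apply: filterS => w [|]; [right|left].
  apply: aeW => w; rewrite /h /= !indicE; have [/set_mem[_ nU]|_] := boolP (w \in D i); last first.
    by left; rewrite mulr0.
  right; rewrite memNset ?mulr0// => -[Ej _]; apply: nU.
  by exists (j - i.+1)%N => //; rewrite subnKC.
Qed.

End splitting.

(** * Series of functionals and weakly null sequences *)

Section dual_series.
Context (T : Type) (R : realType) (E : fspace T R).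
Implicit Types (f g : T -> R).
Local Notation Ec := (carrier E).

Hypothesis E_fin : forall f, Ec f -> fnorm E f = (fine (fnorm E f))%:E.

(** The series converges absolutely on the carrier since the functionals
    belong to the unit ball. *)
Lemma dual_series (x : nat -> dual E) (c : nat -> R) :
  (forall n, @dual_ball _ _ E (x n)) -> (forall n, 0 <= c n) ->
  (forall n, \sum_(0 <= k < n) c k <= 1) ->
  exists y : dual E, forall f, Ec f ->
    \sum_(0 <= k < n) c k * x k f @[n --> \oo] --> y f.
Proof.
move=> bx c0 c1.
have xf k f : Ec f -> `|c k * x k f| <= c k * fine (fnorm E f).
  move=> Ef; rewrite normrM ger0_norm// ler_wpM2l//.
  by have := bx k _ Ef; rewrite E_fin.
have nf f : Ec f -> 0 <= fine (fnorm E f).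
  by move=> Ef; have := bx 0%N _ Ef; rewrite E_fin// lee_fin; exact: le_trans.
have sb f n : Ec f -> \sum_(0 <= k < n) `|c k * x k f| <= fine (fnorm E f).
  move=> Ef; apply: (@le_trans _ _ (\sum_(0 <= k < n) c k * fine (fnorm E f))).
    by apply: ler_sum => k _; exact: xf.
  by rewrite -mulr_suml -[leRHS]mul1r ler_wpM2r ?nf.
pose s f n := \sum_(0 <= k < n) c k * x k f.
have sc f : Ec f -> cvgn (s f).
  move=> Ef.
  have : cvgn (fun n => \sum_(0 <= k < n) `|c k * x k f|).
    apply: nondecreasing_is_cvgn.
      by apply/nondecreasing_seqP => n; rewrite big_nat_recr//= lerDl.
    by exists (fine (fnorm E f)) => _ [n _ <-]; exact: sb.
  exact: normed_cvg.
have lin (a : R) f g : Ec f -> Ec g ->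
    limn (s ((a \*o f) \+ g)) = a * limn (s f) + limn (s g).
  move=> Ef Eg; apply/cvg_lim => //.
  rewrite (_ : s _ = fun n => a * s f n + s g n).
    by apply: cvgD; [apply: cvgMr; exact: sc|exact: sc].
  apply/funext => n; rewrite /s mulr_sumr -big_split/=; apply: eq_bigr => k _.
  by rewrite dual_linear// mulrDr mulrCA.
have bd : exists C : R, forall f, Ec f -> (`|limn (s f)|%:E <= C%:E * fnorm E f)%E.
  exists 1 => f Ef; rewrite mul1e E_fin// lee_fin ler_norml; apply/andP; split.
    apply: limr_ge; first exact: sc.
    apply: nearW => n; rewrite lerNl; apply: le_trans (sb f n Ef).
    by apply: le_trans (ler_norm_sum _ _ _); rewrite -normrN ler_norm.
  apply: limr_le; first exact: sc.
  apply: nearW => n; apply: le_trans (sb f n Ef).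
  by apply: le_trans (ler_norm_sum _ _ _); exact: ler_norm.
by exists (Dual lin bd) => f Ef /=; exact: sc.
Qed.

Lemma geometric_third n k : \sum_(n <= l < n + k) (3 : R) ^- l.+1 <= 3 ^- n / 2.
Proof.
have -> : \sum_(n <= l < n + k) (3 : R) ^- l.+1 = (3 ^- n - 3 ^- (n + k)) / 2.
  elim: k => [|k IH]; first by rewrite addn0 big_geq// subrr mul0r.
  rewrite addnS big_nat_recr ?leq_addr//= IH exprS invfM.
  set a := 3 ^- n; set b := 3 ^- (n + k); by field.
by rewrite ler_pM2r ?invr_gt0// gerBl invr_ge0 exprn_ge0.
Qed.

(** Gliding hump proof of uniform boundedness. If the norms were unbounded, let
    x k norm a term f (p k) whose norm exceeds (k + 2) 2 3^(k+1) and on which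
    the previous functionals are at most 1. The series of the 3^-(k+1) x k is
    then large at each f (p k): the later terms of the series cancel at most
    half of the k-th one. *)
Lemma weakly_null_bounded (f : nat -> T -> R) :
  (forall n, Ec (f n)) ->
  (forall g, Ec g -> exists2 x : dual E, @dual_ball _ _ E x & x g = fine (fnorm E g)) ->
  @weakly_null _ _ E f -> exists M : R, forall n, fine (fnorm E (f n)) <= M.
Proof.
move=> Ef norming wf; apply: contrapT => nM.
have unb K N : exists2 n, (N <= n)%N & K <= fine (fnorm E (f n)).
  apply: contrapT => nK; apply: nM.
  have [M0 hM0] : exists M0 : R, forall n, (n < N)%N -> fine (fnorm E (f n)) <= M0.
    elim: N {nK} => [|N [M0 h]]; first by exists 0.
    exists (Num.max M0 (fine (fnorm E (f N)))) => n.
    by rewrite ltnS leq_eqVlt le_max => /orP[/eqP ->|/h ->//]; rewrite lexx orbT.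
  exists (Num.max M0 K) => n; rewrite le_max; have [Nn|/hM0 -> //] := leqP N n.
  have [h|h] := leP (fine (fnorm E (f n))) K; first by rewrite orbT.
  by exfalso; apply: nK; exists n => //; exact: ltW.
have /choice[x xP] n : exists x : dual E,
    @dual_ball _ _ E x /\ x (f n) = fine (fnorm E (f n)).
  by have [x bx xE] := norming _ (Ef n); exists x.
have bx n : @dual_ball _ _ E (x n) by have [] := xP n.
have xE n : x n (f n) = fine (fnorm E (f n)) by have [] := xP n.
pose P (s : seq nat) n := (size s + 2)%:R <= 3 ^- (size s).+1 / 2 * fine (fnorm E (f n)) /\
  forall r, r \in s -> `|x r (f n)| <= 1.
have [s N|p ph pP] := @extract_subsequence P.
  have : \forall n \near \oo, [set n | forall r, r \in s -> `|x r (f n)| <= 1] n.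
    apply: filter_all_seq => r; have [n0 h] := (cvgn0P _).1 (wf (x r)) 1 ltr01.
    by exists n0 => // n /h /ltW.
  move=> [n0 _ hn0].
  have c0 : 0 < 3 ^- (size s).+1 / 2 :> R by rewrite divr_gt0// invr_gt0 exprn_gt0.
  have [n hn hK] := unb ((size s + 2)%:R / (3 ^- (size s).+1 / 2)) (maxn N n0).
  move: hn; rewrite geq_max => /andP[Nn n0n]; exists n => //; split; last exact: hn0.
  by rewrite -ler_pdivrMl// mulrC.
have c1 n : \sum_(0 <= k < n) (3 : R) ^- k.+1 <= 1.
  have := geometric_third 0 n; rewrite add0n expr0 invr1 => /le_trans; apply.
  by rewrite mul1r invf_le1// ler1n.
have [|y yP] := dual_series (fun n => bx (p n)) _ c1.
  by move=> n; rewrite invr_ge0 exprn_ge0.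
have [n0 hn0] := (cvgn0P _).1 (wf y) 1 ltr01.
(* At a large index i, the i-th term of the series is at least 2 (i + 2), the
   earlier ones add up to at most 1/2, the later ones to at most half of it. *)
pose i := n0; have pi := homo_geq_id ph i.
have yi := hn0 (p i) pi.
have [] := pP i; rewrite size_mkseq => big small.
set F := fine (fnorm E (f (p i))) in big.
have F0 : 0 <= F.
  by have := bx (p i) _ (Ef (p i)); rewrite E_fin// lee_fin; exact: le_trans.
suff : 1 <= y (f (p i)) by rewrite leNgt (le_lt_trans (ler_norm _) yi).
have hy := yP _ (Ef (p i)); rewrite -(cvg_lim (@Rhausdorff R) hy).
apply: limr_ge; first by apply/cvg_ex; exists (y (f (p i))).
exists i.+1 => // n /= ni; rewrite (big_cat_nat (n := i))//=; last exact: ltnW.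
rewrite (big_ltn ni) /= xE -/F.
have h1 : - 2^-1 <= \sum_(0 <= k < i) 3 ^- k.+1 * x (p k) (f (p i)).
  rewrite lerNl; apply: (le_trans (ler_norm _)); rewrite normrN.
  apply: (le_trans (ler_norm_sum _ _ _)).
  have := geometric_third 0 i; rewrite add0n expr0 invr1 mul1r; apply: le_trans.
  rewrite !big_nat; apply: ler_sum => k /andP[_ ki].
  have k0 : 0 <= (3 : R) ^- k.+1 by rewrite invr_ge0 exprn_ge0.
  rewrite normrM ger0_norm// -[leRHS]mulr1 ler_wpM2l// small//.
  by apply/mapP; exists k => //; rewrite mem_iota.
have h2 : - (3 ^- i.+1 / 2 * F) <= \sum_(i.+1 <= k < n) 3 ^- k.+1 * x (p k) (f (p i)).
  rewrite lerNl; apply: (le_trans (ler_norm _)); rewrite normrN.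
  apply: (le_trans (ler_norm_sum _ _ _)).
  apply: (@le_trans _ _ (\sum_(i.+1 <= k < n) 3 ^- k.+1 * F)).
    apply: ler_sum => k _; have k0 : 0 <= (3 : R) ^- k.+1 by rewrite invr_ge0 exprn_ge0.
    rewrite normrM ger0_norm// ler_wpM2l//.
    by have := bx (p k) _ (Ef (p i)); rewrite E_fin.
  rewrite -mulr_suml ler_wpM2r//.
  by have := geometric_third i.+1 (n - i.+1); rewrite subnKC.
have h3 : 2 <= (i + 2)%:R :> R by rewrite ler_nat leq_addl.
move: h1 h2 h3 big; set A := \sum_(_ <= _ < i) _; set B := \sum_(_ <= _ < n) _.
set Q := 3 ^- _; have -> : Q * F = Q / 2 * F + Q / 2 * F by field.
set Z := Q / 2 * F; clearbody A B Z; move=> h1 h2 h3 h4; lra.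
Qed.

End dual_series.

(** * Functionals on L^1(m) and Rybakov control measures *)

Section functionals_on_L1.
Context dS (S : measurableType dS) (R : realType).
Variables (rho : {measure set S -> \bar R}) (X : bfs rho).
Context d (Omega : measurableType d).
Variable m : vmeasure X Omega.
Hypothesis hm_pos : vm_positive m.
Implicit Types (f g : Omega -> R) (A B : set Omega) (x : dual X).

Local Notation Xc := (carrier X).
Local Notation L := (carrier (L1 m)).
Local Notation N := (nrm X).
Local Notation var x := (Defs.variation (scalar_measure m x)).
Local Notation J x f := (cint (scalar_measure m x) f).
Local Notation normL := (normL m).
Local Notation mint := (mint m).

Lemma cint_indicE x A : measurable A -> J x \1_A = x (m A).
Proof. by move=> mA; apply: EFin_inj; rewrite (cint_indic (scalar_measure m x)). Qed.

Lemma vm_symdiff_le x A B : @dual_ball _ _ X x -> positive_dual x ->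
  measurable A -> measurable B -> x (m A) <= x (m B) + N (m (A `+` B)).
Proof.
move=> bx px mA mB.
have mD : measurable (A `+` B) by apply: measurableU; exact: measurableD.
have LA := L1_indic m mA; have LB := L1_indic m mB; have LD := L1_indic m mD.
apply: (@le_trans _ _ (x (m B) + x (m (A `+` B)))); last first.
  rewrite lerD2l; apply: (le_trans (ler_norm _)); apply: dual_ball_le => //.
  exact: vm_carrier.
rewrite -!cint_indicE// -cintD//; apply: cint_le => //; first exact: L1D.
move=> w /=; rewrite !indicE; have [/set_mem Aw|] := boolP (w \in A); last by rewrite addr_ge0.
have [Bw|nB] := boolP (w \in B); first by rewrite lerDl.
by rewrite add0r mem_set//; left; split => //; move: nB; rewrite notin_setE.
Qed.

(** Let x n be a positive functional norming m (B n), for B n in a countable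
    dense family, and let x0 be the sum of the series of the 3^-(n+1) x n. If
    x0 m vanishes on A then so does every x n m, and choosing B n close to A
    shows that m A = 0. *)
Theorem rybakov_exists : vm_separable m -> exists x0 : dual X,
  rybakov m (Defs.variation (scalar_measure m x0)).
Proof.
move=> [D [/countable_injP[code code_inj] Dm Dd]].
pose e n : set Omega := if pselect (exists2 B, D B & code B = n) is left h
  then sval (cid2 h) else set0.
have me n : measurable (e n).
  by rewrite /e; case: pselect => [h|_//]; case: cid2 => B /= /Dm.
have eD B : D B -> e (code B) = B.
  move=> DB; rewrite /e; case: pselect => [h|[]]; last by exists B.
  case: cid2 => C /= DC cC; apply: code_inj => //; exact/mem_set.
have /choice[x xP] n : exists x : dual X,
    [/\ @dual_ball _ _ X x, positive_dual x & x (m (e n)) = N (m (e n))].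
  by have [XA A0] := hm_pos (me n); exact: positive_norming_ge0.
have bx n : @dual_ball _ _ X (x n) by have [] := xP n.
have px n : positive_dual (x n) by have [] := xP n.
have xE n : x n (m (e n)) = N (m (e n)) by have [] := xP n.
have c1 n : \sum_(0 <= k < n) (3 : R) ^- k.+1 <= 1.
  have := geometric_third R 0 n; rewrite add0n expr0 invr1 => /le_trans; apply.
  by rewrite mul1r invf_le1// ler1n.
have c0 n : 0 <= (3 : R) ^- n.+1 by rewrite invr_ge0 exprn_ge0.
have finX (f : S -> R) : Xc f -> fnorm X f = (fine (fnorm X f))%:E by move=> /fnormE.
have [y yP] := dual_series finX bx c0 c1.
exists y; split; first by exists y.
move=> A mA; rewrite semivariationE//; split=> [vA|[] NA]; last first.
  exact: variation_null.
congr (_%:E); apply/eqP; rewrite eq_le nrm_ge0 ?andbT; last exact: vm_carrier.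
have XmA := vm_carrier m mA.
have yA0 : y (m A) = 0.
  have := vm_le_variation hm_pos y mA; rewrite vA lee_fin normr_le0 => /eqP //.
have xA0 n : x n (m A) = 0.
  have pA k : 0 <= x k (m A) by have [_ A0] := hm_pos mA; exact: px.
  apply/eqP; rewrite eq_le pA andbT -(pmulr_rle0 _ (_ : 0 < 3 ^- n.+1)) ?invr_gt0 ?exprn_gt0//.
  have hy := yP _ XmA; rewrite -yA0 -(cvg_lim (@Rhausdorff R) hy).
  apply: limr_ge; first by apply/cvg_ex; exists (y (m A)).
  exists n.+1 => // k /= nk; rewrite (big_cat_nat (n := n.+1))//= big_nat_recr//=.
  by rewrite addrAC ler_wpDl// addr_ge0//; apply: sumr_ge0 => l _; rewrite mulr_ge0.
apply/ler_addgt0Pr => r r0; rewrite add0r.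
have r2 : 0 < r / 2 by rewrite divr_gt0.
have [B DB] := Dd A _ mA r2; have mB := Dm _ DB.
have mAB : measurable (A `+` B) by apply: measurableU; exact: measurableD.
rewrite semivariationE// lte_fin => hAB.
have [_ A0] := hm_pos mA.
have [z [bz pz zE]] := positive_norming_ge0 XmA A0.
have h1 := vm_symdiff_le bz pz mA mB.
have h2 : z (m B) <= N (m B).
  by apply: (le_trans (ler_norm _)); apply: dual_ball_le => //; exact: vm_carrier.
have h3 := vm_symdiff_le (bx (code B)) (px (code B)) mB mA.
have xB : x (code B) (m B) = N (m B) by have := xE (code B); rewrite eD.
rewrite xA0 add0r xB setYC in h3.
rewrite -zE [r]splitr; apply: (le_trans h1); apply: lerD; last exact: ltW.
by apply: (le_trans h2); apply: (le_trans h3); exact: ltW.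
Qed.

(** Functionals f |-> x (I (f th)): with th an indicator they localize weak
    convergence, with th a sign they norm L^1(m). *)
Lemma dual_multiplier x (th : Omega -> R) : (forall f, L f -> L (f \* th)) ->
  (forall w, `|th w| <= 1) -> exists y : dual (L1 m), forall f, y f = J x (f \* th).
Proof.
move=> Lth th1; have [C C0 xC] := dual_le x.
have lin (a : R) f g : L f -> L g ->
    J x (((a \*o f) \+ g) \* th) = a * J x (f \* th) + J x (g \* th).
  move=> Lf Lg; have Lf' := Lth _ Lf; have Lg' := Lth _ Lg.
  rewrite -cintZ// -cintD//; last exact: L1Z.
  by congr cint; apply/funext => w /=; rewrite mulrDl mulrA.
have bd : exists C : R, forall f, L f -> (`|J x (f \* th)|%:E <= C%:E * fnorm (L1 m) f)%E.
  exists C => f Lf; rewrite fnorm_L1E// lee_fin; have Lf' := Lth _ Lf.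
  apply: (le_trans (cint_normL_le hm_pos Lf' C0 xC)); rewrite ler_wpM2l//.
  apply: normL_le => // w /=; rewrite normrM -[leRHS]mulr1.
  by rewrite ler_wpM2l.
by exists (@Dual _ _ (L1 m) (fun f => J x (f \* th)) lin bd).
Qed.

Lemma weakly_null_cint x (f : nat -> Omega -> R) A : (forall n, L (f n)) ->
  measurable A -> @weakly_null _ _ (L1 m) f -> J x (f n \* \1_A) @[n --> \oo] --> (0 : R).
Proof.
move=> Lf mA wf; have [||y yE] := @dual_multiplier x \1_A.
- by move=> g; exact: L1_mul_indic.
- by move=> w; rewrite indicE; case: (w \in A); rewrite ?normr1 ?normr0.
- by have := wf y; under eq_fun do rewrite yE.
Qed.

Lemma L1_weakly_null_bounded (f : nat -> Omega -> R) : (forall n, L (f n)) ->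
  @weakly_null _ _ (L1 m) f -> exists M : R, forall n, normL (f n) <= M.
Proof.
move=> Lf wf.
have [||M hM] := @weakly_null_bounded _ _ (L1 m) _ f Lf _ wf.
- by move=> g Lg; rewrite fnorm_L1E.
- move=> g Lg; have [x [bx px xE]] := normL_norming hm_pos Lg.
  have [P mP gP] := norm_signed (L1_mfun Lg).
  have Lth f' : L f' -> L (f' \* signed R P) by exact: L1_mul_signed.
  have [|y yE] := dual_multiplier x Lth; first by move=> w; rewrite normr_signed.
  exists y.
    move=> f' Lf'; have Lf2 := Lth _ Lf'.
    rewrite yE fnorm_L1E// lee_fin; apply: (le_trans (cint_ball_le hm_pos Lf2 bx)).
    by apply: normL_le => // w; rewrite normr_mul_signed.
  by rewrite yE fnorm_L1E//= -xE gP.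
- by exists M => n; have := hM n; rewrite fnorm_L1E.
Qed.

End functionals_on_L1.

(** * Cesaro means in L^2 *)

Section averages.
Context (R : realType).

Definition avg T (a : nat -> T -> R) n (w : T) : R :=
  n.+1%:R^-1 * \sum_(0 <= k < n.+1) a k w.

Let sum_lt_le n i0 : \sum_(0 <= i < n) (i < i0)%N%:R <= i0%:R :> R.
Proof.
rewrite -natr_sum ler_nat; elim: n => [|n IH]; first by rewrite big_geq.
rewrite big_nat_recr//=; have [ni|ni] := ltnP n i0; last by rewrite addn0.
apply: leq_trans ni; rewrite addn1 ltnS; apply: (@leq_trans (\sum_(0 <= i < n) 1)%N).
  by apply: leq_sum => i _; exact: leq_b1.
by rewrite sum_nat_const_nat subn0 muln1.
Qed.

Let sum_eq_le n i : \sum_(0 <= l < n) (i == l)%:R <= 1 :> R.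
Proof.
rewrite -natr_sum (ler_nat R _ 1); elim: n => [|n IH]; first by rewrite big_geq.
rewrite big_nat_recr//=; have [->|ni] := eqVneq i n; last by rewrite addn0.
rewrite big_nat big1 ?add0n// => l /andP[_ ln].
by rewrite gtn_eqF.
Qed.

(** The exceptional pairs, diagonal or with an index below i0, have vanishing
    proportion. *)
Lemma cvg_double_average (B : nat -> nat -> R) (c K : R) :
  (forall i l, `|B i l - c| <= K) ->
  (forall e : R, 0 < e -> exists i0, forall i l, (i0 <= i)%N -> (i0 <= l)%N ->
     i != l -> `|B i l - c| <= e) ->
  forall e : R, 0 < e -> exists n0, forall p q, (n0 <= p)%N -> (n0 <= q)%N ->
    `|p.+1%:R^-1 * \sum_(0 <= i < p.+1) (q.+1%:R^-1 * \sum_(0 <= l < q.+1) B i l) - c| <= e.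
Proof.
move=> BK Bc e e0; have K0 : 0 <= K by exact: le_trans (BK 0%N 0%N).
have e2 : 0 < e / 2 by rewrite divr_gt0.
have [i0 hi0] := Bc _ e2.
pose C := K * (2 * i0%:R + 1) + 1.
have C0 : 0 < C by rewrite ltr_wpDl// mulr_ge0// addr_ge0// mulr_ge0.
have [n0 hn0] := ltr_add_invr (divr_gt0 e2 C0); rewrite add0r in hn0.
exists n0 => p q n0p n0q.
have pt i l : `|B i l - c| <= e / 2 + K * ((i < i0)%N%:R + (l < i0)%N%:R + (i == l)%:R).
  have [ii|ii] := ltnP i i0.
    apply: (le_trans (BK i l)); rewrite -[leLHS]add0r lerD ?(ltW e2)//.
    by rewrite -[leLHS]mulr1 ler_wpM2l// -addrA lerDl addr_ge0.
  have [ll|ll] := ltnP l i0.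
    apply: (le_trans (BK i l)); rewrite -[leLHS]add0r lerD ?(ltW e2)//.
    by rewrite -[leLHS]mulr1 ler_wpM2l// add0r lerDl.
  have [->|il] := eqVneq i l.
    apply: (le_trans (BK l l)); rewrite -[leLHS]add0r lerD ?(ltW e2)//.
    by rewrite !add0r mulr1.
  by apply: (le_trans (hi0 _ _ ii ll il)); rewrite lerDl !addr0 mulr0.
have a0 n : 0 < n.+1%:R^-1 :> R by rewrite invr_gt0.
have aS n (z : R) : n.+1%:R^-1 * \sum_(0 <= i < n.+1) z = z.
  by rewrite sumr_const_nat subn0 -[z *+ _]mulr_natl mulKf.
have row i : `|q.+1%:R^-1 * \sum_(0 <= l < q.+1) B i l - c| <=
    e / 2 + K * ((i < i0)%N%:R + q.+1%:R^-1 * (i0%:R + 1)).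
  rewrite -[in X in `|X|](aS q c) -mulrBr -sumrB normrM (gtr0_norm (a0 q)).
  apply: (@le_trans _ _ (q.+1%:R^-1 * \sum_(0 <= l < q.+1)
      (e / 2 + K * ((i < i0)%N%:R + (l < i0)%N%:R + (i == l)%:R)))).
    rewrite ler_wpM2l ?(ltW (a0 q))//; apply: (le_trans (ler_norm_sum _ _ _)).
    by apply: ler_sum => l _; exact: pt.
  rewrite big_split/= mulrDr aS lerD2l -mulr_sumr mulrCA ler_wpM2l//.
  rewrite big_split/= big_split/= -addrA mulrDr aS lerD2l ler_wpM2l ?(ltW (a0 q))//.
  exact: lerD.
rewrite -[in X in `|X|](aS p c) -mulrBr -sumrB normrM (gtr0_norm (a0 p)).
apply: (@le_trans _ _ (p.+1%:R^-1 * \sum_(0 <= i < p.+1)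
    (e / 2 + K * ((i < i0)%N%:R + q.+1%:R^-1 * (i0%:R + 1))))).
  rewrite ler_wpM2l ?(ltW (a0 p))//; apply: (le_trans (ler_norm_sum _ _ _)).
  by apply: ler_sum => i _; exact: row.
rewrite big_split/= mulrDr aS [leRHS]splitr lerD2l -mulr_sumr mulrCA.
rewrite big_split/= mulrDr aS.
have inv_le n : (n0 <= n)%N -> n.+1%:R^-1 <= e / 2 / C.
  by move=> nn; apply: le_trans (ltW hn0); rewrite lef_pV2 ?posrE ?ltr0n// ler_nat ltnS.
apply: (@le_trans _ _ (K * (e / 2 / C * i0%:R + e / 2 / C * (i0%:R + 1)))).
  rewrite ler_wpM2l//; apply: lerD.
    apply: ler_pM; [exact/ltW|by apply: sumr_ge0|exact: inv_le|exact: sum_lt_le].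
  by rewrite ler_wpM2r ?inv_le// addr_ge0.
rewrite -mulrDr mulrCA mulrAC ler_pdivrMr// ler_wpM2l ?(ltW e2)//.
rewrite /C (_ : i0%:R + (i0%:R + 1) = 2 * i0%:R + 1); last by ring.
by rewrite lerDl.
Qed.

End averages.

Section bounded_measurable.
Context d (T : measurableType d) (R : realType).
Variable mu : {measure set T -> \bar R}.
Hypothesis mu_fin : (mu setT < +oo)%E.
Implicit Types u v : T -> R.

Definition bmeas u := measurable_fun setT u /\ exists K : R, forall w, `|u w| <= K.

Lemma bmeas_integrable u : bmeas u -> mu.-integrable setT (EFin \o u).
Proof.
move=> [mu_ [K uK]]; apply: measurable_bounded_integrable => //.
exists K; split; first exact: num_real.
by move=> r r1 s _ /=; apply: (le_trans (uK s)); exact: ltW.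
Qed.

Lemma bmeas_linear (a : R) u v : bmeas u -> bmeas v -> bmeas (fun w => a * u w + v w).
Proof.
move=> [mu_ [K uK]] [mv [K' vK]]; split.
  by apply: measurable_funD => //; exact: measurable_funM.
exists (`|a| * K + K') => w; apply: (le_trans (ler_normD _ _)).
by rewrite lerD// normrM ler_wpM2l.
Qed.

Lemma bmeasM u v : bmeas u -> bmeas v -> bmeas (u \* v).
Proof.
move=> [mu_ [K uK]] [mv [K' vK]]; split; first exact: measurable_funM.
by exists (K * K') => w; rewrite normrM ler_pM.
Qed.

Definition ip u v : R := Rintegral mu setT (u \* v).

Lemma ipC u v : ip u v = ip v u.
Proof. by congr Rintegral; apply/funext => w /=; rewrite mulrC. Qed.

Lemma ip_linear (a : R) u v z : bmeas u -> bmeas v -> bmeas z ->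
  ip (fun w => a * u w + v w) z = a * ip u z + ip v z.
Proof.
move=> bu bv bz; have i1 := bmeas_integrable (bmeasM bu bz).
have i2 := bmeas_integrable (bmeasM bv bz).
rewrite /ip -RintegralZl//.
have i3 : mu.-integrable setT (EFin \o (fun w => a * (u \* z) w)).
  have /(integrableZl measurableT a) := i1; apply: eq_integrable => // w _.
rewrite -RintegralD//; congr Rintegral; apply/funext => w /=.
by rewrite mulrDl mulrA.
Qed.

Lemma bmeas0 : bmeas (cst 0).
Proof. by split; [exact: measurable_cst|exists 0 => w; rewrite normr0]. Qed.

Lemma bmeas_sum (a : nat -> T -> R) n : (forall k, bmeas (a k)) ->
  bmeas (fun w => \sum_(0 <= k < n) a k w).
Proof.
move=> ba; elim: n => [|n IH].
  by rewrite (_ : (fun w => _) = cst 0); [exact: bmeas0|apply/funext => w; rewrite big_geq].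
rewrite (_ : (fun w => _) = (fun w => 1 * a n w + \sum_(0 <= k < n) a k w)).
  exact: bmeas_linear.
by apply/funext => w; rewrite big_nat_recr//= mul1r addrC.
Qed.

Lemma ip0 z : ip (cst 0) z = 0.
Proof.
rewrite /ip (_ : cst 0 \* z = cst 0); last by apply/funext => w /=; rewrite mul0r.
by rewrite Rintegral_cst// mul0r.
Qed.

Lemma ipZ (a : R) u z : bmeas u -> bmeas z -> ip (fun w => a * u w) z = a * ip u z.
Proof.
move=> bu bz; rewrite (_ : (fun w => _) = (fun w => a * u w + cst 0 w)).
  by rewrite ip_linear ?ip0 ?addr0//; exact: bmeas0.
by apply/funext => w; rewrite addr0.
Qed.

Lemma bmeasZ (a : R) u : bmeas u -> bmeas (fun w => a * u w).
Proof.
move=> bu; rewrite (_ : (fun w => _) = (fun w => a * u w + cst 0 w)).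
  by apply: bmeas_linear => //; exact: bmeas0.
by apply/funext => w; rewrite addr0.
Qed.

Lemma ip_sum (a : nat -> T -> R) n z : (forall k, bmeas (a k)) -> bmeas z ->
  ip (fun w => \sum_(0 <= k < n) a k w) z = \sum_(0 <= k < n) ip (a k) z.
Proof.
move=> ba bz; elim: n => [|n IH].
  rewrite big_geq// (_ : (fun w => _) = cst 0) ?ip0//.
  by apply/funext => w; rewrite big_geq.
rewrite (_ : (fun w => _) = (fun w => 1 * a n w + \sum_(0 <= k < n) a k w)).
  by rewrite ip_linear// ?IH ?mul1r ?big_nat_recr//= 1?addrC//; exact: bmeas_sum.
by apply/funext => w; rewrite big_nat_recr//= mul1r addrC.
Qed.

Lemma bmeas_avg (a : nat -> T -> R) n : (forall k, bmeas (a k)) -> bmeas (avg a n).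
Proof. by move=> ba; apply: bmeasZ; exact: bmeas_sum. Qed.

Lemma ip_avg (a : nat -> T -> R) n z : (forall k, bmeas (a k)) -> bmeas z ->
  ip (avg a n) z = n.+1%:R^-1 * \sum_(0 <= k < n.+1) ip (a k) z.
Proof. by move=> ba bz; rewrite /avg ipZ ?ip_sum//; exact: bmeas_sum. Qed.

Lemma ip_avg2 (a : nat -> T -> R) p q : (forall k, bmeas (a k)) ->
  ip (avg a p) (avg a q) =
  p.+1%:R^-1 * \sum_(0 <= i < p.+1) (q.+1%:R^-1 * \sum_(0 <= l < q.+1) ip (a i) (a l)).
Proof.
move=> ba; have bq := bmeas_avg q ba; rewrite ip_avg//; congr (_ * _).
apply: eq_bigr => i _; rewrite ipC ip_avg//; congr (_ * _).
by apply: eq_bigr => l _; exact: ipC.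
Qed.

Lemma ip_sub_self u v : bmeas u -> bmeas v ->
  ip (u \- v) (u \- v) = ip u u - ip u v *+ 2 + ip v v.
Proof.
move=> bu bv.
have E : u \- v = (fun w => -1 * v w + u w).
  by apply/funext => w /=; rewrite mulN1r addrC.
have bB : bmeas (u \- v) by rewrite E; exact: bmeas_linear.
rewrite {1}E ip_linear// ![ip _ (u \- v)]ipC E !ip_linear// (ipC v u).
by rewrite mulr2n; ring.
Qed.

(** Each of the three inner products in the expansion of the squared distance
    of two means is a double average of the Gram matrix. *)
Lemma cauchy_averages (a : nat -> T -> R) (c K : R) : (forall k, bmeas (a k)) ->
  (forall i l, `|ip (a i) (a l) - c| <= K) ->
  (forall e : R, 0 < e -> exists i0, forall i l, (i0 <= i)%N -> (i < l)%N ->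
     `|ip (a i) (a l) - c| <= e) ->
  forall e : R, 0 < e -> exists n0, forall p q, (n0 <= p)%N -> (n0 <= q)%N ->
    ip (avg a p \- avg a q) (avg a p \- avg a q) <= e.
Proof.
move=> ba aK ac e e0; have e4 : 0 < e / 4 by rewrite divr_gt0.
have ac' : forall e : R, 0 < e -> exists i0, forall i l, (i0 <= i)%N -> (i0 <= l)%N ->
     i != l -> `|ip (a i) (a l) - c| <= e.
  move=> r /ac[i0 h]; exists i0 => i l ii ll; rewrite neq_ltn => /orP[il|li].
    exact: h.
  by rewrite ipC; exact: h.
have [n0 hn0] := cvg_double_average aK ac' e4.
exists n0 => p q np nq; have bp := bmeas_avg p ba; have bq := bmeas_avg q ba.
rewrite ip_sub_self// !ip_avg2//.
have h1 := hn0 p p np np; have h2 := hn0 p q np nq; have h3 := hn0 q q nq nq.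
move: h1 h2 h3; set A := p.+1%:R^-1 * _; set B := p.+1%:R^-1 * _; set C := q.+1%:R^-1 * _.
clearbody A B C; rewrite !ler_norml mulr2n => /andP[_ h1] /andP[h2 _] /andP[_ h3].
lra.
Qed.

End bounded_measurable.

(** * Disjoint and equi-integrable sequences of L^1(m) *)

Section weak_banach_saks.
Context dS (S : measurableType dS) (R : realType).
Variables (rho : {measure set S -> \bar R}) (X : bfs rho).
Context d (Omega : measurableType d).
Variable m : vmeasure X Omega.
Hypothesis hm_pos : vm_positive m.
Variable eta : {measure set Omega -> \bar R}.
Hypothesis ryb : rybakov m eta.
Implicit Types (f g : Omega -> R) (A B : set Omega) (x : dual X).

Local Notation Xc := (carrier X).
Local Notation L := (carrier (L1 m)).
Local Notation N := (nrm X).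
Local Notation var x := (Defs.variation (scalar_measure m x)).
Local Notation J x f := (cint (scalar_measure m x) f).
Local Notation normL := (normL m).
Local Notation mint := (mint m).

Let eta_fin : (eta setT < +oo)%E. Proof. exact: rybakov_fin ryb. Qed.

Lemma cint_mul_indicU x f A B : L f -> measurable A -> measurable B -> A `&` B = set0 ->
  J x (f \* \1_(A `|` B)) = J x (f \* \1_A) + J x (f \* \1_B).
Proof.
move=> Lf mA mB AB; have LA := L1_mul_indic mA Lf; have LB := L1_mul_indic mB Lf.
rewrite -cintD//; congr cint; apply/funext => w /=; rewrite -mulrDr; congr (_ * _).
rewrite !indicE in_setU; have [/set_mem Aw|nA] := boolP (w \in A); last by rewrite add0r.
by rewrite memNset ?addr0// => Bw; have : (A `&` B) w by []; rewrite AB.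
Qed.

(** Gliding hump. Otherwise there are indices q p for which the p-th integral
    over its own set D (q p) exceeds e, the integrals over the earlier sets
    D (q r) add up to at most e / 4, and so does the integral over the union of the
    later ones. The integrals over the union of all D (q r) would not tend
    to 0. *)
Lemma weakly_null_trivIset x (f : nat -> Omega -> R) (D : nat -> set Omega) :
  (forall n, L (f n)) -> @weakly_null _ _ (L1 m) f -> (forall n, measurable (D n)) ->
  trivIset setT D -> J x (f n \* \1_(D n)) @[n --> \oo] --> (0 : R).
Proof.
move=> Lf wf mD tD; apply: contrapT => ncv.
have D0 i j : i != j -> D i `&` D j = set0.
  by move=> ij; apply/eqP; apply: contra_neqT ij => /set0P; exact: tD.
have [e e0 bad] : exists2 e : R, 0 < e & forall n0, exists2 n, (n0 <= n)%N &
    e <= `|J x (f n \* \1_(D n))|.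
  apply: contrapT => H; apply: ncv; apply/cvgn0P => e e0; apply: contrapT => H'.
  apply: H; exists e => // n0; apply: contrapT => H2; apply: H'; exists n0 => n nn.
  by rewrite ltNge; apply/negP => le; apply: H2; exists n.
have [C C0 xC] := dual_le x.
have e4 : 0 < e / 4 by rewrite divr_gt0.
have eC : 0 < e / 4 / (C + 1) by rewrite divr_gt0// ltr_wpDl.
have /choice[Nt NtP] i : exists n, forall B, measurable B -> B `<=` \bigcup_l D (n + l)%N ->
    `|J x (f i \* \1_B)| <= e / 4.
  have [delta d0 hd] := L1_ac hm_pos ryb (Lf i) eC.
  have [|n hn] := almost_disjoint_tail eta_fin mD _ d0.
    by move=> k l kl; rewrite D0// measure0.
  exists n => B mB sB; have LB := L1_mul_indic mB (Lf i).
  apply: (le_trans (cint_normL_le hm_pos LB C0 xC)).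
  have eB : (eta B < delta%:E)%E.
    by apply: le_lt_trans hn; rewrite le_measure ?inE//; exact: bigcupT_measurable.
  apply: (@le_trans _ _ ((C + 1) * (e / 4 / (C + 1)))).
    by apply: ler_pM => //; rewrite ?normL_ge0 ?lerDl ?ltW// hd.
  by rewrite mulrCA divff ?mulr1// gt_eqF// ltr_wpDl.
pose P (s : seq nat) n := [/\ forall r, r \in s -> (Nt r <= n)%N,
  forall r, r \in s -> `|J x (f n \* \1_(D r))| <= e / 4 / (size s).+1%:R &
  e <= `|J x (f n \* \1_(D n))|].
have [s N0|q qh qP] := @extract_subsequence P.
  have : \forall n \near \oo, [set n | forall r, r \in s -> (Nt r <= n)%N /\
      `|J x (f n \* \1_(D r))| <= e / 4 / (size s).+1%:R] n.
    apply: (@filter_all_seq _ _ \oo _ (fun r => [set n | (Nt r <= n)%N /\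
      `|J x (f n \* \1_(D r))| <= e / 4 / (size s).+1%:R])) => r.
    have es : 0 < e / 4 / (size s).+1%:R by rewrite divr_gt0.
    have [n0 h] := (cvgn0P _).1 (weakly_null_cint hm_pos x Lf (mD r) wf) _ es.
    exists (maxn (Nt r) n0) => // n /=; rewrite geq_max => /andP[-> /h /ltW].
    by [].
  move=> [n0 _ hn0]; have [n hn en] := bad (maxn N0 n0).
  move: hn; rewrite geq_max => /andP[Nn /hn0 hn]; exists n => //.
  by split => // r /hn[].
have q_inj i j : (i < j)%N -> q i != q j by move=> /qh; rewrite neq_ltn => ->.
pose Ls := \bigcup_p D (q p).
have mLs : measurable Ls by exact: bigcupT_measurable.
have [p hp] := (cvgn0P _).1 (weakly_null_cint hm_pos x Lf mLs wf) _ e4.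
have := hp (q p) (homo_geq_id qh p).
pose V1 := \bigcup_(r < p) D (q r).
pose V2 := \bigcup_k D (q (p.+1 + k)%N).
have mV1 : measurable V1 by exact: bigcup_measurable.
have mV2 : measurable V2 by exact: bigcupT_measurable.
have LsE : Ls = (V1 `|` V2) `|` D (q p).
  apply/seteqP; split => w.
    move=> [r _ Dw]; have [rp|pr|rp] := ltngtP r p; last by right; rewrite -rp.
      by left; left; exists r.
    by left; right; exists (r - p.+1)%N => //; rewrite subnKC.
  by move=> [[[r _ Dw]|[k _ Dw]]|Dw]; [exists r|exists (p.+1 + k)%N|exists p].
have V12 : V1 `&` V2 = set0.
  apply/seteqP; split => w // -[[r /= rp Dr] [k _ Dk]].
  have : (D (q r) `&` D (q (p.+1 + k)%N)) w by [].
  by rewrite D0//; apply: q_inj; apply: (leq_trans rp); rewrite addSn ltnW// ltnS leq_addr.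
have VD : (V1 `|` V2) `&` D (q p) = set0.
  apply/seteqP; split => w // -[[[r /= rp Dr]|[k _ Dk]] Dp].
    have : (D (q r) `&` D (q p)) w by [].
    by rewrite D0//; exact: q_inj.
  have : (D (q p) `&` D (q (p.+1 + k)%N)) w by [].
  by rewrite D0//; apply: q_inj; rewrite addSn ltnS leq_addr.
have mV : measurable (V1 `|` V2) by exact: measurableU.
rewrite LsE cint_mul_indicU// cint_mul_indicU//.
have [_ small big] := qP p.
have b2 : `|J x (f (q p) \* \1_V2)| <= e / 4.
  apply: NtP => // w [k _ Dk]; have [Ntk _ _] := qP (p.+1 + k)%N.
  have le : (Nt (q p) <= q (p.+1 + k))%N.
    by apply: Ntk; apply/mapP; exists p => //; rewrite mem_iota/= addSn ltnS leq_addr.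
  by exists (q (p.+1 + k) - Nt (q p))%N => //; rewrite subnKC.
have b1 : `|J x (f (q p) \* \1_V1)| <= e / 4.
  have V1E n : (n <= p)%N -> J x (f (q p) \* \1_(\bigcup_(r < n) D (q r))) =
      \sum_(0 <= r < n) J x (f (q p) \* \1_(D (q r))).
    elim: n => [_|n IH np].
      rewrite big_geq// (_ : _ \* _ = 0 \*o f (q p)); last first.
        apply/funext => w /=; rewrite bigcup0 ?indic0 ?mulr0 ?mul0r// => i /=; by rewrite ltn0.
      by rewrite cintZ// mul0r.
    rewrite big_nat_recr//= -IH ?(ltnW np)//.
    rewrite (_ : \bigcup_(r < n.+1) D (q r) = (\bigcup_(r < n) D (q r)) `|` D (q n)).
      rewrite cint_mul_indicU//; first exact: bigcup_measurable.
      apply/seteqP; split => w // -[[r /= rn Dr] Dn].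
      have : (D (q r) `&` D (q n)) w by [].
      by rewrite D0//; exact: q_inj.
    apply/seteqP; split => w.
      move=> [r /=]; rewrite ltnS leq_eqVlt => /orP[/eqP ->|rn] Dr; [by right|left].
      by exists r.
    by move=> [[r /= rn Dr]|Dn]; [exists r => //=; exact: ltnW|exists n => /=].
  rewrite V1E//; apply: (le_trans (ler_norm_sum _ _ _)).
  apply: (@le_trans _ _ (\sum_(0 <= r < p) e / 4 / p.+1%:R)).
    rewrite !big_nat; apply: ler_sum => r /andP[_ rp].
    rewrite size_mkseq in small; apply: small.
    by apply/mapP; exists r => //; rewrite mem_iota.
  rewrite sumr_const_nat subn0 -[_ *+ p]mulr_natr mulrAC ler_pdivrMr// ler_wpM2l ?(ltW e4)//.
  by rewrite ler_nat.
move: b1 b2 big; set a := J x _; set b := J x _; set c := J x _.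
clearbody a b c; clear -e0.
rewrite !ler_norml ltr_norml => /andP[h1 h2] /andP[h3 h4] + /andP[h5 h6].
by rewrite ler_normr => /orP[]; lra.
Qed.

Lemma weakly_null_disjoint x (f : nat -> Omega -> R) (D : nat -> set Omega) :
  (forall n, L (f n)) -> @weakly_null _ _ (L1 m) f -> (forall n, measurable (D n)) ->
  (forall i j, i != j -> eta (D i `&` D j) = 0%E) ->
  J x (f n \* \1_(D n)) @[n --> \oo] --> (0 : R).
Proof.
move=> Lf wf mD D0.
have mU n : measurable (seqDU D n).
  by apply: measurableD => //; exact: bigsetU_measurable.
suff -> : (fun n => J x (f n \* \1_(D n))) = (fun n => J x (f n \* \1_(seqDU D n))).
  exact: weakly_null_trivIset (trivIset_seqDU D).
apply/funext => n; apply/esym/(cint_ae_eq hm_pos ryb); [exact: L1_mul_indic|exact: L1_mul_indic|].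
have ng : eta.-negligible (\big[setU/set0]_(k < n) (D k `&` D n)).
  rewrite -(bigcup_mkord n (fun k => D k `&` D n)).
  apply: (@negligibleS _ _ _ _ (\bigcup_k (if (k < n)%N then D k `&` D n else set0))).
    by move=> w [k /= kn Dk]; exists k => //; rewrite kn.
  apply: negligible_bigcup => k; case: ifPn => kn; last exact: negligible_set0.
  exists (D k `&` D n); split => //; first exact: measurableI.
  by apply: D0; rewrite neq_ltn kn.
case: ng => Z [mZ Z0 sZ]; exists Z; split => // w /= h; apply: sZ.
rewrite -(bigcup_mkord n (fun k => D k `&` D n)).
apply: contrapT => nw; apply: h; rewrite !indicE.
suff -> : (w \in seqDU D n) = (w \in D n) by [].
apply/idP/idP => /set_mem; first by case=> Dw _; apply/mem_set.
move=> Dw; apply/mem_set; split => //; rewrite -bigcup_mkord => -[k /= kn Dk].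
by apply: nw; exists k.
Qed.

(** On bounded subsets of L^infinity, convergence in L^2(eta) implies
    convergence in measure, hence in L^1(m) by absolute continuity. *)
Lemma small_L2 (e K : R) : 0 < e -> 0 <= K -> exists2 tau : R, 0 < tau & forall W, L W ->
  (forall w, `|W w| <= K) -> ip eta W W <= tau -> normL W <= e.
Proof.
move=> e0 K0; have e2 : 0 < e / 2 by rewrite divr_gt0.
have n1 : 0 < normL (cst 1) + 1 by rewrite ltr_wpDl// normL_ge0.
pose t := e / 2 / (normL (cst 1) + 1); have t0 : 0 < t by rewrite divr_gt0.
have [delta d0 hd] := L1_ac hm_pos ryb (L1_cst m K) e2.
have t2 : 0 < t ^+ 2 by rewrite exprn_gt0.
exists (delta / 2 * t ^+ 2) => [|W LW WK ipW]; first by rewrite mulr_gt0// divr_gt0.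
have mW := L1_mfun LW.
have mn : measurable_fun setT (fun w => `|W w|) by exact: measurableT_comp.
pose A := [set w | t < `|W w|]; have mA : measurable A by exact: measurable_gt.
have mWW : measurable_fun setT (W \* W) by exact: measurable_funM.
have eA : (eta A < delta%:E)%E.
  have bW : bmeas W by split => //; exists K.
  have iW := bmeas_integrable eta_fin (bmeasM bW bW).
  have := @le_integral_comp_abse _ _ _ eta setT measurableT
    (fun w => ((W \* W) w)%:E) (t ^+ 2) id.
  have mEW : measurable_fun setT (fun w => ((W \* W) w)%:E) by exact/measurable_EFinP.
  move=> /(_ (@measurable_id _ _ _)) /(_ (fun r h => h)) /(_ (fun _ _ _ _ h => h)) /(_ mEW t2).
  rewrite setTI => mk.
  have sA : A `<=` [set w | ((t ^+ 2)%:E <= `|((W \* W) w)%:E|)%E].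
    move=> w; rewrite /A /= lee_fin -expr2 normrX => h.
    by rewrite lerXn2r ?nnegrE ?(ltW t0)// ltW.
  have mA2 : measurable [set w | ((t ^+ 2)%:E <= `|((W \* W) w)%:E|)%E].
    rewrite (_ : [set _ | _] = [set w | t ^+ 2 <= `|(W \* W) w|]).
      by apply: measurable_ge; exact: measurableT_comp.
    by apply/seteqP; split => w /=; rewrite lee_fin.
  apply: (@le_lt_trans _ _ (delta / 2)%:E); last first.
    by rewrite lte_fin gtr_pMr// invf_lt1// ltr1n.
  apply: (@le_trans _ _ (eta [set w | ((t ^+ 2)%:E <= `|((W \* W) w)%:E|)%E])).
    by rewrite le_measure ?inE.
  rewrite -(@lee_pmul2l _ (t ^+ 2)%:E)// ?lte_fin//; apply: (le_trans mk).
  rewrite -EFinM mulrC.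
  rewrite (_ : (\int[eta]_w `|((W \* W) w)%:E|)%E = (ip eta W W)%:E) ?lee_fin//.
  rewrite /ip /Rintegral fineK; last by apply: integrable_fin_num.
  by apply: eq_integral => w _; rewrite /= ger0_norm// -expr2 sqr_ge0.
have LK := L1_mul_indic mA (L1_cst m K); have Lt := L1_cst m t.
apply: (@le_trans _ _ (normL (cst t \+ (cst K \* \1_A)))).
  apply: normL_le => //; first exact: L1D.
  move=> w /=; rewrite [leRHS]ger0_norm; last by rewrite addr_ge0 ?(ltW t0)// mulr_ge0.
  rewrite indicE; have [/set_mem Aw|nA] := boolP (w \in A).
    by rewrite mulr1 ler_wpDl// ltW.
  by rewrite mulr0 addr0; move: nA; rewrite notin_setE /A /= => /negP; rewrite -leNgt.
apply: (le_trans (normLD hm_pos Lt LK)); rewrite [leRHS]splitr.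
apply: lerD; last exact/ltW/hd.
rewrite (_ : cst t = t \*o cst 1); last by apply/funext => w /=; rewrite mulr1.
rewrite normLZ; last exact: L1_cst.
rewrite gtr0_norm// /t mulrAC ler_pdivrMr// ler_wpM2l ?(ltW e2)//.
by rewrite lerDl.
Qed.

Lemma L1_avg (a : nat -> Omega -> R) n : (forall k, L (a k)) -> L (avg a n).
Proof. by move=> La; apply: (@L1Z _ _ _ _ X _ _ m n.+1%:R^-1); exact: L1_sum. Qed.

Lemma normL_sum (r : seq nat) (a : nat -> Omega -> R) : (forall k, L (a k)) ->
  normL (fun w => \sum_(k <- r) a k w) <= \sum_(k <- r) normL (a k).
Proof.
move=> La; elim: r => [|k r IH].
  rewrite big_nil (_ : (fun w => _) = 0 \*o cst 0); last first.
    by apply/funext => w; rewrite big_nil /= mul0r.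
  by rewrite normLZ ?normr0 ?mul0r//; exact: L1_0.
rewrite (_ : (fun w => _) = a k \+ (fun w => \sum_(k <- r) a k w)); last first.
  by apply/funext => w; rewrite big_cons.
rewrite big_cons; apply: (le_trans (normLD hm_pos (La k) (L1_sum r La))).
by rewrite lerD2l.
Qed.

Lemma normL_avg_le (a : nat -> Omega -> R) (e : R) n : (forall k, L (a k)) ->
  (forall k, normL (a k) <= e) -> normL (avg a n) <= e.
Proof.
move=> La ae; have n0 : 0 < n.+1%:R^-1 :> R by rewrite invr_gt0.
rewrite -[normL _]/(normL (n.+1%:R^-1 \*o (fun w => \sum_(0 <= k < n.+1) a k w))).
rewrite normLZ; last exact: L1_sum.
rewrite gtr0_norm// ler_pdivrMl//; apply: (le_trans (normL_sum _ La)).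
apply: (@le_trans _ _ (\sum_(0 <= k < n.+1) e)); first by apply: ler_sum => k _.
by rewrite sumr_const_nat subn0 mulr_natl.
Qed.

Lemma avgB (a b : nat -> Omega -> R) n : avg (fun k => a k \- b k) n = avg a n \- avg b n.
Proof.
by apply/funext => w; rewrite /avg /= -mulrBr -sumrB.
Qed.

(** Up to a small error in norm the sequence may be truncated at a height j. The
    Gram matrix of the truncations is bounded, and indices can be chosen so
    that it is asymptotically constant for all heights j at the same time.
    The same then holds along every further subsequence chi. *)
Theorem uniformly_ac_cauchy_averages (g : nat -> Omega -> R) (M : R) :
  (forall n, L (g n)) -> (forall n, normL (g n) <= M) -> uniformly_ac eta (L1 m) (range g) ->
  exists2 psi : nat -> nat, {homo psi : i j / (i < j)%N} &
    forall chi : nat -> nat, {homo chi : i j / (i < j)%N} ->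
    forall e : R, 0 < e -> exists n0, forall p q, (n0 <= p)%N -> (n0 <= q)%N ->
      normL (avg (fun k => g (psi (chi k))) p \- avg (fun k => g (psi (chi k))) q) <= e.
Proof.
move=> Lg gM ug; have mg n : measurable_fun setT (g n) by exact: L1_mfun (Lg n).
have M0 : 0 <= M by exact: le_trans (normL_ge0 m (g 0%N)) (gM 0%N).
pose y (j n : nat) := g n \* \1_(low j%:R (g n)).
have mlow (j n : nat) : measurable (low j%:R (g n)) by exact: measurable_low.
have Ly j n : L (y j n) by exact: L1_mul_indic.
have yj j n w : `|y j n w| <= j%:R.
  rewrite /y /= indicE; have [/set_mem h|_] := boolP (w \in low _ _).
    by rewrite mulr1.
  by rewrite mulr0 normr0.
have ybm j n : bmeas (y j n) by split; [exact: L1_mfun (Ly j n)|exists j%:R].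
have tail e : 0 < e -> exists j, forall n, normL (g n \- y j n) <= e.
  move=> e0; have [delta d0 hd] := ug e e0.
  have [C C0 etaC] := rybakov_le hm_pos ryb.
  have dM : 0 < delta / (C * (M + 1)).
    by rewrite divr_gt0// mulr_gt0// ltr_wpDl.
  have [k hk] := ltr_add_invr dM; rewrite add0r in hk.
  have k0 : 0 < k.+1%:R :> R by rewrite ltr0n.
  exists k.+1 => n; pose A := [set w | k.+1%:R < `|g n w|].
  have mA : measurable A by apply: measurable_gt; exact: measurableT_comp.
  have -> : g n \- y k.+1 n = g n \* \1_A.
    apply/funext => w; rewrite /y /= -[X in X - _]mulr1 -mulrBr; congr (_ * _).
    rewrite !indicE /low /A; have [h|h] := leP `|g n w| k.+1%:R.
      by rewrite mem_set// memNset ?subrr//= ltNge h.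
    by rewrite memNset ?mem_set ?subr0//= leNgt h.
  have LA := L1_mul_indic mA (Lg n).
  have Ad : (eta A < delta%:E)%E.
    apply: (le_lt_trans (etaC _ mA)); rewrite lte_fin.
    have h1 := L1_markov hm_pos (Lg n) k0; rewrite -/A in h1.
    rewrite -ltr_pdivlMl//; apply: (le_lt_trans h1).
    apply: (@le_lt_trans _ _ ((M + 1) * k.+1%:R^-1)).
      by rewrite ler_wpM2r ?invr_ge0// (le_trans (gM n))// lerDl.
    have M1 : 0 < M + 1 by rewrite ltr_wpDl.
    rewrite -ltr_pdivlMl//; apply: (lt_le_trans hk).
    rewrite le_eqVlt; apply/orP; left; apply/eqP; field.
    by rewrite !gt_eqF.
  have := hd A mA Ad; rewrite -lee_fin -fnorm_L1E// => h; apply: ltW; apply: le_lt_trans h.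
  by apply: ereal_sup_ubound; exists (g n) => //; exists n.
have [U UU oU] := free_ultrafilter.
have PU : ProperFilter U by exact: ultra_proper.
(* Gram matrices of the truncated sequences, and their iterated limits *)
pose b j i l := ip eta (y j i) (y j l).
pose Kj (j : nat) : R := j%:R * j%:R * fine (eta setT).
have bK j i l : `|b j i l| <= Kj j.
  have bb := bmeasM (ybm j i) (ybm j l).
  apply: (le_trans (le_normr_Rintegral measurableT (bmeas_integrable eta_fin bb))).
  rewrite /Kj -Rintegral_cst//; apply: le_Rintegral => //.
  - have [mb [K bK]] := bb.
    apply: (@bmeas_integrable _ _ _ eta eta_fin (fun w => `|(y j i \* y j l) w|)).
    by split; [exact: measurableT_comp|exists K => w; rewrite normr_id].
  - apply: (@bmeas_integrable _ _ _ eta eta_fin (cst (j%:R * j%:R))).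
    by split; [exact: measurable_cst|exists `|j%:R * j%:R| => w].
  - by move=> w _; rewrite normrM ler_pM.
have /choice[cf cfP] ji : exists l : R, b ji.1 ji.2 l' @[l' --> U] --> l.
  by apply: (@ultrafilter_lim _ _ _ (Kj ji.1)) => n; exact: bK.
have cK j i : `|cf (j, i)| <= Kj j.
  have h := cfP (j, i); rewrite ler_norml; apply/andP; split.
    apply: (ler_cvg_to (cvg_cst _) h); apply: filterS (@filterT _ U _) => n _.
    by have := bK j i n; rewrite ler_norml => /andP[].
  apply: (ler_cvg_to h (cvg_cst _)); apply: filterS (@filterT _ U _) => n _.
  by have := bK j i n; rewrite ler_norml => /andP[].
have /choice[cc ccP] j : exists l : R, cf (j, i) @[i --> U] --> l.
  by apply: (@ultrafilter_lim _ _ _ (Kj j)) => n; exact: cK.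
pose P (s : seq nat) n := forall j : 'I_(size s).+1, `|cc j - cf (val j, n)| < (size s).+1%:R^-1 /\
  forall r, r \in s -> `|cf (val j, r) - b j r n| < (size s).+1%:R^-1.
have [s N0|psi psih psiP] := @extract_subsequence P.
  have i1 : 0 < (size s).+1%:R^-1 :> R by rewrite invr_gt0.
  have U1 : U [set n | (N0 <= n)%N] by apply: oU; exists N0.
  have U2 : U [set n | P s n].
    apply: filter_forall => j; apply: filterI.
      exact: (cvgr_dist_lt _ _ (ccP j)).
    apply: filter_all_seq => r; exact: (cvgr_dist_lt _ _ (cfP (val j, r))).
  by have [n [/= n1 n2]] := filter_ex (filterI U1 U2); exists n.
have psi_gram j l i : (j <= l)%N -> (l < i)%N ->
    `|b j (psi l) (psi i) - cc j| <= 2 / l.+1%:R.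
  move=> jl li; have := psiP l; rewrite /P size_mkseq => h1.
  have := psiP i; rewrite /P size_mkseq => h2.
  have [{}h1 _] := h1 (Ordinal (jl : (j < l.+1)%N)).
  have [_ {}h2] := h2 (Ordinal (leq_ltn_trans jl (leqW li) : (j < i.+1)%N)).
  have {}h2 : `|cf (j, psi l) - b j (psi l) (psi i)| < i.+1%:R^-1.
    by apply: h2; apply/mapP; exists l => //; rewrite mem_iota.
  have h3 : i.+1%:R^-1 <= l.+1%:R^-1 :> R.
    by rewrite lef_pV2 ?posrE ?ltr0n// ler_nat ltnS ltnW.
  rewrite distrC -(subrKA (cf (j, psi l))); apply: (le_trans (ler_normD _ _)).
  rewrite mulrC mulr_natr mulr2n; apply: lerD; first exact: ltW.
  exact: le_trans (ltW h2) h3.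
exists psi => // chi chih e e0.
have e3 : 0 < e / 3 by rewrite divr_gt0.
have [j hj] := tail _ e3.
have jj0 : 0 <= j%:R + j%:R :> R by rewrite addr_ge0.
have [tau t0 ht] := small_L2 e3 jj0.
pose a k := y j (psi (chi k)); pose g' k := g (psi (chi k)).
have La k : L (a k) by exact: Ly.
have Lg' k : L (g' k) by exact: Lg.
have ba k : bmeas (a k) by exact: ybm.
have [||n0 hn0] := @cauchy_averages _ _ _ eta eta_fin a (cc j) (Kj j + `|cc j|) ba _ _ tau t0.
- by move=> i l; apply: (le_trans (ler_normB _ _)); rewrite lerD2r bK.
- move=> r r0; have r2 : 0 < r / 2 by rewrite divr_gt0.
  have [k hk] := ltr_add_invr r2; rewrite add0r in hk.
  exists (maxn j k) => i l; rewrite geq_max => /andP[ji ki] il.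
  have ci := homo_geq_id chih i.
  apply: (le_trans (psi_gram _ _ _ (leq_trans ji ci) (chih _ _ il))).
  rewrite -ler_pdivlMl// mulrC; apply: le_trans (ltW hk).
  by rewrite lef_pV2 ?posrE ?ltr0n// ler_nat ltnS (leq_trans ki ci).
exists n0 => p q np nq; rewrite -/g'.
have Lap n : L (avg a n) by exact: L1_avg.
have Lgp n : L (avg g' n) by exact: L1_avg.
have Ld k : L (g' k \- a k) by exact: L1B.
have dj n : normL (avg g' n \- avg a n) <= e / 3.
  by rewrite -avgB; apply: normL_avg_le => // k; exact: hj.
have aj n w : `|avg a n w| <= j%:R.
  rewrite /avg normrM gtr0_norm ?invr_gt0// ler_pdivrMl//.
  apply: (le_trans (ler_norm_sum _ _ _)).
  apply: (@le_trans _ _ (\sum_(0 <= k < n.+1) j%:R)); first by apply: ler_sum => k _; exact: yj.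
  by rewrite sumr_const_nat subn0 mulr_natl.
have L1' := L1B (Lgp p) (Lap p); have L2' := L1B (Lap p) (Lap q).
have L3' := L1B (Lgp q) (Lap q).
have -> : avg g' p \- avg g' q =
    ((avg g' p \- avg a p) \+ (avg a p \- avg a q)) \- (avg g' q \- avg a q).
  by apply/funext => w /=; ring.
apply: (le_trans (normLB hm_pos (L1D L1' L2') L3')); rewrite [leRHS](third_sum e).
apply: lerD => //; apply: (le_trans (normLD hm_pos L1' L2')); apply: lerD => //.
apply: ht => //; last exact: hn0.
by move=> w /=; apply: (le_trans (ler_normB _ _)); exact: lerD.
Qed.

End weak_banach_saks.

(** * The weak Banach-Saks property of L^1(m) *)

Section assembly.
Context dS (S : measurableType dS) (R : realType).
Variables (rho : {measure set S -> \bar R}) (X : bfs rho).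
Context d (Omega : measurableType d).
Variable m : vmeasure X Omega.
Hypothesis hm_pos : vm_positive m.
Variable eta : {measure set Omega -> \bar R}.
Hypothesis ryb : rybakov m eta.
Implicit Types (f g : Omega -> R) (A B : set Omega) (x : dual X).

Local Notation Xc := (carrier X).
Local Notation L := (carrier (L1 m)).
Local Notation N := (nrm X).
Local Notation J x f := (cint (scalar_measure m x) f).
Local Notation normL := (normL m).
Local Notation mint := (mint m).

Lemma weakly_null_subseq T (E : fspace T R) (f : nat -> T -> R) (p : nat -> nat) :
  {homo p : i j / (i < j)%N} -> @weakly_null _ _ E f -> @weakly_null _ _ E (fun n => f (p n)).
Proof.
move=> ph wf x; apply/cvgn0P => e e0; have [n0 h] := (cvgn0P _).1 (wf x) e e0.
by exists n0 => n nn; apply: h; exact: leq_trans nn (homo_geq_id ph n).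
Qed.

Lemma average_cvg0 (a : nat -> R) : a n @[n --> \oo] --> (0 : R) ->
  n.+1%:R^-1 * (\sum_(0 <= k < n.+1) a k) @[n --> \oo] --> (0 : R).
Proof.
move=> /cesaro; rewrite /arithmetic_mean /series /=.
by under eq_fun do rewrite mulrC.
Qed.

Lemma cint_avg x (a : nat -> Omega -> R) A n : (forall k, L (a k)) -> measurable A ->
  J x (avg a n \* \1_A) = n.+1%:R^-1 * \sum_(0 <= k < n.+1) J x (a k \* \1_A).
Proof.
move=> La mA; have LA k : L (a k \* \1_A) by exact: L1_mul_indic.
rewrite (_ : avg a n \* \1_A =
  n.+1%:R^-1 \*o (fun w => \sum_(0 <= k < n.+1) (a k \* \1_A) w)); last first.
  by apply/funext => w; rewrite /avg /= -mulrA mulr_suml.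
have Ls := L1_sum (index_iota 0 n.+1) LA.
rewrite cintZ//; congr (_ * _); rewrite -mintE//.
rewrite (dual_ae x (mint_carrier m _) _ (mint_sum _ LA)); last first.
  by apply: bfs_sum => k; exact: mint_carrier.
rewrite dual_sum; last by move=> k; exact: mint_carrier.
by apply: eq_bigr => k _; rewrite mintE.
Qed.

(** On the set where h n > 0 the function f n coincides with h n, and these sets are
    disjoint for different n; likewise where h n < 0. Hence weakly_null_disjoint
    applies to both sets. *)
Lemma mint_disjoint_weakly_null (f g h : nat -> Omega -> R) :
  (forall n, L (f n)) -> (forall n, L (h n)) -> @weakly_null _ _ (L1 m) f ->
  (forall n, {ae eta, forall w, f n w = g n w + h n w}) ->
  (forall n, disjoint_support eta (g n) (h n)) ->
  (forall i j, i != j -> disjoint_support eta (h i) (h j)) ->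
  @weakly_null _ _ X (fun n => mint (fun w => `|h n w|)).
Proof.
move=> Lf Lh wf fgh gh hh x.
have mh n := L1_mfun (Lh n).
pose Dp n := [set w | 0 < h n w]; pose Dn n := [set w | 0 < - h n w].
have mDp n : measurable (Dp n) by exact: measurable_gt.
have mDn n : measurable (Dn n).
  by apply: (@measurable_gt _ _ _ (fun w => - h n w)); exact: measurableT_comp.
have null (D : nat -> set Omega) i j : i != j -> (forall n, measurable (D n)) ->
    (forall n w, D n w -> h n w != 0) -> eta (D i `&` D j) = 0%E.
  move=> ij mD Dh; have [Z [mZ Z0 sZ]] := hh i j ij.
  apply: (subset_measure0 _ mZ _ Z0); first exact: measurableI.
  move=> w [/Dh/eqP Di /Dh/eqP Dj]; apply: sZ => /= -[]; [exact: Di|exact: Dj].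
have cvD (D : nat -> set Omega) : (forall n, measurable (D n)) ->
    (forall n w, D n w -> h n w != 0) -> J x (h n \* \1_(D n)) @[n --> \oo] --> (0 : R).
  move=> mD Dh; rewrite (_ : (fun n => _) = fun n => J x (f n \* \1_(D n))).
    by apply: (weakly_null_disjoint hm_pos ryb) => // i j ij; exact: null.
  apply/funext => n; apply: (cint_ae_eq hm_pos ryb); [exact: L1_mul_indic|exact: L1_mul_indic|].
  apply: filterS2 (fgh n) (gh n) => w fw gw /=; rewrite indicE.
  have [/set_mem/Dh/eqP h0|_] := boolP (w \in D n); last by rewrite !mulr0.
  by rewrite fw; case: gw => [->|/h0//]; rewrite add0r.
have cp := cvD Dp mDp (fun n w (h0 : 0 < h n w) => lt0r_neq0 h0).
have cn : J x (h n \* \1_(Dn n)) @[n --> \oo] --> (0 : R).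
  by apply: cvD => // n w; rewrite /Dn /= oppr_gt0 => h0; rewrite lt_eqF.
have := cvgB cp cn; rewrite subr0.
suff -> : (fun n => x (mint (fun w => `|h n w|))) =
  (fun n => J x (h n \* \1_(Dp n)) - J x (h n \* \1_(Dn n))) by move=> H; exact: H.
apply/funext => n /=; have Lp := L1_mul_indic (mDp n) (Lh n).
have Ln := L1_mul_indic (mDn n) (Lh n).
rewrite mintE; last exact: L1_norm.
rewrite -cintB//; congr cint; apply/funext => w /=; rewrite !indicE.
have [h0|h0|h0] := ltgtP (h n w) 0.
- rewrite memNset; last by rewrite /Dp /= => /ltW; rewrite leNgt h0.
  by rewrite mem_set ?mulr0 ?mulr1 ?sub0r ?ltr0_norm// /Dn /= oppr_gt0.
- rewrite mem_set// memNset ?mulr1 ?mulr0 ?subr0 ?gtr0_norm//.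
  by rewrite /Dn /= oppr_gt0 => /ltW; rewrite leNgt h0.
- by rewrite h0 !mul0r subr0 normr0.
Qed.

Lemma fnorm_avgE (f : nat -> Omega -> R) (p : nat -> nat) n : (forall n, L (f n)) ->
  fnorm (L1 m) (fun t => n.+1%:R^-1 * \sum_(0 <= k < n.+1) f (p k) t) =
  (normL (avg (fun k => f (p k)) n))%:E.
Proof. by move=> Lf; rewrite -fnorm_L1E//; exact: L1_avg. Qed.

Lemma normL_avg_disjoint_le (h : nat -> Omega -> R) n : (forall n, L (h n)) ->
  normL (avg h n) <= N (avg (fun k => mint (fun w => `|h k w|)) n).
Proof.
move=> Lh; have La k : L (fun w => `|h k w|) by exact: L1_norm.
have Lav := L1_avg n La.
apply: (@le_trans _ _ (normL (avg (fun k w => `|h k w|) n))).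
  apply: normL_le => //; first exact: L1_avg.
  move=> w; rewrite /avg [leRHS]ger0_norm; last first.
    by rewrite mulr_ge0 ?invr_ge0//; apply: sumr_ge0.
  by rewrite normrM ger0_norm ?invr_ge0// ler_wpM2l ?invr_ge0// ler_norm_sum.
have Xs : Xc (fun s => \sum_(0 <= k < n.+1) mint (fun w => `|h k w|) s).
  by apply: bfs_sum => k; exact: mint_carrier.
have XA : Xc (avg (fun k => mint (fun w => `|h k w|)) n).
  exact: (@bfsZ _ _ _ _ X n.+1%:R^-1 _ Xs).
rewrite le_eqVlt; apply/orP; left; apply/eqP.
apply: nrm_ae => //; first exact: mint_carrier.
rewrite (_ : (fun w => _) = n.+1%:R^-1 \*o (fun w => \sum_(0 <= k < n.+1) `|h k w|)); last first.
  apply/funext => w; rewrite ger0_norm//.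
  by rewrite /avg mulr_ge0 ?invr_ge0//; apply: sumr_ge0.
have Ls := L1_sum (index_iota 0 n.+1) La.
apply: filterS2 (mintZ n.+1%:R^-1 Ls) (mint_sum (index_iota 0 n.+1) La) => s -> /= ->.
by [].
Qed.

(** The subsequence is extracted first for the equi-integrable part, since the
    Cauchy property of its means is inherited by subsequences, and then for the
    disjoint part by the property of X. *)
Theorem L1_weak_Banach_Saks : weak_Banach_Saks X ->
  subsequence_splitting eta (L1 m) -> weak_Banach_Saks (L1 m).
Proof.
move=> wX [_ splitL] f Lf wf.
have [M fM] := L1_weakly_null_bounded hm_pos Lf wf.
have [|p [g [h [ph Lgh fgh ug dh]]]] := splitL f Lf.
  by exists M => n; rewrite fnorm_L1E ?lee_fin //; exact: Lf.
have Lg n : L (g n) by have [] := Lgh n.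
have Lh n : L (h n) by have [] := Lgh n.
have fE n : {ae eta, forall w, f (p n) w = g n w + h n w} by have [] := fgh n.
have gh n : disjoint_support eta (g n) (h n) by have [] := fgh n.
have gM n : normL (g n) <= M.
  apply: le_trans (fM (p n)); apply: (normL_ae_le hm_pos ryb) => //.
  apply: filterS2 (fE n) (gh n) => w ->; case=> ->; first by rewrite normr0.
  by rewrite addr0.
have [psi psih psiC] := uniformly_ac_cauchy_averages hm_pos ryb Lg gM ug.
have wp := weakly_null_subseq ph wf.
have wH := mint_disjoint_weakly_null (fun n => Lf (p n)) Lh wp fE gh dh.
have wHp := weakly_null_subseq psih wH.
have [chi chih chiC] := wX _ (fun n => mint_carrier m _) wHp.
pose s k := psi (chi k).
have sh : {homo s : i j / (i < j)%N} by move=> i j ij; apply: psih; exact: chih.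
exists (p \o s); first by move=> i j ij; apply: ph; exact: sh.
have {}psiC := psiC chi chih; rewrite -/s in psiC.
pose G n := avg (fun k => g (s k)) n; pose Hh n := avg (fun k => h (s k)) n.
have LG n : L (G n) by exact: L1_avg.
have LHh n : L (Hh n) by exact: L1_avg.
have Hc : forall e : R, 0 < e -> exists n0, forall n, (n0 <= n)%N -> normL (Hh n) <= e.
  move=> e e0; pose V n := avg (fun k => mint (fun w => `|h (s k) w|)) n.
  have XV n : Xc (V n).
    have Xs : Xc (fun t => \sum_(0 <= k < n.+1) mint (fun w => `|h (s k) w|) t).
      by apply: bfs_sum => k; exact: mint_carrier.
    exact: (@bfsZ _ _ _ _ X n.+1%:R^-1 _ Xs).
  have cV : N (V n) @[n --> \oo] --> (0 : R) by exact: fine_cvg chiC.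
  have [n0 hn0] := (cvgn0P _).1 cV e e0; exists n0 => n /hn0 Vn.
  apply: (le_trans (normL_avg_disjoint_le n (fun k => Lh (s k)))).
  by apply: ltW; apply: le_lt_trans Vn; exact: ler_norm.
have fs_ae n : {ae eta, forall w, avg (fun k => f (p (s k))) n w = G n w + Hh n w}.
  have : {ae eta, forall w, forall k, f (p (s k)) w = g (s k) w + h (s k) w}.
    by apply: ae_foralln => k; exact: fE.
  apply: filterS => w fw; rewrite /G /Hh /avg -mulrDr -big_split/=.
  by congr (_ * _); apply: eq_bigr => k _.
have LF n : L (avg (fun k => f (p (s k))) n) by apply: L1_avg => k; exact: Lf.
have Gw x A : @dual_ball _ _ X x -> measurable A ->
    forall e : R, 0 < e -> exists n0, forall n, (n0 <= n)%N -> `|J x (G n \* \1_A)| <= e.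
  move=> bx mA e e0; have e2 : 0 < e / 2 by rewrite divr_gt0.
  have [n1 h1] := Hc _ e2.
  have ws := weakly_null_subseq sh wp.
  have := average_cvg0 (weakly_null_cint hm_pos x (fun n => Lf (p (s n))) mA ws).
  move=> /cvgn0P /(_ _ e2)[n2 h2].
  exists (maxn n1 n2) => n; rewrite geq_max => /andP[nn1 nn2].
  have LFA := L1_mul_indic mA (LF n); have LHA := L1_mul_indic mA (LHh n).
  have LGA := L1_mul_indic mA (LG n).
  have -> : J x (G n \* \1_A) =
      J x (avg (fun k => f (p (s k))) n \* \1_A) - J x (Hh n \* \1_A).
    rewrite -cintB//; apply: (cint_ae_eq hm_pos ryb) => //; first exact: L1B.
    by apply: filterS (fs_ae n) => w /= ->; ring.
  apply: (le_trans (ler_normB _ _)); rewrite [leRHS]splitr; apply: lerD.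
    by rewrite cint_avg//; apply: ltW; apply: h2.
  apply: (le_trans (cint_ball_le hm_pos LHA bx)); apply: le_trans (h1 n nn1).
  by apply: normL_le => // w; exact: normr_mul_indic_le.
(* A Cauchy sequence which tends weakly to 0 tends to 0 in norm: a functional
   that norms G n is small on G k for k large. *)
have Gc : forall e : R, 0 < e -> exists n0, forall n, (n0 <= n)%N -> normL (G n) <= e.
  move=> e e0; have e3 : 0 < e / 3 by rewrite divr_gt0.
  have [n0 hn0] := psiC _ e3; exists n0 => n nn.
  have [x [bx px xE]] := normL_norming hm_pos (LG n).
  have [P mP GP] := norm_signed (L1_mfun (LG n)).
  have mC := measurableC mP.
  have [n1 h1] := Gw x _ bx mP _ e3; have [n2 h2] := Gw x _ bx mC _ e3.
  pose k := maxn n0 (maxn n1 n2).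
  have k0 : (n0 <= k)%N by exact: leq_maxl.
  have k1 : (n1 <= k)%N by rewrite /k leq_max leq_maxl orbT.
  have k2 : (n2 <= k)%N by rewrite /k leq_max leq_maxr orbT.
  have {}h1 := h1 k k1; have {}h2 := h2 k k2.
  have LB := L1B (LG n) (LG k).
  have GE : (fun w => `|G n w|) =
      ((G n \- G k) \* signed R P) \+ ((G k \* \1_P) \- (G k \* \1_(~` P))).
    by rewrite -mul_signed GP; apply/funext => w /=; rewrite -mulrDl subrK.
  have LP := L1_mul_indic mP (LG k); have LC := L1_mul_indic mC (LG k).
  rewrite -xE GE cintD//; [|exact: L1_mul_signed|exact: L1B].
  rewrite cintB//; apply: (le_trans (ler_norm _)); apply: (le_trans (ler_normD _ _)).
  rewrite [leRHS](_ : e = e / 3 + (e / 3 + e / 3)); last by field.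
  apply: lerD; last by apply: (le_trans (ler_normB _ _)); exact: lerD.
  have Lt := L1_mul_signed mP LB; apply: (le_trans (cint_ball_le hm_pos Lt bx)).
  by apply: le_trans (hn0 n k nn k0); apply: normL_le => // w; rewrite normr_mul_signed.
rewrite (_ : (fun n => fnorm _ _) = (fun n => (normL (avg (fun k => f (p (s k))) n))%:E)).
  apply: cvg_EFin; first exact: nearW.
  apply/cvgn0P => e e0; have e2 : 0 < e / 3 by rewrite divr_gt0.
  have [n1 h1] := Gc _ e2; have [n2 h2] := Hc _ e2.
  exists (maxn n1 n2) => n; rewrite geq_max => /andP[nn1 nn2].
  rewrite ger0_norm ?normL_ge0//.
  rewrite (normL_ae_eq hm_pos ryb (LF n) (L1D (LG n) (LHh n)) (fs_ae n)).
  apply: (le_lt_trans (normLD hm_pos (LG n) (LHh n))).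
  rewrite [ltRHS](third_sum e); apply: (@le_lt_trans _ _ (e / 3 + e / 3)).
    by apply: lerD; [exact: h1|exact: h2].
  by rewrite ltrDl.
apply/funext => n; exact: (fnorm_avgE (p \o s)).
Qed.

End assembly.

Theorem theorem6 (R : realType) (dS : measure_display) (S : measurableType dS)
    (rho : {finite_measure set S -> \bar R}) (X : bfs rho)
    (d : measure_display) (Omega : measurableType d) (m : vmeasure X Omega)
    (hX_wBS : weak_Banach_Saks X)
    (hX_split : subsequence_splitting rho X)
    (hX'_split : subsequence_splitting rho (associate rho X))
    (hm_sep : vm_separable m)
    (hm_pos : vm_positive m)
    (hm_ac : uniformly_ac rho X (vm_range m)) :
  (forall eta : {measure set Omega -> \bar R},
     rybakov m eta -> subsequence_splitting eta (L1 m)) /\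
  weak_Banach_Saks (L1 m).
Proof.
have rho_fin : (rho setT < +oo)%E by rewrite ltey_eq fin_num_measure.
have split (eta : {measure set Omega -> \bar R}) :
    rybakov m eta -> subsequence_splitting eta (L1 m).
  move=> ryb; exact: (L1_splitting hm_pos rho_fin ryb hX_split).
split=> //; have [x0 ryb] := rybakov_exists hm_pos hm_sep.
exact: (L1_weak_Banach_Saks hm_pos ryb hX_wBS (split _ ryb)).
Qed.
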